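(* Assume the minimax problem, the standing assumptions (C1)–(C4) and the Acc-MDA algorithm described in the context, with constrained set $\mathcal{X}\subset\mathbb{R}^{d_1}$, and parameters satisfying $\eta_t=\frac{k}{(m+t)^{1/3}}$ for all $t\ge0$, $c_1\ge\frac{2}{3k^3}+\frac{9\tau^2}{4}$, $c_2\ge\frac{2}{3k^3}+\frac{75L_f^2}{2}$, $k>0$, $m\ge\max\big(2,k^3,(c_1k)^3,(c_2k)^3\big)$, $0<\lambda\le\min\big(\frac{1}{6L_f},\frac{27b\tau}{16}\big)$ and $0<\gamma\le\min\Big(\frac{\lambda\tau}{2L_f}\sqrt{\frac{2b}{8\lambda^2+75\kappa_y^2b}},\frac{m^{1/3}}{2L_gk}\Big)$. Suppose the batch size $b$ is of order $\kappa_y^{\nu}$ for some $\nu>0$ and $\frac{27b\tau}{16}\le\frac{1}{6L_f}$ (i.e., for $b=\kappa_y^\nu$, $\kappa_y^{\nu}\le\frac{8}{81L_f\tau}$). Then, for a suitable choice of parameters satisfying these conditions, Acc-MDA has gradient complexity $$\tilde O\big(\kappa_y^{(4.5-\nu/2)}\epsilon^{-3}\big)$$ for finding an $\epsilon$-stationary point.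
   Context: Problem: $\min_{x\in\mathcal{X}}\max_{y\in\mathcal{Y}}f(x,y)$, $f(x,y)=\mathbb{E}_{\xi\sim\mathcal{D}'}[f(x,y;\xi)]$, with $f(\cdot,\cdot;\xi)$ differentiable, $\xi$ a random variable with distribution $\mathcal{D}'$, $\mathcal{X}\subset\mathbb{R}^{d_1}$ compact convex, and $\mathcal{Y}\subset\mathbb{R}^{d_2}$ compact convex or $\mathcal{Y}=\mathbb{R}^{d_2}$. $\|\cdot\|$ is the Euclidean norm; $\mathcal{P}_{\mathcal{X}},\mathcal{P}_{\mathcal{Y}}$ are Euclidean projections. $\nabla_x,\nabla_y$ are partial gradients and $\nabla f=(\nabla_xf,\nabla_yf)$. For a mini-batch $\mathcal{B}=\{\xi_1,\dots,\xi_b\}$, $\nabla_xf(x,y;\mathcal{B})=\frac1b\sum_{i=1}^b\nabla_xf(x,y;\xi_i)$, and likewise for $\nabla_y$. Standing assumptions. (C1) There is $\delta>0$ such that for all $x,y$: $\mathbb{E}\|\nabla_xf(x,y;\xi)-\nabla_xf(x,y)\|^2\le\delta^2$ and $\mathbb{E}\|\nabla_yf(x,y;\xi)-\nabla_yf(x,y)\|^2\le\delta^2$. (C2) $\|\nabla f(x,y;\xi)-\nabla f(x',y';\xi)\|\le L_f\|(x,y)-(x',y')\|$ for all $x,x'\in\mathcal{X}$, $y,y'\in\mathcal{Y}$. (C3) $f$ is $\tau$-strongly concave in $y$ ($\tau>0$): $f(x,y)\le f(x,y')+\langle\nabla_yf(x,y'),y-y'\rangle-\frac\tau2\|y-y'\|^2$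 for $x\in\mathcal{X}$, $y,y'\in\mathcal{Y}$. (C4) $F^*=\inf_{x\in\mathcal{X}}F(x)>-\infty$. Notation: $y^*(x)=\arg\max_{y\in\mathcal{Y}}f(x,y)$, $F(x)=\max_{y\in\mathcal{Y}}f(x,y)=f(x,y^*(x))$, $\kappa_y=L_f/\tau$, $L_g=L_f+L_f^2/\tau$. Acc-MDA algorithm (constrained case), with parameters $\gamma,\lambda,k,m,c_1,c_2$, batch size $b\ge1$, horizon $T$, initial $x_1\in\mathcal{X}$, $y_1\in\mathcal{Y}$: draw a mini-batch $\mathcal{B}_1$ of $b$ i.i.d. samples; set $v_1=\nabla_xf(x_1,y_1;\mathcal{B}_1)$, $w_1=\nabla_yf(x_1,y_1;\mathcal{B}_1)$. For $t=1,\dots,T$: $\eta_t=\frac{k}{(m+t)^{1/3}}$; $\tilde x_{t+1}=\mathcal{P}_{\mathcal{X}}(x_t-\gamma v_t)$, $x_{t+1}=x_t+\eta_t(\tilde x_{t+1}-x_t)$; $\tilde y_{t+1}=\mathcal{P}_{\mathcal{Y}}(y_t+\lambda w_t)$, $y_{t+1}=y_t+\eta_t(\tilde y_{t+1}-y_t)$; $\alpha_{t+1}=c_1\eta_t^2$, $\beta_{t+1}=c_2\eta_t^2$; draw a fresh independent mini-batch $\mathcal{B}_{t+1}$ of $b$ i.i.d. samples; $v_{t+1}=\nabla_xf(x_{t+1},y_{t+1};\mathcal{B}_{t+1})+(1-\alpha_{t+1})[v_t-\nabla_xf(x_t,y_t;\mathcal{B}_{t+1})]$, $w_{t+1}=\nabla_yf(x_{t+1},y_{t+1};\mathcal{B}_{t+1})+(1-\beta_{t+1})[w_t-\nabla_yf(x_t,y_t;\mathcal{B}_{t+1})]$.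 Complexity: let $\mathcal{H}_t=\frac1\gamma\|\tilde x_{t+1}-x_t\|+\|\nabla_xf(x_t,y_t)-v_t\|+L_f\|y_t-y^*(x_t)\|$ and let $\zeta$ be uniformly random in $\{1,\dots,T\}$, independent of the rest. An $\epsilon$-stationary point ($0<\epsilon\le1$) is found when $\mathbb{E}[\mathcal{H}_\zeta]\le\epsilon$. The gradient complexity is the total number $4bT$ of stochastic partial gradients evaluated over the $T$ iterations ($4b$ per iteration) for a $T$ ensuring this. $\tilde O(\cdot)$ hides logarithmic factors and multiplicative constants; only the dependence on $\kappa_y$ (with $b$ of order $\kappa_y^\nu$) and $\epsilon$ is tracked, all other quantities ($L_f$, $\delta$, $F(x_1)-F^*$, $\|y_1-y^*(x_1)\|$, $\nu$) being treated as constants.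
   Formalization: The mean objective is assumed differentiable and the stochastic gradients unbiased on X×Y (E∇f(x,y;ξ)=∇f(x,y)); unbiasedness follows from (C1)–(C2) if X×Y has nonempty interior, but the claim can fail without it when X×Y has empty interior. *)

(* Defs.v *)
From HB Require Import structures.
From mathcomp Require Import all_boot all_order all_algebra.
From mathcomp Require Import all_classical all_reals all_analysis.

Set Implicit Arguments.
Unset Strict Implicit.
Unset Printing Implicit Defensive.
Import Order.TTheory GRing.Theory Num.Theory.
Import numFieldNormedType.Exports.

Local Open Scope classical_set_scope.
Local Open Scope ring_scope.

Section Euclidean.
Context {R : realType} {d : nat}.
Implicit Types (u v z : 'rV[R]_d) (A : set 'rV[R]_d).

Definition dot u v : R := \sum_i u 0 i * v 0 i.

(* The library norm on ['rV_d] is the sup norm, hence a separate Euclidean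
   norm; topology and differentiability are the same for both. *)
Definition enorm u : R := Num.sqrt (dot u u).

Definition eproj A z : 'rV[R]_d :=
  get [set u | A u /\ forall w, A w -> enorm (u - z) <= enorm (w - z)].

End Euclidean.

Definition enorm2 {R : realType} {d1 d2 : nat} (u : 'rV[R]_d1) (v : 'rV[R]_d2)
  : R := Num.sqrt (enorm u ^+ 2 + enorm v ^+ 2).

Section Gradients.
Context {R : realType} {d1 d2 : nat}.
Implicit Types (g : 'rV[R]_d1 -> 'rV[R]_d2 -> R).

Definition gradx g (x : 'rV[R]_d1) (y : 'rV[R]_d2) : 'rV[R]_d1 :=
  \row_i 'D_(delta_mx 0 i) (fun u : 'rV[R]_d1 => g u y) x.

Definition grady g (x : 'rV[R]_d1) (y : 'rV[R]_d2) : 'rV[R]_d2 :=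
  \row_i 'D_(delta_mx 0 i) (fun u : 'rV[R]_d2 => g x u) y.

Definition differentiable2 g (x : 'rV[R]_d1) (y : 'rV[R]_d2) : Prop :=
  differentiable (fun z : 'rV[R]_d1 * 'rV[R]_d2 => g z.1 z.2) (x, y).

End Gradients.

Section Problem.
Context {R : realType} {d1 d2 : nat}.
Context {d : measure_display} {Xi : measurableType d} (D : probability Xi R).
Context (f : 'rV[R]_d1 -> 'rV[R]_d2 -> Xi -> R).
Context (X : set 'rV[R]_d1) (Y : set 'rV[R]_d2).

Definition fmean (x : 'rV[R]_d1) (y : 'rV[R]_d2) : R := fine ('E_D[f x y])%E.

Definition sgradx (s : Xi) := gradx (fun x y => f x y s).
Definition sgrady (s : Xi) := grady (fun x y => f x y s).

(* [f (., .; s)] and its mean are functions on the whole space, differentiable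
   (as such) at the points of [X * Y], where the partial gradients of the mean
   are the means of the stochastic partial gradients. The latter identity is
   the unbiasedness of the stochastic oracle; it follows from
   [lipschitz_gradient] when [X * Y] has nonempty interior, but not in general
   (e.g. when [X] is a singleton). *)
Definition stochastic_objective : Prop :=
  [/\ (forall x y, D.-integrable setT (EFin \o f x y)),
      (forall s x y, X x -> Y y -> differentiable2 (fun u v => f u v s) x y),
      (forall x y, X x -> Y y -> differentiable2 fmean x y),
      (forall x y i, X x -> Y y ->
        ('E_D[fun s => (sgradx s x y 0 i)%R] = (gradx fmean x y 0 i)%R%:E)%E) &
      (forall x y i, X x -> Y y ->
        ('E_D[fun s => (sgrady s x y 0 i)%R] = (grady fmean x y 0 i)%R%:E)%E)].

Definition bounded_variance (delta : R) : Prop :=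
  forall x y, X x -> Y y ->
    ('E_D[fun s => (enorm (sgradx s x y - gradx fmean x y) ^+ 2)%R]
       <= (delta ^+ 2)%:E)%E /\
    ('E_D[fun s => (enorm (sgrady s x y - grady fmean x y) ^+ 2)%R]
       <= (delta ^+ 2)%:E)%E.

Definition lipschitz_gradient (Lf : R) : Prop :=
  forall s x x' y y', X x -> X x' -> Y y -> Y y' ->
    enorm2 (sgradx s x y - sgradx s x' y') (sgrady s x y - sgrady s x' y')
      <= Lf * enorm2 (x - x') (y - y').

Definition strongly_concave (tau : R) : Prop :=
  forall x y y', X x -> Y y -> Y y' ->
    fmean x y <= fmean x y' + dot (grady fmean x y') (y - y')
                 - tau / 2 * enorm (y - y') ^+ 2.

Definition ystar (x : 'rV[R]_d1) : 'rV[R]_d2 :=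
  get [set y | Y y /\ forall y', Y y' -> fmean x y' <= fmean x y].

Definition Fmax (x : 'rV[R]_d1) : R := fmean x (ystar x).

Definition Fstar : R := inf (Fmax @` X).

End Problem.

Section AccMDA.
Context {R : realType} {d1 d2 : nat}.
Context {d : measure_display} {Xi : measurableType d} (D : probability Xi R).
Context (f : 'rV[R]_d1 -> 'rV[R]_d2 -> Xi -> R).
Context (X : set 'rV[R]_d1) (Y : set 'rV[R]_d2).
Context (b : nat) (k m c1 c2 lambda gamma : R).
Context (x1 : 'rV[R]_d1) (y1 : 'rV[R]_d2).

Definition bgradx (B : 'I_b -> Xi) x y : 'rV[R]_d1 :=
  b%:R^-1 *: \sum_(i < b) sgradx f (B i) x y.
Definition bgrady (B : 'I_b -> Xi) x y : 'rV[R]_d2 :=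
  b%:R^-1 *: \sum_(i < b) sgrady f (B i) x y.

Definition eta (t : nat) : R := k / (m + t%:R) `^ (3^-1).

Record state := State {
  st_x : 'rV[R]_d1; st_y : 'rV[R]_d2; st_v : 'rV[R]_d1; st_w : 'rV[R]_d2 }.

Definition xtilde (S : state) := eproj X (st_x S - gamma *: st_v S).
Definition ytilde (S : state) := eproj Y (st_y S + lambda *: st_w S).

Definition acc_init (B : 'I_b -> Xi) : state :=
  State x1 y1 (bgradx B x1 y1) (bgrady B x1 y1).

(* [B] is the mini-batch of time [t.+1]. *)
Definition acc_step (t : nat) (B : 'I_b -> Xi) (S : state) : state :=
  let: State x y v w := S in
  let x' := x + eta t *: (xtilde S - x) in
  let y' := y + eta t *: (ytilde S - y) in
  let alpha := c1 * eta t ^+ 2 in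
  let beta := c2 * eta t ^+ 2 in
  State x' y'
    (bgradx B x' y' + (1 - alpha) *: (v - bgradx B x y))
    (bgrady B x' y' + (1 - beta) *: (w - bgrady B x y)).

(* Times start at 1, [B t] is the mini-batch drawn at time [t]; the value at
   time 0 is a dummy. *)
Fixpoint accmda (B : nat -> 'I_b -> Xi) (t : nat) : state :=
  match t with
  | 0%N => acc_init (B 1%N)
  | t'.+1 => match t' with
             | 0%N => acc_init (B 1%N)
             | _ => acc_step t' (B t) (accmda B t')
             end
  end.

Definition stationarity (Lf : R) (S : state) : R :=
  gamma^-1 * enorm (xtilde S - st_x S)
  + enorm (gradx (fmean D f) (st_x S) (st_y S) - st_v S)
  + Lf * enorm (st_y S - ystar D f Y (st_x S)).

End AccMDA.

Section Sampling.
Context {R : realType} {d : measure_display} {Omega : measurableType d}.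
Context (P : probability Omega R).

Definition mutually_independent {I : choiceType} (G : I -> set (set Omega))
  : Prop :=
  forall (J : seq I) (A : I -> set Omega), uniq J ->
    (forall i, i \in J -> G i (A i)) ->
    P (\bigcap_(i in [set` J]) A i) = (\prod_(i <- J) P (A i))%E.

Definition sigma_of {d'} {T : measurableType d'} (Z : {RV P >-> T})
  : set (set Omega) := preimage_set_system setT Z measurable.

(* The samples [xi t i] (the [i]-th one of the batch of time [t]) are i.i.d.
   with law [D], [zeta] is uniform on {1, ..., T}, and all of them are mutually
   independent. *)
Definition sampling {d'} {Xi : measurableType d'} (D : probability Xi R)
    (b T : nat) (xi : nat -> 'I_b -> {RV P >-> Xi}) (zeta : {RV P >-> nat})
  : Prop :=
  [/\ (forall t i A, measurable A -> distribution P (xi t i) A = D A),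
      (forall t, (1 <= t <= T)%N ->
         distribution P zeta [set t] = (T%:R^-1)%:E) &
      mutually_independent (fun j : option (nat * 'I_b) =>
        if j is Some (t, i) then sigma_of (xi t i) else sigma_of zeta)].

End Sampling.

(* Main.v *)
(** With [y*(x)] the maximiser of [f(x, .)], the function
    [F(x) + p ||y - y*(x)||^2] is a Lyapunov function along each trajectory:
    a step decreases it by multiples of [||x~ - x||^2], [||y~ - y||^2] and
    [||y - y*(x)||^2], up to the squared errors of the gradient estimators [v]
    and [w]. These errors obey in expectation
    [E_(t+1) <= (1 - c eta_t^2) E_t + O(eta_t^4 + eta_t^2 moves_t) / b], since
    each sample is independent of the past sigma-algebra and may be integrated
    out first (Fubini), which kills the cross terms. Divided by [eta_t], this
    recursion telescopes because [1/eta_(t+1) - 1/eta_t <= eta_(t+1)], and the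
    moves are absorbed by the Lyapunov decrease. The sum of [eta_t^3] is at most
    [ln (1 + T)]. With [k = 1], [lambda] of order [b tau] and [gamma] of order
    [b tau^3], the resulting rate is
    [E[H^2] <= O(kappa^3 / b * ln T * T^(-2/3))], so that [T] of order
    [(kappa^3 / b)^(3/2) eps^-3], up to logarithms, suffices. *)

Require Import Defs.
From HB Require Import structures.
From mathcomp Require Import all_boot all_order all_algebra.
From mathcomp Require Import all_classical all_reals all_analysis.
From mathcomp Require Import measurable_realfun.
From mathcomp Require Import ring lra.
Set Implicit Arguments.
Unset Strict Implicit.
Unset Printing Implicit Defensive.
Import Order.TTheory GRing.Theory Num.Theory.
Import numFieldNormedType.Exports.
Local Open Scope classical_set_scope.
Local Open Scope ring_scope.

(** * Euclidean geometry *)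

(** No moment bound on the iterates is assumed, and [Y] may be the whole space. Finiteness of the
    expectations is therefore proved along the way: errors of finite mean up to time t bound the
    moves at time t through the Lyapunov inequality, and these moves bound the errors at time t+1.
    Measurability has to be earned too: a stochastic gradient is measurable in the sample at a fixed
    point and Lipschitz in the point, which makes its value at a random point measurable;
    projections and the maximiser map are Lipschitz as well. The parameters rest on one consequence
    of the batch hypothesis: b tau, hence tau, is at most t0 = 8 / (81 Lf). So kappa is bounded
    below, lower powers of kappa are absorbed by higher ones, and the momentum constants and m can
    be chosen independently of tau and b. The dominant term of the bound is the initial gap divided
    by gamma, of order kappa^3 / b; the gradient noise contributes only kappa^2 / b, up to the
    logarithm. Finally b (kappa^3 / b)^(3/2) = kappa^(9/2) b^(-1/2) gives the exponent. *)

Section EuclideanGeometry.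
Context {R : realType} {d : nat}.
Implicit Types (u v w z : 'rV[R]_d) (A : set 'rV[R]_d).

Lemma dotC u v : dot u v = dot v u.
Proof. by apply: eq_bigr => i _; rewrite mulrC. Qed.

Lemma dotDl u v w : dot (u + v) w = dot u w + dot v w.
Proof.
by rewrite /dot -big_split; apply: eq_bigr => i _; rewrite mxE mulrDl.
Qed.

Lemma dotZl a u v : dot (a *: u) v = a * dot u v.
Proof. by rewrite /dot mulr_sumr; apply: eq_bigr => i _; rewrite mxE mulrA. Qed.

Lemma dotNl u v : dot (- u) v = - dot u v.
Proof. by rewrite -scaleN1r dotZl mulN1r. Qed.

Lemma dotDr u v w : dot u (v + w) = dot u v + dot u w.
Proof. by rewrite dotC dotDl !(dotC _ u). Qed.

Lemma dotZr a u v : dot u (a *: v) = a * dot u v.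
Proof. by rewrite dotC dotZl dotC. Qed.

Lemma dotNr u v : dot u (- v) = - dot u v.
Proof. by rewrite dotC dotNl dotC. Qed.

Lemma dot0l u : dot 0 u = 0.
Proof. by rewrite -(scale0r 0) dotZl mul0r. Qed.

Definition dotE := (dotDl, dotDr, dotNl, dotNr, dotZl, dotZr).

Lemma dot_ge0 u : 0 <= dot u u.
Proof. by apply: sumr_ge0 => i _; rewrite -expr2 sqr_ge0. Qed.

Lemma dot_eq0 u : dot u u = 0 -> u = 0.
Proof.
move=> /eqP; rewrite psumr_eq0; last by move=> i _; rewrite -expr2 sqr_ge0.
move=> /allP u0; apply/rowP => i; have := u0 i (mem_index_enum i).
by rewrite mxE /= mulf_eq0 orbb => /eqP.
Qed.

Lemma sqr_enorm u : enorm u ^+ 2 = dot u u.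
Proof. by rewrite sqr_sqrtr ?dot_ge0. Qed.

Lemma enorm_ge0 u : 0 <= enorm u. Proof. exact: sqrtr_ge0. Qed.

Lemma enorm0 : enorm (0 : 'rV[R]_d) = 0.
Proof. by rewrite /enorm dot0l sqrtr0. Qed.

Lemma enormZ a u : enorm (a *: u) = `|a| * enorm u.
Proof.
by rewrite /enorm !dotE mulrA -expr2 sqrtrM ?sqr_ge0// sqrtr_sqr.
Qed.

Lemma enormN u : enorm (- u) = enorm u.
Proof. by rewrite -scaleN1r enormZ normrN normr1 mul1r. Qed.

Lemma enormBC u v : enorm (u - v) = enorm (v - u).
Proof. by rewrite -enormN opprB. Qed.

(** The square of [(2 * a) *: u - v] is nonnegative; divide its expansion by [4 * a]. *)
Lemma dot_le_young a u v : 0 < a -> dot u v <= a * dot u u + dot v v / (4 * a).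
Proof.
move=> a0; have := dot_ge0 ((2 * a) *: u - v); rewrite !dotE (dotC v u) => H.
have -> : a * dot u u + dot v v / (4 * a) =
    dot u v + (2 * a * (2 * a * dot u u - dot u v) -
                (2 * a * dot u v - dot v v)) / (4 * a) by field; lra.
rewrite lerDl divr_ge0//; lra.
Qed.

Lemma cauchy_schwarz u v : dot u v <= enorm u * enorm v.
Proof.
have [->|u0] := eqVneq u 0; first by rewrite dot0l mulr_ge0 ?enorm_ge0.
have [->|v0] := eqVneq v 0; first by rewrite dotC dot0l mulr_ge0 ?enorm_ge0.
have nu : 0 < enorm u.
  by rewrite lt0r enorm_ge0 andbT; apply: contra u0 => /eqP nu;
     apply/eqP/dot_eq0; rewrite -sqr_enorm nu expr0n.
have nv : 0 < enorm v.
  by rewrite lt0r enorm_ge0 andbT; apply: contra v0 => /eqP nv;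
     apply/eqP/dot_eq0; rewrite -sqr_enorm nv expr0n.
(* This weight minimises the Young bound, and the minimum is the product of the norms. *)
apply: (le_trans (@dot_le_young (enorm v / (2 * enorm u)) u v _)).
  by rewrite divr_gt0// mulr_gt0.
rewrite -!sqr_enorm.
suff -> : enorm v / (2 * enorm u) * enorm u ^+ 2 +
   enorm v ^+ 2 / (4 * (enorm v / (2 * enorm u))) = enorm u * enorm v by [].
by field; lra.
Qed.

Lemma ler_enormD u v : enorm (u + v) <= enorm u + enorm v.
Proof.
rewrite -(@ler_pXn2r _ 2) ?nnegrE ?addr_ge0 ?enorm_ge0//.
rewrite sqr_enorm !dotE sqrrD !sqr_enorm (dotC v u).
have := cauchy_schwarz u v; lra.
Qed.

Lemma ler_coord_enorm u i : `|u 0 i| <= enorm u.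
Proof.
rewrite -sqrtr_sqr ler_wsqrtr// /dot (bigD1 i)//= -expr2 lerDl.
by apply: sumr_ge0 => j _; rewrite -expr2 sqr_ge0.
Qed.

Lemma ler_enorm_sum u : enorm u <= \sum_i `|u 0 i|.
Proof.
have S0 : 0 <= \sum_i `|u 0 i| by apply: sumr_ge0.
rewrite -(@ler_pXn2r _ 2) ?nnegrE ?enorm_ge0// sqr_enorm expr2 mulr_suml.
apply: ler_sum => i _; apply: le_trans (ler_norm _) _; rewrite normrM.
apply: ler_wpM2l => //; rewrite (bigD1 i)//= lerDl.
by apply: sumr_ge0.
Qed.

Lemma ler_norm_enorm u : `|u| <= enorm u.
Proof.
rewrite [leLHS]/Num.norm /= mx_normrE; apply: bigmax_le => [|[i j] _ /=].
  exact: enorm_ge0.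
by rewrite ord1; exact: ler_coord_enorm.
Qed.

Lemma dot_sqrD u v : dot (u + v) (u + v) = dot u u + 2 * dot u v + dot v v.
Proof. by rewrite !dotE (dotC v u); ring. Qed.

Lemma dot_sqrB u v : dot (u - v) (u - v) = dot u u - 2 * dot u v + dot v v.
Proof. by rewrite !dotE (dotC v u); ring. Qed.

Lemma dot_sqrB_le u v : dot (u - v) (u - v) <= 2 * dot u u + 2 * dot v v.
Proof. by have := dot_ge0 (u + v); rewrite !dotE (dotC v u); lra. Qed.

Lemma dot_sqrD_le u v : dot (u + v) (u + v) <= 2 * dot u u + 2 * dot v v.
Proof. by have := dot_ge0 (u - v); rewrite !dotE (dotC v u); lra. Qed.

Lemma continuous_dot_self : continuous (fun u => dot u u).
Proof.
rewrite /dot; apply: continuous_big => [|i _ u]; first exact: add_continuous.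
by apply: (@cvgM _ _ (nbhs u)); exact: (@coord_continuous R 1 d 0 i u).
Qed.

Lemma continuous_enorm : continuous (@enorm R d).
Proof.
move=> u; rewrite /enorm; apply: (continuous_comp (@continuous_dot_self u)).
exact: sqrt_continuous.
Qed.

(** Outside a ball around [a0] the values exceed [g a0], so a minimum over the compact part of [A]
    in that ball is global. This yields projections and, for possibly unbounded [Y], the maximiser
    of the strongly concave objective. *)
Lemma closed_coercive_min (g : 'rV[R]_d -> R) A a0 r :
    closed A -> A a0 -> (forall a, A a -> {for a, continuous g}) ->
    (forall a, A a -> r < enorm (a - a0) -> g a0 < g a) ->
  exists2 a, A a & forall b, A b -> g a <= g b.
Proof.
move=> clA Aa0 cg coer.
(* A negative radius contradicts the coercivity hypothesis at [a0] itself. *)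
have r0 : 0 <= r \/ r < 0 by case: (leP 0 r) => ?; [left|right].
case: r0 => r0; last first.
  have := coer _ Aa0; rewrite subrr enorm0 ltxx => /(_ r0) //.
pose K := A `&` [set a | enorm (a - a0) <= r].
have cK : compact K.
  apply: bounded_closed_compact.
    exists (`|a0| + r); split; first exact: num_real.
    move=> M rM a [_ /= ar]; apply/ltW; apply: le_lt_trans rM.
    rewrite -{1}(subrK a0 a) addrC; apply: le_trans (ler_normD _ _) _.
    by rewrite lerD2l; apply: le_trans (ler_norm_enorm _) ar.
  apply: closedI => //.
  have -> : [set a | enorm (a - a0) <= r] =
      (fun a => enorm (a - a0)) @^-1` [set x | x <= r] by [].
  apply: preimage_closed; last exact: closed_le.
  move=> a _; apply: continuous_comp; last exact: continuous_enorm.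
  apply: (@continuousB _ _ _ id (cst a0)); [exact: cvg_id|exact: cst_continuous].
have K0 : K !=set0 by exists a0; split => //=; rewrite subrr enorm0.
have [|c] := @compact_EVT_min _ _ g K K0 cK.
- by apply: continuous_in_subspaceT => a; rewrite inE => -[Aa _]; exact: cg.
rewrite inE => -[Ac cr] cmin; exists c => // b Ab.
have [br|br] := leP (enorm (b - a0)) r.
  by apply: cmin; rewrite inE.
apply: (@le_trans _ _ (g a0)); last exact/ltW/coer.
by apply: cmin; rewrite inE; split => //=; rewrite subrr enorm0.
Qed.

End EuclideanGeometry.

(** Replaces the passage to the limit at 0 in first-order optimality arguments: if [a] were
    negative, a step [s] with [s * c <= - a / 2] would make the affine function negative. *)
Lemma ge0_affine_small {R : realType} (a c : R) :
  (forall s, 0 < s -> s <= 1 -> 0 <= a + s * c) -> 0 <= a.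
Proof.
move=> H; rewrite leNgt; apply/negP => a0.
have c1 : 0 < `|c| + 1 by have := normr_ge0 c; lra.
pose s := Num.min 1 (- a / (2 * (`|c| + 1))).
have s0 : 0 < s by rewrite lt_min ltr01 divr_gt0//; lra.
have := H s s0; rewrite ge_min lexx => /(_ isT).
have : s * c <= - a / (2 * (`|c| + 1)) * (`|c| + 1).
  apply: (@le_trans _ _ (s * (`|c| + 1))).
    by rewrite ler_pM2l//; have := ler_norm c; lra.
  by rewrite ler_pM2r// /s ge_min lexx orbT.
have -> : - a / (2 * (`|c| + 1)) * (`|c| + 1) = - a / 2 by field; lra.
lra.
Qed.

(** * Segments and projections in closed convex sets *)

Section ConvexSets.
Context {R : realType} {d : nat}.
Implicit Types (u v w z : 'rV[R]_d) (A : set 'rV[R]_d).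

Lemma convex_segment A u v s : convex_set A -> A u -> A v ->
  0 <= s -> s <= 1 -> A (u + s *: (v - u)).
Proof.
move=> cA Au Av s0 s1.
(* Library convexity takes a weight bundled with its bounds; the weight goes to the first of the two
   points, hence [v] before [u] below. *)
have s01 : Itv.spec (@Itv.num_sem R) (Itv.Real `[0%Z, 1%Z]) s.
  by rewrite /= /Itv.num_sem /= num_real /= in_itv/= s0 s1.
have := cA v u (Itv.mk s01); rewrite !inE => /(_ Av Au).
by rewrite /conv/= /unstable.onem scalerBl scale1r scalerBr addrCA.
Qed.

Lemma eprojP A z a : closed A -> A a ->
  A (eproj A z) /\ forall w, A w -> enorm (eproj A z - z) <= enorm (w - z).
Proof.
(* The radius [2 * enorm (a - z)] works: by the triangle inequality, a point farther than that from
   [a] is farther from [z] than [a] is. *)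
move=> clA Aa; rewrite /eproj; apply: (@getPex _ (fun u => A u /\ _)).
have [|b _ br|p Ap pmin] := @closed_coercive_min R d
   (fun u => enorm (u - z)) A a (2 * enorm (a - z)) clA Aa.
- move=> b _; apply: continuous_comp; last exact: continuous_enorm.
  by apply: (@continuousB _ _ _ id (cst z)); [exact: cvg_id|exact: cst_continuous].
- have := ler_enormD (b - z) (z - a).
  rewrite addrA subrK (enormBC z a); lra.
- by exists p.
Qed.

(** Compare the projection with the points at parameter [s] on the segment towards [w], divide by
    [s], and let [s] tend to 0. *)
Lemma eproj_variational A z w : closed A -> convex_set A -> A w ->
  0 <= dot (eproj A z - z) (w - eproj A z).
Proof.
move=> clA cA Aw; have [Ap pmin] := eprojP z clA Aw.
set p := eproj A z in Ap pmin *.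
apply: (@ge0_affine_small _ _ (dot (w - p) (w - p) / 2)) => s s0 s1.
have As := convex_segment cA Ap Aw (ltW s0) s1.
have := pmin _ As; rewrite -(@ler_pXn2r _ 2) ?nnegrE ?enorm_ge0//.
rewrite !sqr_enorm addrAC (dot_sqrD (p - z)) dotZl !dotZr => H.
have : 0 <= 2 * s * (dot (p - z) (w - p) + s * (dot (w - p) (w - p) / 2)) by lra.
by rewrite pmulr_rge0//; lra.
Qed.

(** Add the two variational inequalities, each tested at the other projection, and apply
    Cauchy-Schwarz. The Lipschitz property serves to make projected iterates measurable. *)
Lemma eproj_nonexpansive A z z' : closed A -> convex_set A -> A !=set0 ->
  enorm (eproj A z - eproj A z') <= enorm (z - z').
Proof.
move=> clA cA [a Aa].
have [Ap _] := eprojP z clA Aa; have [Ap' _] := eprojP z' clA Aa.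
have := eproj_variational z clA cA Ap'; have := eproj_variational z' clA cA Ap.
set p := eproj A z; set p' := eproj A z' => H1 H2.
have H : dot (p - p') (p - p') <= dot (z - z') (p - p').
  by move: H1 H2; rewrite !dotE (dotC p' p); lra.
have [->|pp] := eqVneq (enorm (p - p')) 0; first exact: enorm_ge0.
have p0 : 0 < enorm (p - p') by rewrite lt0r pp enorm_ge0.
rewrite -(ler_pM2r p0) -expr2 sqr_enorm; apply: le_trans H _.
exact: cauchy_schwarz.
Qed.

End ConvexSets.

(** * Derivatives along lines *)

Section LineDerivative.
Context {R : realType}.

Lemma derive_dot d (H : 'rV[R]_d -> R) (a v : 'rV[R]_d) :
  differentiable H a ->
  'D_v H a = dot (\row_i 'D_(delta_mx 0 i) H a) v.
Proof.
move=> dH; rewrite deriveE// {1}[v]row_sum_delta linear_sum /dot.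
by apply: eq_bigr => i _; rewrite linearZ /= mxE deriveE// mulrC.
Qed.

(** The difference quotients of the restriction to the line are those of [H] in direction [v]. *)
Lemma is_derive_line d (H : 'rV[R]_d -> R) (a v : 'rV[R]_d) (s : R) :
  differentiable H (a + s *: v) ->
  is_derive s 1 (fun t : R => H (a + t *: v))
    (dot (\row_i 'D_(delta_mx 0 i) H (a + s *: v)) v).
Proof.
move=> dH; rewrite -derive_dot//.
have E : (fun h : R => h^-1 *: (((fun t : R => H (a + t *: v)) \o shift s) (h *: 1)
             - H (a + s *: v))) =
   (fun h : R => h^-1 *: ((H \o shift (a + s *: v)) (h *: v) - H (a + s *: v))).
  apply/funext => h /=; congr (_ *: (H _ - _)).
  by rewrite [h *: 1]mulr1 scalerDl addrCA.
apply: DeriveDef; first by rewrite /derivable E; exact: diff_derivable.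
by rewrite /derive E.
Qed.

Context {d1 d2 : nat}.
Implicit Types (G : 'rV[R]_d1 -> 'rV[R]_d2 -> R).

Lemma differentiable2_fst G x y :
  differentiable2 G x y -> differentiable (G^~ y) x.
Proof.
move=> dG; apply: (@differentiable_comp _ _ _ _ (fun u => (u, y))
  (fun z : 'rV[R]_d1 * 'rV[R]_d2 => G z.1 z.2)) => //.
Qed.

Lemma differentiable2_snd G x y :
  differentiable2 G x y -> differentiable (G x) y.
Proof.
move=> dG; apply: (@differentiable_comp _ _ _ _ (fun u => (x, u))
  (fun z : 'rV[R]_d1 * 'rV[R]_d2 => G z.1 z.2)) => //.
Qed.

Lemma is_derive_gradx G x v y s : differentiable2 G (x + s *: v) y ->
  is_derive s 1 (fun t : R => G (x + t *: v) y) (dot (gradx G (x + s *: v) y) v).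
Proof. by move=> /differentiable2_fst; exact: is_derive_line. Qed.

Lemma is_derive_grady G x y v s : differentiable2 G x (y + s *: v) ->
  is_derive s 1 (fun t : R => G x (y + t *: v)) (dot (grady G x (y + s *: v)) v).
Proof. by move=> /differentiable2_snd; exact: is_derive_line. Qed.

End LineDerivative.

(** Integrates an affine bound on the derivative without integrals: [phi] minus the primitive of the
    bound has nonpositive derivative, hence decreases. The term [c / 2] is the source of the [L / 2]
    in the smoothness inequalities. *)
Lemma derive_affine_bound {R : realType} (phi dphi : R -> R) (a c : R) :
  (forall s : R, 0 <= s -> s <= 1 -> is_derive s 1 phi (dphi s)) ->
  (forall s : R, 0 <= s -> s <= 1 -> dphi s <= a + s * c) ->
  phi 1 - phi 0 <= a + c / 2.
Proof.
move=> dp hp.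
pose psi := fun s : R => phi s - (a * s + (c / 2) * s ^+ 2).
have dpsi (s : R) : 0 <= s -> s <= 1 -> is_derive s 1 psi (dphi s - (a + s * c)).
  move=> s0 s1; have := dp s s0 s1 => ?.
  apply: is_derive_eq; rewrite /GRing.scale/=. by field.
have : psi 1 <= psi 0.
  apply: (@ler0_derive1_nincr _ psi 0 1) => //.
  - by move=> r; rewrite in_itv/= => /andP[r0 r1]; have [] := dpsi r (ltW r0) (ltW r1).
  - move=> r; rewrite in_itv/= => /andP[r0 r1].
    have [_] := dpsi r (ltW r0) (ltW r1); rewrite derive1E => ->.
    by rewrite subr_le0; apply: hp; exact: ltW.
  - apply: derivable_within_continuous => r; rewrite in_itv/= => /andP[r0 r1].
    by have [] := dpsi r r0 r1.
rewrite /psi; lra.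
Qed.

(** * Geometry of the saddle problem *)

Lemma sqr_enorm2 {R : realType} d1 d2 (u : 'rV[R]_d1) (v : 'rV[R]_d2) :
  enorm2 u v ^+ 2 = dot u u + dot v v.
Proof. by rewrite /enorm2 sqr_sqrtr ?addr_ge0 ?sqr_ge0// !sqr_enorm. Qed.

Lemma enorm2_ge0 {R : realType} d1 d2 (u : 'rV[R]_d1) (v : 'rV[R]_d2) :
  0 <= enorm2 u v.
Proof. exact: sqrtr_ge0. Qed.

Lemma ler_enorm2 {R : realType} d1 d2 (u : 'rV[R]_d1) (v : 'rV[R]_d2) :
  enorm u <= enorm2 u v /\ enorm v <= enorm2 u v.
Proof.
by split; rewrite -(@ler_pXn2r _ 2) ?nnegrE ?enorm_ge0 ?enorm2_ge0//;
  rewrite sqr_enorm2 sqr_enorm ?lerDl ?lerDr dot_ge0.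
Qed.

Lemma enorm2l0 {R : realType} d1 d2 (u : 'rV[R]_d1) :
  enorm2 u (0 : 'rV[R]_d2) = enorm u.
Proof. by rewrite /enorm2 enorm0 expr0n addr0 sqrtr_sqr ger0_norm ?enorm_ge0. Qed.

Lemma enorm20r {R : realType} d1 d2 (v : 'rV[R]_d2) :
  enorm2 (0 : 'rV[R]_d1) v = enorm v.
Proof. by rewrite /enorm2 enorm0 expr0n add0r sqrtr_sqr ger0_norm ?enorm_ge0. Qed.

Section SaddleGeometry.
Context {R : realType} {d1 d2 : nat}.
Context (g : 'rV[R]_d1 -> 'rV[R]_d2 -> R).
Context (X : set 'rV[R]_d1) (Y : set 'rV[R]_d2) (L tau : R).
Context (ys : 'rV[R]_d1 -> 'rV[R]_d2).
Hypothesis L_gt0 : 0 < L.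
Hypothesis tau_gt0 : 0 < tau.
Hypothesis clX : closed X.
Hypothesis cvX : convex_set X.
Hypothesis clY : closed Y.
Hypothesis cvY : convex_set Y.
Hypothesis dg : forall x y, X x -> Y y -> differentiable2 g x y.
Hypothesis lipg : forall x x' y y', X x -> X x' -> Y y -> Y y' ->
  enorm2 (gradx g x y - gradx g x' y') (grady g x y - grady g x' y')
    <= L * enorm2 (x - x') (y - y').
Hypothesis scg : forall x y y', X x -> Y y -> Y y' ->
  g x y <= g x y' + dot (grady g x y') (y - y') - tau / 2 * enorm (y - y') ^+ 2.
Hypothesis ysP : forall x, X x ->
  Y (ys x) /\ forall y, Y y -> g x y <= g x (ys x).

Lemma gradx_lip x x' y y' : X x -> X x' -> Y y -> Y y' ->
  enorm (gradx g x y - gradx g x' y') <= L * enorm2 (x - x') (y - y').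
Proof.
move=> *; apply: le_trans (lipg _ _ _ _) => //.
by have [] := ler_enorm2 (gradx g x y - gradx g x' y')
                         (grady g x y - grady g x' y').
Qed.

Lemma grady_lip x x' y y' : X x -> X x' -> Y y -> Y y' ->
  enorm (grady g x y - grady g x' y') <= L * enorm2 (x - x') (y - y').
Proof.
move=> *; apply: le_trans (lipg _ _ _ _) => //.
by have [] := ler_enorm2 (gradx g x y - gradx g x' y')
                         (grady g x y - grady g x' y').
Qed.

(** Along the segment the directional derivative differs from its initial value by at most
    [s * L * dot v v]; integrate over [s]. *)
Lemma smooth_x x x' y : X x -> X x' -> Y y ->
  g x' y <= g x y + dot (gradx g x y) (x' - x) + L / 2 * dot (x' - x) (x' - x).
Proof.
move=> Xx Xx' Yy; set v := x' - x.
have Xs (s : R) : 0 <= s -> s <= 1 -> X (x + s *: v).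
  by move=> *; exact: convex_segment.
have := @derive_affine_bound R (fun s => g (x + s *: v) y)
  (fun s => dot (gradx g (x + s *: v) y) v)
  (dot (gradx g x y) v) (L * dot v v).
have -> : g (x + 1 *: v) y = g x' y by rewrite scale1r /v addrC subrK.
have -> : g (x + 0 *: v) y = g x y by rewrite scale0r addr0.
move=> H; suff : g x' y - g x y <= dot (gradx g x y) v + L * dot v v / 2 by lra.
apply: H => s s0 s1; first by apply: is_derive_gradx; apply: dg => //; exact: Xs.
rewrite -[leLHS](subrK (dot (gradx g x y) v)) addrC lerD2l -dotNl -dotDl.
apply: le_trans (cauchy_schwarz _ _) _.
have := gradx_lip (Xs s s0 s1) Xx Yy Yy.
rewrite subrr enorm2l0 addrAC subrr add0r enormZ (ger0_norm s0) => H'.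
rewrite -sqr_enorm expr2; apply: le_trans (ler_wpM2r (enorm_ge0 _) H') _.
lra.
Qed.

Lemma smooth_y x y y' : X x -> Y y -> Y y' ->
  g x y + dot (grady g x y) (y' - y) - L / 2 * dot (y' - y) (y' - y) <= g x y'.
Proof.
move=> Xx Yy Yy'; set v := y' - y.
have Ys (s : R) : 0 <= s -> s <= 1 -> Y (y + s *: v).
  by move=> *; exact: convex_segment.
have := @derive_affine_bound R (fun s => - g x (y + s *: v))
  (fun s => - dot (grady g x (y + s *: v)) v)
  (- dot (grady g x y) v) (L * dot v v).
have -> : g x (y + 1 *: v) = g x y' by rewrite scale1r /v addrC subrK.
have -> : g x (y + 0 *: v) = g x y by rewrite scale0r addr0.
move=> H; suff : - g x y' - - g x y <= - dot (grady g x y) v + L * dot v v / 2.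
  by lra.
apply: H => s s0 s1.
  by apply: is_deriveN; apply: is_derive_grady; apply: dg => //; exact: Ys.
rewrite -[leLHS](subrK (- dot (grady g x y) v)) addrC lerD2l opprK addrC.
rewrite -dotNl -dotDl; apply: le_trans (cauchy_schwarz _ _) _.
have := grady_lip Xx Xx Yy (Ys s s0 s1).
rewrite subrr enorm20r opprD addrA subrr add0r enormN enormZ (ger0_norm s0) => H'.
rewrite -sqr_enorm expr2; apply: le_trans (ler_wpM2r (enorm_ge0 _) H') _.
lra.
Qed.

(** Strong concavity at a point [z] of the segment, applied to both endpoints with weights [1 - s]
    and [s], cancels the gradient at [z]. Comparing with [g x z <= g x p] and letting [s] tend to 0
    gives the growth, so no optimality condition at a boundary point is needed. *)
Lemma quadratic_growth x y : X x -> Y y ->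
  g x y <= g x (ys x) - tau / 2 * dot (y - ys x) (y - ys x).
Proof.
move: (tau_gt0) (L_gt0) => tau0 L0 Xx Yy; have [Yp pmax] := ysP Xx; set p := ys x in Yp pmax *.
set v := y - p; pose N := dot v v.
suff : 0 <= (g x p - g x y - tau / 2 * N) by rewrite /N; lra.
apply: (@ge0_affine_small _ _ (tau / 2 * N)) => s s0 s1.
pose z := p + s *: v.
have Yz : Y z by apply: convex_segment => //; exact: ltW.
have zp : p - z = (- s) *: v.
  by rewrite /z opprD addrA subrr add0r scaleNr.
have zy : y - z = (1 - s) *: v.
  by rewrite /z opprD addrA -/v scalerBl scale1r.
have H1 := scg Xx Yp Yz; have H2 := scg Xx Yy Yz; have H3 := pmax _ Yz.
rewrite zp sqr_enorm dotZl !dotZr -/N in H1.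
rewrite zy sqr_enorm dotZl !dotZr -/N in H2.
set c := dot _ v in H1 H2.
have H : 0 <= s * (g x p - g x y - tau / 2 * N + s * (tau / 2 * N)).
  have : (1 - s) * (g x p) <= (1 - s) * (g x z + - s * c - tau / 2 * (- s * (- s * N))).
    by rewrite ler_wpM2l//; lra.
  have : s * (g x y) <= s * (g x z + (1 - s) * c - tau / 2 * ((1 - s) * ((1 - s) * N))).
    by rewrite ler_wpM2l//; lra.
  lra.
by move: H; rewrite pmulr_rge0.
Qed.

(** Adding the quadratic growth at [x] and at [x'] bounds [tau * dot v v] by a second difference of
    [g], which is the integral along [v] of [grady g x - grady g x'], hence at most
    [L * enorm (x - x') * enorm v]. *)
Lemma ystar_lip x x' : X x -> X x' ->
  enorm (ys x - ys x') <= L / tau * enorm (x - x').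
Proof.
move: (tau_gt0) (L_gt0) => tau0 L0 Xx Xx'; have [Yp _] := ysP Xx; have [Yp' _] := ysP Xx'.
have H1 := quadratic_growth Xx Yp'; have H2 := quadratic_growth Xx' Yp.
set p := ys x in Yp H1 H2 *; set p' := ys x' in Yp' H1 H2 *.
pose v := p - p'.
have Ys (s : R) : 0 <= s -> s <= 1 -> Y (p' + s *: v).
  by move=> *; exact: convex_segment.
(* The derivative bound is constant along the segment, so the slope is 0. *)
have := @derive_affine_bound R
  (fun s => g x (p' + s *: v) - g x' (p' + s *: v))
  (fun s => dot (grady g x (p' + s *: v)) v - dot (grady g x' (p' + s *: v)) v)
  (L * enorm (x - x') * enorm v) 0.
have -> : p' + 1 *: v = p by rewrite scale1r /v addrC subrK.
have -> : p' + 0 *: v = p' by rewrite scale0r addr0.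
move=> H.
have {}H : g x p - g x' p - (g x p' - g x' p') <= L * enorm (x - x') * enorm v.
  rewrite -[leRHS]addr0 -(mul0r 2^-1); apply: H => s s0 s1.
    by apply: is_deriveB; apply: is_derive_grady; apply: dg => //; exact: Ys.
  rewrite mulr0 addr0 -dotNl -dotDl; apply: le_trans (cauchy_schwarz _ _) _.
  apply: ler_wpM2r; first exact: enorm_ge0.
  apply: le_trans (grady_lip _ _ _ _) _ => //; try exact: Ys.
  by rewrite subrr enorm2l0.
have Evv : dot (p' - p) (p' - p) = dot v v.
  by rewrite -!sqr_enorm enormBC.
rewrite -/v -!sqr_enorm in H2; rewrite Evv -sqr_enorm in H1.
have [v0|v0] := eqVneq (enorm v) 0.
  by rewrite v0 mulr_ge0 ?enorm_ge0// divr_ge0// ltW.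
have vp : 0 < enorm v by rewrite lt0r v0 enorm_ge0.
rewrite mulrAC ler_pdivlMr// -(ler_pM2r vp) -mulrA mulrC -mulrA -expr2.
lra.
Qed.

(* Strong concavity absorbs the displacement of the maximiser, so that no
   differentiability of [x |-> g x (ys x)] is needed. *)
Lemma max_smooth x x' : X x -> X x' ->
  g x' (ys x') <= g x (ys x) + dot (gradx g x (ys x)) (x' - x)
    + (L + L ^+ 2 / tau) / 2 * dot (x' - x) (x' - x).
Proof.
move: (tau_gt0) (L_gt0) => tau0 L0 Xx Xx'; have [Yp _] := ysP Xx; have [Yp' _] := ysP Xx'.
have H1 := smooth_x Xx Xx' Yp'; have H2 := quadratic_growth Xx Yp'.
set p := ys x in Yp H1 H2 *; set p' := ys x' in Yp' H1 H2 *.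
set v := x' - x in H1 *.
have H3 : dot (gradx g x p' - gradx g x p) v <= L * enorm (p' - p) * enorm v.
  apply: le_trans (cauchy_schwarz _ _) _; rewrite ler_wpM2r ?enorm_ge0//.
  apply: le_trans (gradx_lip _ _ _ _) _ => //.
  by rewrite subrr enorm20r.
rewrite dotDl dotNl in H3; rewrite -!sqr_enorm in H1 H2 *.
set a := enorm (p' - p) in H2 H3; set c := enorm v in H1 H3 *.
have : L * a * c <= tau / 2 * a ^+ 2 + (L ^+ 2 / tau) / 2 * c ^+ 2.
  have : 0 <= tau / 2 * (a - L / tau * c) ^+ 2 by apply: mulr_ge0; [lra|exact: sqr_ge0].
  suff -> : tau / 2 * (a - L / tau * c) ^+ 2 =
    tau / 2 * a ^+ 2 + (L ^+ 2 / tau) / 2 * c ^+ 2 - L * a * c by lra.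
  by field; lra.
lra.
Qed.

Context (lambda gamma eta : R).
Hypothesis lambda_gt0 : 0 < lambda.
Hypothesis gamma_gt0 : 0 < gamma.
Hypothesis eta_ge0 : 0 <= eta.
Hypothesis eta_le1 : eta <= 1.
Hypothesis step_x : (L + L ^+ 2 / tau) * eta * gamma <= 1 / 2.
Hypothesis lambdaL : lambda * L <= 1 / 6.
Hypothesis lambdatau : lambda * tau <= 1 / 6.

(** In [max_smooth] the gradient at the maximiser is split into [v], whose product with the move is
    at most [- dot w w / gamma] by the projection inequality, and an error, handled by Young with
    weight [gamma]. The error is in turn the estimation error plus the gradient change from [p] to
    [y]. Multiples of [eta * W / gamma]: -1 from the projection, 1/4 from Young, 1/4 from
    smoothness. *)
Lemma primal_step x y v : X x -> Y y ->
  let x' := eproj X (x - gamma *: v) in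
  X (x + eta *: (x' - x)) /\
  g (x + eta *: (x' - x)) (ys (x + eta *: (x' - x))) +
    eta / (2 * gamma) * dot (x' - x) (x' - x)
  <= g x (ys x)
    + 2 * eta * gamma * L ^+ 2 * dot (y - ys x) (y - ys x)
    + 2 * eta * gamma * dot (gradx g x y - v) (gradx g x y - v).
Proof.
move: (gamma_gt0) (eta_ge0) (step_x) (tau_gt0) => gamma0 eta0 stepx tau0 Xx Yy x'; have [Xx' _] := eprojP (x - gamma *: v) clX Xx.
rewrite -/x' in Xx'; have Xn := convex_segment cvX Xx Xx' eta_ge0 eta_le1.
split => //; have [Yp _] := ysP Xx.
have H := max_smooth Xx Xn; set p := ys x in Yp H *.
set q := ys (x + _) in H *; set w := x' - x in H *.
rewrite (_ : x + eta *: w - x = eta *: w) in H; last by rewrite addrAC subrr add0r.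
rewrite dotZl !dotZr in H.
have V := eproj_variational (x - gamma *: v) clX cvX Xx; rewrite -/x' in V.
have V' : dot v w <= - (dot w w / gamma).
  move: V; have -> : x' - (x - gamma *: v) = w + gamma *: v by rewrite opprB addrCA addrC.
  rewrite -(opprB x') -/w dotNr dotDl dotZl => V.
  by rewrite -mulNr ler_pdivlMr//; lra.
have E1 : dot (gradx g x p - v) w <=
    gamma * dot (gradx g x p - v) (gradx g x p - v) + dot w w / (4 * gamma).
  exact: dot_le_young.
have E2 : dot (gradx g x p - v) (gradx g x p - v) <=
   2 * L ^+ 2 * dot (y - p) (y - p) + 2 * dot (gradx g x y - v) (gradx g x y - v).
  have -> : gradx g x p - v = (gradx g x p - gradx g x y) + (gradx g x y - v).
    by rewrite addrA subrK.
  apply: le_trans (dot_sqrD_le _ _) _; rewrite lerD2r -mulrA ler_pM2l//.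
  rewrite -!sqr_enorm -exprMn ler_pXn2r ?nnegrE ?mulr_ge0 ?enorm_ge0 ?(ltW L_gt0)//.
  apply: le_trans (gradx_lip _ _ _ _) _ => //.
  by rewrite subrr enorm20r enormBC.
have W0 := dot_ge0 w; set W := dot w w in H V' E1 W0 *.
set e2 := dot (gradx g x y - v) _ in E2 *; set D := dot (y - p) _ in E2 *.
set G := dot (gradx g x p - v) (gradx g x p - v) in E1 E2.
have E3 : dot (gradx g x p) w = dot (gradx g x p - v) w + dot v w.
  by rewrite -dotDl subrK.
rewrite E3 in H.
(* The step size condition [step_x] makes the smoothness term a quarter of [eta * W / gamma]. *)
have E4 : (L + L ^+ 2 / tau) / 2 * (eta * (eta * W)) <= eta * W / (4 * gamma).
  have : 0 <= (1 / 2 - (L + L ^+ 2 / tau) * eta * gamma) * (eta * W / (2 * gamma)).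
    by rewrite mulr_ge0 ?divr_ge0 ?mulr_ge0//; lra.
  suff -> : (1 / 2 - (L + L ^+ 2 / tau) * eta * gamma) * (eta * W / (2 * gamma)) =
    eta * W / (4 * gamma) - (L + L ^+ 2 / tau) / 2 * (eta * (eta * W)) by lra.
  by field; rewrite !gt_eqF.
have E5 : eta * (dot (gradx g x p - v) w + dot v w) <=
   eta * (gamma * (2 * L ^+ 2 * D + 2 * e2) + W / (4 * gamma) - W / gamma).
  apply: ler_wpM2l => //; have := ler_wpM2l (ltW gamma_gt0) E2; lra.
have E6 : W / (4 * gamma) - W / gamma = - (3 / 4 * (W / gamma)) by field; lra.
have E7 : eta * W / (4 * gamma) = eta * (W / gamma) / 4 by field; lra.
have E8 : eta / (2 * gamma) * W = eta * (W / gamma) / 2 by field; lra.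
rewrite -addrA E6 in E5; rewrite E7 in E4; rewrite E8; lra.
Qed.

(** With [x] frozen, the move contracts the squared distance to [p] by [1 - 2 * s], where [s] is
    [eta * lambda * tau / 4]; one of the two [s] is then spent on the drift of the maximiser from
    [ys x] to [ys xn]. *)
Lemma dual_step x x'' y w : X x -> X x'' -> Y y ->
  let y' := eproj Y (y + lambda *: w) in
  let p := ys x in
  let yn := y + eta *: (y' - y) in
  let xn := x + eta *: (x'' - x) in
  Y yn /\
  dot (yn - ys xn) (yn - ys xn) <=
    (1 - eta * lambda * tau / 4) * dot (y - p) (y - p)
    - 3 / 4 * eta * dot (y' - y) (y' - y)
    + 5 * eta * lambda / tau * dot (grady g x y - w) (grady g x y - w)
    + 8 * (L / tau) ^+ 2 * eta / (lambda * tau) * dot (x'' - x) (x'' - x).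
Proof.
move: (tau_gt0) (lambda_gt0) (eta_ge0) (eta_le1) (lambdaL) (lambdatau) => tau0 la0 eta0 eta1 laL lat.
move=> Xx Xx'' Yy y' p yn xn.
have [Yy' _] := eprojP (y + lambda *: w) clY Yy; rewrite -/y' in Yy'.
have Yn := convex_segment cvY Yy Yy' eta_ge0 eta_le1.
split => //; have [Yp pmax] := ysP Xx; rewrite -/p in Yp pmax.
have Xn := convex_segment cvX Xx Xx'' eta_ge0 eta_le1.
have V := eproj_variational (y + lambda *: w) clY cvY Yp; rewrite -/y' in V.
have S1 := scg Xx Yp Yy; have S2 := smooth_y Xx Yy Yy'; have S3 := pmax _ Yy'.
set a := y - p; set c := y' - y in S2 *; set u := grady g x y - w.
have Eg : grady g x y = u + w by rewrite subrK.
have Epy : p - y = - a by rewrite opprB.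
have Epy' : p - y' = - a - c by rewrite /a /c !opprB addrA subrK.
rewrite sqr_enorm Epy Eg in S1; rewrite Eg in S2.
have EV : y' - (y + lambda *: w) = c - lambda *: w by rewrite opprD addrA.
rewrite EV Epy' in V.
have A0 := dot_ge0 a; have C0 := dot_ge0 c; have U0 := dot_ge0 u.
have Nu : dot (- u) (- u) = dot u u by rewrite dotNl dotNr opprK.
have Y1 : dot (- u) a <= dot u u / tau + tau / 4 * dot a a.
  have := @dot_le_young R _ (1 / tau) (- u) a _; rewrite divr_gt0// => /(_ isT).
  rewrite Nu.
  have -> : dot a a / (4 * (1 / tau)) = tau / 4 * dot a a by field; lra.
  by rewrite div1r mulrC.
have Y2 : dot (- u) c <= dot u u / tau + tau / 4 * dot c c.
  have := @dot_le_young R _ (1 / tau) (- u) c _; rewrite divr_gt0// => /(_ isT).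
  rewrite Nu.
  have -> : dot c c / (4 * (1 / tau)) = tau / 4 * dot c c by field; lra.
  by rewrite div1r mulrC.
(* Chaining strong concavity from [y] to [p], smoothness from [y] to [y'] and maximality of [p]
   eliminates the values of [g]; the projection inequality at [p] then eliminates [w], and Young
   removes the error [u]. *)
have K : dot c a <= - (1 - lambda * L / 2 - lambda * tau / 4) * dot c c
   - lambda * tau / 4 * dot a a + 2 * (lambda / tau) * dot u u.
  have K0 : 0 <= lambda * (dot (- u) a + dot (- u) c + L / 2 * dot c c
     - tau / 2 * dot a a) - dot c a - dot c c.
    have K1 : 0 <= - dot w a - dot w c + dot (- u) a + dot (- u) c
       + L / 2 * dot c c - tau / 2 * dot a a.
      move: S1 S2 S3; rewrite !dotE; lra.
    have := ler_wpM2l (ltW lambda_gt0) K1; rewrite mulr0 => K2.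
    move: V; rewrite !dotE => V; move: K2; rewrite !dotE; lra.
  have K1 : lambda * (dot (- u) a + dot (- u) c) <=
      lambda * (dot u u / tau + tau / 4 * dot a a +
               (dot u u / tau + tau / 4 * dot c c)).
    by rewrite ler_pM2l// lerD.
  have -> : 2 * (lambda / tau) * dot u u = 2 * lambda * (dot u u / tau) by field; lra.
  lra.
set s := eta * lambda * tau / 4.
have s0 : 0 <= s by rewrite /s !mulr_ge0//; lra.
have lt0 : 0 < lambda * tau by rewrite mulr_gt0.
have s24 : s <= 1 / 24.
  have : eta * (lambda * tau) <= 1 * (lambda * tau) by rewrite ler_wpM2r// ltW.
  rewrite /s; lra.
(* The multiple of [eta * dot c c] is 1 - 2 + 1/4: the square of the move, twice [K], and the two
   terms controlled by [lambda * L] and [lambda * tau]. *)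
have Pn : dot (yn - p) (yn - p) <= (1 - 2 * s) * dot a a - 3 / 4 * eta * dot c c
    + 4 * (eta * lambda / tau) * dot u u.
  have -> : yn - p = a + eta *: c by rewrite /yn addrAC.
  rewrite dot_sqrD dotZl !dotZr (dotC a c).
  have := ler_wpM2l eta_ge0 K.
  have : eta * (eta * dot c c) <= eta * dot c c.
    by apply: ler_wpM2l => //; rewrite ler_piMl.
  have : lambda * L * (eta * dot c c) <= 1 / 6 * (eta * dot c c).
    by apply: ler_wpM2r => //; rewrite mulr_ge0.
  have : lambda * tau * (eta * dot c c) <= 1 / 6 * (eta * dot c c).
    by apply: ler_wpM2r => //; rewrite mulr_ge0.
  have : 0 <= eta * dot c c by rewrite mulr_ge0.
  rewrite /s; lra.
(* A zero step is treated apart because the drift is weighted by [s^-1]. *)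
have [e0|e0] := eqVneq eta 0.
  have -> : xn = x by rewrite /xn e0 scale0r addr0.
  rewrite -/p; move: Pn; rewrite /s e0; lra.
have ep : 0 < eta by rewrite lt0r e0.
have sp : 0 < s by rewrite /s divr_gt0// !mulr_gt0.
have si0 : 0 <= s^-1 by rewrite invr_ge0.
have PX : dot (p - ys xn) (p - ys xn) <=
    (L / tau) ^+ 2 * (eta ^+ 2 * dot (x'' - x) (x'' - x)).
  rewrite -!sqr_enorm -!exprMn ler_pXn2r ?nnegrE ?enorm_ge0//; last first.
    by rewrite !mulr_ge0 ?enorm_ge0 ?invr_ge0// ltW.
  apply: le_trans (ystar_lip Xx Xn) _.
  by rewrite /xn opprD addrA subrr add0r enormN enormZ ger0_norm.
have Pf : dot (yn - ys xn) (yn - ys xn) <=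
   (1 + s) * dot (yn - p) (yn - p) + (1 + s^-1) * dot (p - ys xn) (p - ys xn).
  have -> : yn - ys xn = (yn - p) + (p - ys xn) by rewrite addrA subrK.
  rewrite dot_sqrD.
  have := dot_ge0 (s *: (yn - p) - (p - ys xn)); rewrite (dot_sqrB (s *: (yn - p))) !dotZl !dotZr => H.
  have : 0 <= s^-1 * (s * (s * dot (yn - p) (yn - p)) -
     2 * (s * dot (yn - p) (p - ys xn)) + dot (p - ys xn) (p - ys xn)).
    by apply: mulr_ge0.
  set P1 := dot (yn - p) _; set P2 := dot (p - ys xn) _.
  suff : forall A B C : R, 0 <= s^-1 * (s * (s * A) - 2 * (s * B) + C) ->
     A + 2 * B + C <= (1 + s) * A + (1 + s^-1) * C.
    by move=> T /T; lra.
  move=> A B C; have -> : s^-1 * (s * (s * A) - 2 * (s * B) + C) =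
     s * A - 2 * B + s^-1 * C by field; lra.
  lra.
apply: le_trans Pf _.
have Q1 : (1 + s) * dot (yn - p) (yn - p) <= (1 - s) * dot a a
    - 3 / 4 * eta * dot c c + 5 * (eta * lambda / tau) * dot u u.
  apply: (@le_trans _ _ ((1 + s) * ((1 - 2 * s) * dot a a - 3 / 4 * eta * dot c c
    + 4 * (eta * lambda / tau) * dot u u))).
    by apply: ler_wpM2l => //; lra.
  have T0 : 0 <= eta * lambda / tau * dot u u.
    by rewrite mulr_ge0// divr_ge0 ?mulr_ge0 ?ltW.
  have T1 : s * (eta * lambda / tau * dot u u) <= 1 / 24 * (eta * lambda / tau * dot u u).
    by rewrite ler_wpM2r.
  have T2 : 0 <= s * (eta * dot c c).
    by apply: mulr_ge0 => //; exact: mulr_ge0.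
  have T3 : 0 <= s * s * dot a a.
    by apply: mulr_ge0 => //; exact: mulr_ge0.
  lra.
(* Since [s <= 1], the weight is at most [2 / s]; the [eta ^+ 2] of the squared drift leaves one
   factor [eta]. *)
have Q2 : (1 + s^-1) * dot (p - ys xn) (p - ys xn) <=
   8 * (L / tau) ^+ 2 * eta / (lambda * tau) * dot (x'' - x) (x'' - x).
  apply: (@le_trans _ _ (2 * s^-1 * dot (p - ys xn) (p - ys xn))).
    rewrite ler_wpM2r ?dot_ge0//.
    have : 1 <= s^-1 by rewrite invf_ge1//; lra.
    lra.
  apply: (@le_trans _ _ (2 * s^-1 * ((L / tau) ^+ 2 *
      (eta ^+ 2 * dot (x'' - x) (x'' - x))))).
    by rewrite ler_wpM2l// mulr_ge0.
  rewrite /s le_eqVlt; apply/orP; left; apply/eqP.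
  by field; rewrite !gt_eqF.
rewrite -/s.
have -> : 5 * eta * lambda / tau = 5 * (eta * lambda / tau) by ring.
lra.
Qed.

End SaddleGeometry.

(** * Measurability *)

Section VectorMeasurability.
Context {R : realType} {dW : measure_display} {W : measurableType dW}.

(** Coordinatewise, so that vector measurability reduces to real-valued measurability. *)
Definition measurable_rV d (F : W -> 'rV[R]_d) :=
  forall i, measurable_fun setT (fun w => F w 0 i).

Lemma measurable_rV_cst d (a : 'rV[R]_d) : measurable_rV (cst a).
Proof. by move=> i; exact: measurable_cst. Qed.

Lemma measurable_rVD d (F G : W -> 'rV[R]_d) :
  measurable_rV F -> measurable_rV G -> measurable_rV (fun w => F w + G w).
Proof.
move=> mF mG i; under eq_fun do rewrite mxE.
exact: measurable_funD (mF i) (mG i).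
Qed.

Lemma measurable_rVZ d (a : R) (F : W -> 'rV[R]_d) :
  measurable_rV F -> measurable_rV (fun w => a *: F w).
Proof.
move=> mF i; under eq_fun do rewrite mxE.
exact: measurable_funM (measurable_cst _) (mF i).
Qed.

Lemma measurable_rVB d (F G : W -> 'rV[R]_d) :
  measurable_rV F -> measurable_rV G -> measurable_rV (fun w => F w - G w).
Proof.
move=> mF mG; apply: measurable_rVD => // i.
by under eq_fun do rewrite -scaleN1r; exact: measurable_rVZ.
Qed.

Lemma measurable_rV_sum d I (s : seq I) (F : I -> W -> 'rV[R]_d) :
  (forall i, measurable_rV (F i)) ->
  measurable_rV (fun w => \sum_(i <- s) F i w).
Proof.
move=> mF j; under eq_fun do rewrite summxE.
by apply: measurable_sum => i; exact: mF.
Qed.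

Lemma measurable_dot d (F G : W -> 'rV[R]_d) :
  measurable_rV F -> measurable_rV G ->
  measurable_fun setT (fun w => dot (F w) (G w)).
Proof.
by move=> mF mG; apply: measurable_sum => i; exact: measurable_funM.
Qed.

Lemma measurable_sqrt_comp (h : W -> R) :
  measurable_fun setT h -> measurable_fun setT (fun w => Num.sqrt (h w)).
Proof.
apply: (measurableT_comp (f := @Num.sqrt R)).
by apply: continuous_measurable_fun; exact: sqrt_continuous.
Qed.

Lemma measurable_enorm d (F : W -> 'rV[R]_d) :
  measurable_rV F -> measurable_fun setT (fun w => enorm (F w)).
Proof. by move=> mF; apply: measurable_sqrt_comp; exact: measurable_dot. Qed.

Lemma measurable_enorm2 d1 d2 (F : W -> 'rV[R]_d1) (G : W -> 'rV[R]_d2) :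
  measurable_rV F -> measurable_rV G ->
  measurable_fun setT (fun w => enorm2 (F w) (G w)).
Proof.
move=> mF mG; apply: measurable_sqrt_comp; apply: measurable_funD.
  by apply: measurable_funX; exact: measurable_enorm.
by apply: measurable_funX; exact: measurable_enorm.
Qed.

(* [H w (F w)] is the infimum over a dense sequence [q] of
   [H w (q n) + L dist (F w) (q n)] (McShane's formula). *)
Lemma measurable_lipschitz_comp (E : Type) (A : set E) (dist : E -> E -> R)
    (q : nat -> E) (L : R) (F : W -> E) (H : W -> E -> R) :
  0 <= L -> (forall a a', 0 <= dist a a') ->
  (forall n, A (q n)) ->
  (forall a e, A a -> 0 < e -> exists n, dist a (q n) < e) ->
  (forall w, A (F w)) ->
  (forall n, measurable_fun setT (fun w => dist (F w) (q n))) ->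
  (forall w a a', A a -> A a' -> `|H w a - H w a'| <= L * dist a a') ->
  (forall n, measurable_fun setT (fun w => H w (q n))) ->
  measurable_fun setT (fun w => H w (F w)).
Proof.
move=> L0 dist0 Aq dense AF mdist lipH mH.
pose h n w := H w (q n) + L * dist (F w) (q n).
have hlb w n : H w (F w) <= h n w.
  by have := lipH w _ _ (AF w) (Aq n); rewrite ler_norml => /andP[_]; rewrite /h; lra.
have mh n : measurable_fun setT (h n).
  by apply: measurable_funD => //; apply: measurable_funM.
(* The tail infimum [infs] from index 0 is the infimum of the whole sequence. *)
have -> : (fun w => H w (F w)) = (fun w => infs (h ^~ w) 0).
  apply/funext => w; rewrite /infs/=.
  have Er : sdrop (h^~ w) 0 = range (h ^~ w).
    by rewrite /sdrop; apply/seteqP; split => x [n _ <-]; exists n.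
  rewrite Er; apply/eqP; rewrite eq_le; apply/andP; split.
    apply: lb_le_inf; first by exists (h 0%N w), 0%N.
    by move=> _ [n _ <-].
  apply/ler_addgt0Pr => e e0.
  have L1 : 0 < 2 * (L + 1) by lra.
  (* The excess of [h n w] over the value is at most twice [L] times the distance; [L + 1] keeps the
     quotient meaningful for [L = 0]. *)
  have [n qn] := dense (F w) (e / (2 * (L + 1))) (AF w) (divr_gt0 e0 L1).
  apply: (@le_trans _ _ (h n w)).
    by apply: ge_inf; [exists (H w (F w)) => _ [m _ <-]|exists n].
  have := lipH w _ _ (AF w) (Aq n); rewrite ler_norml => /andP[].
  have : 2 * L * dist (F w) (q n) <= 2 * (L + 1) * (e / (2 * (L + 1))).
    apply: ler_pM; [lra|exact: dist0|lra|exact: ltW].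
  have -> : 2 * (L + 1) * (e / (2 * (L + 1))) = e by field; lra.
  rewrite /h; lra.
apply: measurable_fun_infs => // w _.
by exists (H w (F w)) => _ [n _ <-].
Qed.

End VectorMeasurability.

(** [A] may contain no rational point. For each rational centre and radius [1 / (k + 1)], a point of
    [A] in that ball is chosen when there is one, and [a0] otherwise. *)
Lemma dense_sequence {R : realType} d (A : set 'rV[R]_d) : A !=set0 ->
  exists q : nat -> 'rV[R]_d, (forall n, A (q n)) /\
    forall a e, A a -> 0 < e -> exists n, enorm (a - q n) < e.
Proof.
move=> [a0 Aa0].
pose near_pt (c : 'rV[rat]_d) (k : nat) (a : 'rV[R]_d) :=
  A a /\ enorm (a - map_mx ratr c) < k.+1%:R^-1.
pose q n := if @unpickle ('rV[rat]_d * nat)%type n is Some (c, k)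
            then xget a0 (near_pt c k) else a0.
exists q; split=> [n|a e Aa e0].
  rewrite /q; case: unpickle => [[c k]|//].
  by case: xgetP => [x -> []|].
have [k ke] : exists k : nat, 2 * (k.+1%:R^-1 : R) < e.
  have /cvgrPdist_lt/(_ (e / 2) (divr_gt0 e0 (ltr0n _ 2)))[k _] := @cvg_harmonic R.
  move=> /(_ k (leqnn k)); rewrite /= sub0r normrN ger0_norm ?invr_ge0// => H.
  by exists k; rewrite mulrC -ltr_pdivlMr.
(* Coordinatewise precision whose sum over [d] coordinates stays below [1 / (k + 1)]; [d.+1] covers
   dimension 0. *)
have dk : 0 < (k.+1%:R * d.+1%:R)^-1 :> R by rewrite invr_gt0 mulr_gt0.
have [c ac] : exists c : 'rV[rat]_d, forall i,
    `|a 0 i - ratr (c 0 i)| < (k.+1%:R * d.+1%:R)^-1.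
  have near_rat (x s : R) : 0 < s -> exists r : rat, `|x - ratr r| < s.
    move=> s0; have [|r] := @rat_in_itvoo R (x - s) (x + s); first lra.
    by rewrite in_itv/= => /andP[r1 r2]; exists r; rewrite ltr_norml; lra.
  have H i := near_rat (a 0 i) _ dk.
  have [r Hr] := choice H; exists (\row_i r i) => i; rewrite mxE; exact: Hr.
have nac : enorm (a - map_mx ratr c) < k.+1%:R^-1.
  apply: le_lt_trans (ler_enorm_sum _) _.
  apply: (@le_lt_trans _ _ (\sum_(i < d) (k.+1%:R * d.+1%:R)^-1)).
    by apply: ler_sum => i _; rewrite !mxE; exact/ltW/ac.
  rewrite sumr_const card_ord -[_ *+ d]mulr_natr invfM -mulrA.
  rewrite gtr_pMr ?invr_gt0// mulrC ltr_pdivrMr// mul1r ltr_nat//.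
exists (pickle (c, k)); rewrite /q pickleK.
case: xgetP => [x _ [Ax xc]|/(_ a)/not_andP[]//].
apply: lt_trans ke; rewrite -(subrK (map_mx ratr c) a) -addrA.
by apply: le_lt_trans (ler_enormD _ _) _; rewrite (enormBC _ x) mulr_natl mulr2n ltrD.
Qed.

Section LipschitzComposition.
Context {R : realType} {dW : measure_display} {W : measurableType dW}.

Lemma measurable_rV_lipschitz d e (A : set 'rV[R]_d) (L : R)
    (Phi : 'rV[R]_d -> 'rV[R]_e) (F : W -> 'rV[R]_d) :
  0 <= L -> (forall a a', A a -> A a' -> enorm (Phi a - Phi a') <= L * enorm (a - a')) ->
  (forall w, A (F w)) -> measurable_rV F -> measurable_rV (fun w => Phi (F w)).
Proof.
move=> L0 lip AF mF i.
have [q [Aq qd]] := @dense_sequence R d A (ex_intro _ _ (AF point)).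
apply: (@measurable_lipschitz_comp R _ _ _ A (fun a a' => enorm (a - a')) q L F
   (fun _ a => Phi a 0 i)) => //.
- by move=> *; exact: enorm_ge0.
- by move=> n; apply: measurable_enorm; apply: measurable_rVB.
- move=> _ a a' Aa Aa'; apply: le_trans (lip _ _ Aa Aa').
  by have := ler_coord_enorm (Phi a - Phi a') i; rewrite !mxE.
Qed.

(** Evaluates a random Lipschitz map at a random point, with measurability assumed only at fixed
    points. The dense sequence in the product runs over pairs of terms of two dense sequences. *)
Lemma measurable_rV_lipschitz2 d1 d2 e (X : set 'rV[R]_d1) (Y : set 'rV[R]_d2)
    (L : R) (Phi : W -> 'rV[R]_d1 -> 'rV[R]_d2 -> 'rV[R]_e)
    (F : W -> 'rV[R]_d1) (G : W -> 'rV[R]_d2) :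
  0 <= L ->
  (forall w x x' y y', X x -> X x' -> Y y -> Y y' ->
     enorm (Phi w x y - Phi w x' y') <= L * enorm2 (x - x') (y - y')) ->
  (forall x y, X x -> Y y -> measurable_rV (fun w => Phi w x y)) ->
  (forall w, X (F w)) -> (forall w, Y (G w)) ->
  measurable_rV F -> measurable_rV G ->
  measurable_rV (fun w => Phi w (F w) (G w)).
Proof.
move=> L0 lip mPhi XF YG mF mG i.
have [q [Xq qd]] := @dense_sequence R d1 X (ex_intro _ _ (XF point)).
have [r [Yr rd]] := @dense_sequence R d2 Y (ex_intro _ _ (YG point)).
pose qr n := if @unpickle (nat * nat)%type n is Some (j, k) then (q j, r k)
             else (q 0%N, r 0%N).
have Aqr n : X (qr n).1 /\ Y (qr n).2.
  by rewrite /qr; case: unpickle => [[j k]|] /=; split.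
apply: (@measurable_lipschitz_comp R _ _ _ (fun a => X a.1 /\ Y a.2)
   (fun a a' => enorm2 (a.1 - a'.1) (a.2 - a'.2)) qr L (fun w => (F w, G w))
   (fun w a => Phi w a.1 a.2 0 i)) => //.
- by move=> *; exact: enorm2_ge0.
- move=> a s [Xa Ya] s0.
  have [j qj] := qd a.1 (s / 2) Xa (divr_gt0 s0 (ltr0n _ 2)).
  have [k rk] := rd a.2 (s / 2) Ya (divr_gt0 s0 (ltr0n _ 2)).
  exists (pickle (j, k)); rewrite /qr pickleK /=.
  rewrite -(@ltr_pXn2r _ 2) ?nnegrE ?enorm2_ge0 ?(ltW s0)//.
  rewrite sqr_enorm2 -!sqr_enorm.
  set u := enorm _ in qj *; set v := enorm _ in rk *.
  have u0 : 0 <= u by exact: enorm_ge0.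
  have v0 : 0 <= v by exact: enorm_ge0.
  have : u ^+ 2 < (s / 2) ^+ 2 by rewrite ltr_pXn2r// nnegrE; lra.
  have : v ^+ 2 < (s / 2) ^+ 2 by rewrite ltr_pXn2r// nnegrE; lra.
  have : 0 < s ^+ 2 by rewrite exprn_gt0.
  lra.
- by move=> w; split; [exact: XF|exact: YG].
- move=> n /=; apply: (@measurable_enorm2 _ _ _ _ _ (fun w => F w - (qr n).1)
    (fun w => G w - (qr n).2)); exact: measurable_rVB.
- move=> w a a' [Xa Ya] [Xa' Ya']; apply: le_trans (lip w _ _ _ _ Xa Xa' Ya Ya').
  by have := ler_coord_enorm (Phi w a.1 a.2 - Phi w a'.1 a'.2) i; rewrite !mxE.
- by move=> n; have [Xn Yn] := Aqr n; exact: mPhi.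
Qed.

(** The derivative is the pointwise limit of the difference quotients at increments [1 / (n + 1)].
    This gives measurability of stochastic gradients from that of the objective. *)
Lemma measurable_derive (V : normedModType R) (f : V -> W -> R) (a v : V) :
  (forall u, measurable_fun setT (f u)) ->
  (forall w, derivable (f ^~ w) a v) ->
  measurable_fun setT (fun w => 'D_v (f ^~ w) a).
Proof.
move=> mf df.
have hd : (@harmonic R) @ \oo --> 0^'.
  move=> S S0; have H : nbhs (0 : R) [set y | y != 0 -> S y] by exact: S0.
  have := @cvg_harmonic R _ H; rewrite /nbhs/=; apply: filterS => n /=; apply.
  by rewrite gt_eqF.
apply: (@measurable_fun_cvg _ _ _ _
  (fun n w => (harmonic n)^-1 *: (f (harmonic n *: v + a) w - f a w))).
  move=> n; apply: measurable_funM => //; exact: measurable_funB.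
move=> w _.
exact: (cvg_comp _ _ hd (df w)).
Qed.

End LipschitzComposition.

(** * Independence and conditional Fubini *)

Section IndependentPast.
Context {R : realType} {dO : measure_display} {Omega : measurableType dO}.
Context (P : probability Omega R) (I : choiceType).
Context (G : I -> set (set Omega)).
Hypothesis indG : mutually_independent P G.
Hypothesis GT : forall i, G i setT.
Hypothesis GI : forall i, setI_closed (G i).
Hypothesis Gm : forall i A, G i A -> measurable A.

Definition past_cylinders (J : seq I) : set (set Omega) :=
  [set B | exists2 A : I -> set Omega, (forall i, i \in J -> G i (A i)) &
                   B = \bigcap_(i in [set` J]) A i].

(** [Omega] itself with a coarser sigma-algebra. Dependence on the samples in [J] only becomes
    measurability on this type, and product measures with the sample space are at hand. *)
Definition past (J : seq I) := g_sigma_algebraType (past_cylinders J).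

Lemma past_cylinders_measurable J B : past_cylinders J B -> measurable B.
Proof.
move=> [A GA ->]; apply: fin_bigcap_measurable; first exact: finite_seq.
by move=> i Ji; exact: Gm (GA i Ji).
Qed.

Lemma past_cylindersI J : setI_closed (past_cylinders J).
Proof.
move=> _ _ [A GA ->] [B GB ->]; exists (fun i => A i `&` B i).
  by move=> i Ji; apply: GI; [exact: GA|exact: GB].
by rewrite bigcapI.
Qed.

Lemma past_cylindersT J : past_cylinders J setT.
Proof. by exists (fun=> setT) => //; rewrite bigcapT. Qed.

Lemma past_measurable J (B : set Omega) :
  <<s past_cylinders J >> B -> measurable B.
Proof.
move: B; apply: smallest_sub; first exact: sigma_algebra_measurable.
exact: past_cylinders_measurable.
Qed.

(** Uniqueness of measures on a pi-system: the finite measures P(B and E) and P(E) P(B) of B agree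
    on the cylinders, which generate the past. *)
Lemma past_indep J j (E B : set Omega) : uniq J -> j \notin J -> G j E ->
  <<s past_cylinders J >> B -> P (B `&` E) = (P B * P E)%E.
Proof.
move=> uJ jJ GE sB; have mE := Gm GE.
have PEfin : P E \is a fin_num by exact: fin_num_measure.
have PE0 : 0 <= fine (P E) by rewrite fine_ge0.
pose r := NngNum PE0.
have rE A : mscale r P A = (P E * P A)%E.
  by rewrite -[P E in RHS]fineK.
suff : mrestr P mE B = mscale r P B 
  by move=> H; rewrite muleC; exact: (etrans H (rE B)).
apply: (g_sigma_algebra_measure_unique (past_cylinders J) _ (fun=> setT)) => //.
- exact: past_cylinders_measurable.
- by move=> _; exact: past_cylindersT.
- by rewrite bigcup_const//; exists 0%N.
- exact: past_cylindersI.
- move=> _ [A GA ->]; apply: esym; apply: (etrans (rE _)); apply: esym.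
  rewrite /mrestr.
  (* Independence is applied twice to one family that carries [E] at the fresh index: over [J] and
     over [j :: J]. *)
  pose A' i := if i == j then E else A i.
  have A'J i : i \in J -> A' i = A i.
    by move=> iJ; rewrite /A'; case: eqVneq => // ij; move: jJ; rewrite -ij iJ.
  have -> : \bigcap_(i in [set` J]) A i = \bigcap_(i in [set` J]) A' i.
    by apply: eq_bigcapr => i /= iJ; rewrite A'J.
  have A'j : A' j = E by rewrite /A' eqxx.
  have HJ : P (\bigcap_(i in [set` J]) A' i) = (\prod_(i <- J) P (A' i))%E.
    by apply: indG => // i iJ; rewrite A'J//; exact: GA.
  have := indG (J := j :: J) (A := A'); rewrite /= jJ uJ => /(_ isT).
  rewrite big_cons A'j -HJ muleC => <-.
    congr (P _); apply/seteqP; split=> [w [H Ew] i /=|w H].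
      by rewrite inE => /orP[/eqP->|iJ]; [rewrite A'j|exact: H].
    split; last by have := H j; rewrite /= inE eqxx A'j; exact.
    by move=> i /= iJ; apply: H; rewrite /= inE iJ orbT.
  move=> i; rewrite inE => /orP[/eqP->|iJ]; first by rewrite A'j.
  by rewrite A'J//; exact: GA.
- by move=> _; apply: le_lt_trans (probability_le1 P (measurableI _ _ measurableT mE)) (ltry _).
Qed.

Definition to_past J : Omega -> past J := id.

Lemma measurable_to_past J : measurable_fun setT (to_past J).
Proof. by move=> _ B sB; rewrite setTI; exact: (@past_measurable J B sB). Qed.

Lemma past_le J K d (T : measurableType d) (f : Omega -> T) :
  {subset J <= K} -> measurable_fun setT (f : past J -> T) ->
  measurable_fun setT (f : past K -> T).
Proof.
move=> JK mf _ B mB; have := mf measurableT B mB; rewrite !setTI.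
move: (f @^-1` B); apply: smallest_sub; first exact: sigma_algebra_measurable.
move=> _ [A GA ->]; apply: sub_sigma_algebra.
exists (fun i => if i \in J then A i else setT).
  by move=> i _; case: ifPn => // iJ; exact: GA.
apply/seteqP; split=> [w H i /= iK|w H i /= iJ].
  by case: ifPn => // iJ; exact: H.
by have := H i (JK i iJ); rewrite iJ.
Qed.

Lemma measurable_past_ambient J d (T : measurableType d) (f : Omega -> T) :
  measurable_fun setT (f : past J -> T) -> measurable_fun setT f.
Proof.
move=> mf _ B mB; have := mf measurableT B mB; rewrite !setTI.
exact: (@past_measurable J).
Qed.

Lemma measurable_past_RV J j d (T : measurableType d) (Z : {RV P >-> T}) :
  j \in J -> sigma_of Z `<=` G j -> measurable_fun setT (Z : past J -> T).
Proof.
move=> jJ GZ _ B mB; rewrite setTI; apply: sub_sigma_algebra.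
exists (fun i => if i == j then Z @^-1` B else setT).
  move=> i _; case: eqVneq => // ->; apply: GZ.
  by exists B => //; rewrite setTI.
apply/seteqP; split=> [w H i /= iJ|w /(_ j jJ)]; last by rewrite eqxx.
by case: eqVneq.
Qed.

(** By [past_indep], the joint law of the past and of the fresh sample is the product of their laws,
    so Tonelli applies. Nonnegativity spares any integrability condition. *)
Lemma past_fubini J j d (T : measurableType d) (Z : {RV P >-> T})
    (D : probability T R) (Psi : past J * T -> \bar R) :
  uniq J -> j \notin J -> sigma_of Z `<=` G j ->
  (forall A, measurable A -> distribution P Z A = D A) ->
  measurable_fun setT Psi -> (forall z, 0 <= Psi z)%E ->
  (\int[P]_w Psi (w, Z w) = \int[P]_w \int[D]_z Psi (w, z))%E.
Proof.
move=> uJ jJ GZ ZD mPsi Psi0.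
(* [Q] is [P] restricted to the past sigma-algebra. *)
pose Q : probability (past J) R :=
  distribution P (mfun_Sub (mem_set (@measurable_to_past J))).
have mjoint : measurable_fun setT (fun w : Omega => (to_past J w, Z w)).
  by apply/measurable_fun_pair => //; exact: measurable_to_past.
pose joint : probability (past J * T)%type R :=
  distribution P (mfun_Sub (mem_set mjoint)).
have jointE : forall A, measurable A -> (Q \x D)%E A = joint A.
  apply: product_measure_unique => A B mA mB.
  apply: (etrans _ (congr1 (fun x => (Q A * x)%E) (ZD B mB))).
  apply: (@past_indep J j (Z @^-1` B)) => //.
  by apply: GZ; exists B => //; rewrite setTI.
transitivity (\int[joint]_z Psi z)%E.
  by rewrite ge0_integral_distribution.
transitivity (\int[(Q \x D)%E]_z Psi z)%E.
  by apply: eq_measure_integral => A mA _; apply: esym; exact: jointE.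
rewrite fubini_tonelli1// ge0_integral_distribution//.
  exact: measurable_fun_fubini_tonelli_F.
by move=> w; apply: integral_ge0.
Qed.

End IndependentPast.

(** * Mean vectors and second moments *)

Section HasMean.
Context {R : realType} {dT : measure_display} {T : measurableType dT}.
Context (mu : probability T R).
Implicit Types (h : T -> R).

(** Keeps integrability and the finite value together, so that expectations can be handled by real
    arithmetic. *)
Definition has_mean h (m : R) :=
  mu.-integrable setT (EFin \o h) /\ (\int[mu]_z (h z)%:E = m%:E)%E.

Lemma has_mean_cst c : has_mean (cst c) c.
Proof.
split; first exact: finite_measure_integrable_cst.
by have := expectation_cst mu c; rewrite unlock.
Qed.

Lemma has_meanD h h' m m' : has_mean h m -> has_mean h' m' ->
  has_mean (fun z => h z + h' z) (m + m').
Proof.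
move=> [ih eh] [ih' eh']; split.
  have -> : EFin \o (fun z => h z + h' z) = ((EFin \o h) \+ (EFin \o h'))%E by [].
  exact: integrableD.
under eq_integral do rewrite EFinD.
by rewrite integralD// eh eh' EFinD.
Qed.

Lemma has_meanZ c h m : has_mean h m -> has_mean (fun z => c * h z) (c * m).
Proof.
move=> [ih eh]; split.
  have -> : EFin \o (fun z => c * h z) = (fun z => c%:E * (EFin \o h) z)%E by [].
  exact: integrableZl.
under eq_integral do rewrite EFinM.
by rewrite integralZl// eh EFinM.
Qed.

Lemma has_meanZr c h m : has_mean h m -> has_mean (fun z => h z * c) (m * c).
Proof.
by move=> hm; rewrite mulrC; under eq_fun do rewrite mulrC; exact: has_meanZ.
Qed.

Lemma has_meanB h h' m m' : has_mean h m -> has_mean h' m' ->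
  has_mean (fun z => h z - h' z) (m - m').
Proof.
move=> mh mh'; have := has_meanD mh (has_meanZ (-1) mh').
by rewrite mulN1r; under eq_fun do rewrite mulN1r.
Qed.

Lemma has_mean_sum I (s : seq I) (h : I -> T -> R) (m : I -> R) :
  (forall i, has_mean (h i) (m i)) ->
  has_mean (fun z => \sum_(i <- s) h i z) (\sum_(i <- s) m i).
Proof.
move=> mh; elim: s => [|i s IH].
  under eq_fun do rewrite big_nil; rewrite big_nil; exact: has_mean_cst.
under eq_fun do rewrite big_cons; rewrite big_cons; exact: has_meanD.
Qed.

Lemma has_mean_le h h' m m' : has_mean h m -> has_mean h' m' ->
  (forall z, h z <= h' z) -> m <= m'.
Proof.
move=> [ih eh] [ih' eh'] hh'; rewrite -lee_fin -eh -eh'.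
by apply: le_integral => // z _; rewrite lee_fin.
Qed.

Lemma has_mean_measurable h m : has_mean h m -> measurable_fun setT h.
Proof. by move=> [/integrableP[/measurable_EFinP]]. Qed.

Lemma has_mean_ge0 h m : (forall z, 0 <= h z) -> has_mean h m -> 0 <= m.
Proof. by move=> h0 hm; apply: has_mean_le (has_mean_cst 0) hm _. Qed.

Lemma has_mean_bounded h K : measurable_fun setT h -> (forall z, 0 <= h z) ->
  (\int[mu]_z (h z)%:E <= K%:E)%E -> exists2 m, m <= K & has_mean h m.
Proof.
move=> mh h0 hK.
have fin : (\int[mu]_z (h z)%:E)%E \is a fin_num.
  rewrite ge0_fin_numE; first exact: le_lt_trans hK (ltry _).
  by apply: integral_ge0 => z _; rewrite lee_fin.
exists (fine (\int[mu]_z (h z)%:E)%E).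
  by rewrite -lee_fin fineK.
split; last by rewrite fineK.
apply/integrableP; split; first exact/measurable_EFinP.
under eq_integral do rewrite gee0_abs ?lee_fin//.
exact: le_lt_trans hK (ltry _).
Qed.

Lemma has_mean_dominated h g m : measurable_fun setT h -> (forall z, 0 <= h z) ->
  has_mean g m -> (forall z, h z <= g z) -> exists2 m', m' <= m & has_mean h m'.
Proof.
move=> mh h0 gm hg; apply: has_mean_bounded => //.
have [_ <-] := gm; apply: ge0_le_integral => //.
- by move=> z _; rewrite lee_fin.
- exact/measurable_EFinP.
- exact/measurable_EFinP/(has_mean_measurable gm).
- by move=> z _; rewrite lee_fin.
Qed.

(** Infinite integrals are sent to 0 by [fine], so this number carries meaning only along with
    [has_mean]. *)
Definition mean h := fine (\int[mu]_z (h z)%:E)%E.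

Lemma has_mean_mean h m : has_mean h m -> has_mean h (mean h).
Proof. by move=> hm; have [ih e] := hm; rewrite /mean e. Qed.

Lemma mean_eq h m : has_mean h m -> mean h = m.
Proof. by move=> [_ e]; rewrite /mean e. Qed.

(** A finite integral is a difference of two finite ones, those of the positive and negative parts.
    Unbiasedness of the gradients thereby yields their integrability. *)
Lemma has_mean_integral h m : measurable_fun setT h ->
  (\int[mu]_z (h z)%:E = m%:E)%E -> has_mean h m.
Proof.
move=> mh hm; split => //; have mE : measurable_fun setT (EFin \o h).
  exact/measurable_EFinP.
have : (\int[mu]_z (h z)%:E)%E \is a fin_num by rewrite hm.
rewrite integralE fin_numB => /andP[fp fn].
apply/integrableP; split => //.
rewrite [X in integral _ _ X](_ : _ = ((EFin \o h)^\+ \+ (EFin \o h)^\-)%E); last first.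
  by rewrite -fune_abse.
rewrite ge0_integralD//; first last.
- exact: measurable_funeneg.
- exact: measurable_funepos.
by rewrite lte_add_pinfty// ltey_eq ?fp ?fn.
Qed.

Definition has_mean_rV d (h : T -> 'rV[R]_d) (m : 'rV[R]_d) :=
  forall i, has_mean (fun z => h z 0 i) (m 0 i).

Lemma has_mean_rV_measurable d (h : T -> 'rV[R]_d) m :
  has_mean_rV h m -> measurable_rV h.
Proof. by move=> hm i; exact: has_mean_measurable (hm i). Qed.

Lemma has_mean_rVB d (h h' : T -> 'rV[R]_d) m m' :
  has_mean_rV h m -> has_mean_rV h' m' ->
  has_mean_rV (fun z => h z - h' z) (m - m').
Proof.
move=> hm hm' i; under eq_fun do rewrite !mxE; rewrite !mxE.
exact: has_meanB.
Qed.

Lemma has_mean_rVZ d c (h : T -> 'rV[R]_d) m :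
  has_mean_rV h m -> has_mean_rV (fun z => c *: h z) (c *: m).
Proof.
by move=> hm i; under eq_fun do rewrite !mxE; rewrite !mxE; exact: has_meanZ.
Qed.

Lemma has_mean_rV_cst d (a : 'rV[R]_d) : has_mean_rV (cst a) a.
Proof. by move=> i; exact: has_mean_cst. Qed.

Lemma has_mean_dot d (a : 'rV[R]_d) (h : T -> 'rV[R]_d) m :
  has_mean_rV h m -> has_mean (fun z => dot a (h z)) (dot a m).
Proof. by move=> hm; apply: has_mean_sum => i; exact: has_meanZ. Qed.

(** Jensen for the joint norm: pair the random vector with its own mean and use Cauchy-Schwarz. The
    mean gradient inherits the Lipschitz constant in this way. *)
Lemma has_mean_lipschitz2 d1 d2 (h : T -> 'rV[R]_d1) (k : T -> 'rV[R]_d2) m n C :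
  has_mean_rV h m -> has_mean_rV k n ->
  (forall z, enorm2 (h z) (k z) <= C) -> enorm2 m n <= C.
Proof.
move=> hm kn hC.
have C0 : 0 <= C := le_trans (enorm2_ge0 _ _) (hC point).
have H : dot m m + dot n n <= enorm2 m n * C.
  apply: has_mean_le (has_meanD (has_mean_dot m hm) (has_mean_dot n kn))
    (has_mean_cst _) _ => z.
  apply: (@le_trans _ _ (enorm2 m n * enorm2 (h z) (k z))).
    apply: le_trans (lerD (cauchy_schwarz _ _) (cauchy_schwarz _ _)) _.
    rewrite -(@ler_pXn2r _ 2) ?nnegrE ?addr_ge0 ?mulr_ge0 ?enorm_ge0 ?enorm2_ge0//.
    rewrite exprMn !sqr_enorm2 -!sqr_enorm.
    have := sqr_ge0 (enorm m * enorm (k z) - enorm n * enorm (h z)); lra.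
  by rewrite ler_wpM2l ?enorm2_ge0.
have [->//|m0] := eqVneq (enorm2 m n) 0.
have mp : 0 < enorm2 m n by rewrite lt0r m0 enorm2_ge0.
by rewrite -(ler_pM2l mp) -expr2 sqr_enorm2.
Qed.

Lemma second_moment_shift d (a : 'rV[R]_d) (N : T -> 'rV[R]_d) K :
  has_mean_rV N 0 -> (\int[mu]_z (dot (N z) (N z))%:E <= K%:E)%E ->
  (\int[mu]_z (dot (a + N z) (a + N z))%:E <= (dot a a + K)%:E)%E.
Proof.
move=> N0 NK; have mN := has_mean_rV_measurable N0.
have [m mK hm] := has_mean_bounded (measurable_dot mN mN) (fun z => dot_ge0 _) NK.
have [_ ->] : has_mean (fun z => dot (a + N z) (a + N z)) (dot a a + 2 * 0 + m).
  under eq_fun do rewrite dot_sqrD.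
  apply: has_meanD => //; apply: has_meanD; first exact: has_mean_cst.
  by apply: has_meanZ; have := has_mean_dot a N0; rewrite (dotC a) dot0l.
by rewrite lee_fin; lra.
Qed.

End HasMean.

(** * Averages over an independent mini-batch *)

Section BatchSecondMoment.
Context {R : realType} {dO : measure_display} {Omega : measurableType dO}.
Context (P : probability Omega R) (I : choiceType).
Context (G : I -> set (set Omega)).
Hypothesis indG : mutually_independent P G.
Hypothesis GT : forall i, G i setT.
Hypothesis GI : forall i, setI_closed (G i).
Hypothesis Gm : forall i A, G i A -> measurable A.
Context {dX : measure_display} {Xi : measurableType dX} (D : probability Xi R).
Context (b : nat) (Z : 'I_b -> {RV P >-> Xi}) (idx : 'I_b -> I).
Hypothesis ZD : forall i A, measurable A -> distribution P (Z i) A = D A.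
Hypothesis GZ : forall i, sigma_of (Z i) `<=` G (idx i).
Hypothesis idx_inj : injective idx.
Context (J : seq I).
Hypothesis uJ : uniq J.
Hypothesis idxJ : forall i, idx i \notin J.

Local Notation past := (past G).

(** The samples are integrated out one at a time. Given the past, each is centred, so its cross term
    vanishes and it adds at most [K w / b ^ 2]; [b] of them add [K w / b]. *)
Lemma batch_second_moment d (a : Omega -> 'rV[R]_d)
    (N : Omega -> Xi -> 'rV[R]_d) (K : Omega -> R) :
  measurable_rV (a : past J -> _) ->
  measurable_rV (fun wz : past J * Xi => N wz.1 wz.2) ->
  measurable_fun setT (K : past J -> R) ->
  (forall w, has_mean_rV D (N w) 0) ->
  (forall w, 0 <= K w) ->
  (forall w, (\int[D]_z (dot (N w z) (N w z))%:E <= (K w)%:E)%E) ->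
  (\int[P]_w (let c := a w + b%:R^-1 *: \sum_(i < b) N w (Z i w) in dot c c)%:E <=
   \int[P]_w (dot (a w) (a w) + K w / b%:R)%:E)%E.
Proof.
move=> ma mN mK N0 K0 NK.
have dirK (s : seq 'I_b) w : 0 <= (size s)%:R * (K w / b%:R ^+ 2).
  by rewrite mulr_ge0// divr_ge0.
pose A s w := a w + b%:R^-1 *: \sum_(i <- s) N w (Z i w).
(* Samples already summed join the past of the next one. *)
pose Js s := [seq idx i | i <- s] ++ J.
have JJs s : {subset J <= Js s} by move=> i iJ; rewrite mem_cat iJ orbT.
have mA s : measurable_rV (A s : past (Js s) -> _).
  apply: measurable_rVD; first by move=> k; apply: (past_le GT (@JJs s)); exact: ma.
  apply: measurable_rVZ.
  have mN' i k : i \in s -> measurable_fun setT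
      ((fun w => N w (Z i w) 0 k) : past (Js s) -> R).
    move=> si.
    apply: (@measurableT_comp _ _ _ _ _ _ (fun wz : past J * Xi => N wz.1 wz.2 0 k)
      setT (fun w : past (Js s) => ((w : past J), Z i w))); first exact: mN.
    apply/measurable_fun_pair.
      exact: (@past_le _ _ _ _ GT J (Js s) _ (past J) id (@JJs s)).
    apply: (measurable_past_RV GT _ (@GZ i)).
    by rewrite mem_cat map_f.
  move=> k; under eq_fun do rewrite summxE.
  (* [measurable_sum] wants every term measurable, whereas samples outside [s] do not belong to this
     past; their terms are replaced by 0. *)
  rewrite (_ : (fun _ => _) = (fun w : past (Js s) =>
      \sum_(i <- s) (if i \in s then N w (Z i w) 0 k else 0))).
    by apply: measurable_sum => i; case: (boolP (i \in s)) => si; [exact: mN'|exact: measurable_cst].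
  by apply/funext => w; rewrite big_seq big_mkcond.
have step s : uniq s ->
  (\int[P]_w (dot (A s w) (A s w))%:E <=
    \int[P]_w (dot (a w) (a w) + (size s)%:R * (K w / b%:R ^+ 2))%:E)%E.
  elim: s => [_|i s IH /= /andP[si us]].
    under eq_integral do rewrite /A big_nil scaler0 addr0.
    by under [leRHS]eq_integral do rewrite mul0r addr0.
  have AE w : A (i :: s) w = A s w + b%:R^-1 *: N w (Z i w).
    by rewrite /A big_cons scalerDr addrA addrAC.
  under eq_integral do rewrite AE.
  pose Psi (wz : past (Js s) * Xi) :=
    (dot (A s wz.1 + b%:R^-1 *: N wz.1 wz.2) (A s wz.1 + b%:R^-1 *: N wz.1 wz.2))%:E.
  have mPsi : measurable_fun setT Psi.
    have mS : measurable_rV (fun wz : past (Js s) * Xi =>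
        A s wz.1 + b%:R^-1 *: N wz.1 wz.2).
      apply: measurable_rVD.
        by move=> k; exact: (measurableT_comp (mA s k) measurable_fst).
      apply: measurable_rVZ => k.
      apply: (@measurableT_comp _ _ _ _ _ _ (fun wz : past J * Xi => N wz.1 wz.2 0 k)
        setT (fun wz : past (Js s) * Xi => ((wz.1 : past J), wz.2))); first exact: mN.
      apply/measurable_fun_pair; last exact: measurable_snd.
      apply: (@measurableT_comp _ _ _ _ _ _ (id : past (Js s) -> past J)); last first.
        exact: measurable_fst.
      exact: (@past_le _ _ _ _ GT J (Js s) _ (past J) id (@JJs s)).
    by have /measurable_EFinP := measurable_dot mS mS.
  have uJs : uniq (Js s).
    rewrite cat_uniq uJ andbT map_inj_uniq// us /=.
    apply/hasPn => j jJ; apply/mapP => -[k _ jk].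
    by have := idxJ k; rewrite -jk jJ.
  have iJs : idx i \notin Js s by rewrite mem_cat negb_or idxJ andbT mem_map.
  have Psi0 z : (0 <= Psi z)%E by rewrite /Psi lee_fin dot_ge0.
  rewrite (past_fubini indG GT GI Gm uJs iJs (@GZ i) (@ZD i) mPsi Psi0).
  apply: (@le_trans _ _ (\int[P]_w (dot (A s w) (A s w) + K w / b%:R ^+ 2)%:E)%E).
    apply: ge0_le_integral => //.
    - by move=> w _; apply: integral_ge0 => z _; rewrite lee_fin dot_ge0.
    - apply: (measurable_past_ambient Gm (J := Js s)).
      apply: (@measurable_fun_fubini_tonelli_F _ _ (past (Js s)) Xi R D Psi) => //.
    - apply/measurable_EFinP; apply: (measurable_past_ambient Gm (J := Js s)).
      have mKs := @past_le _ _ _ _ GT J (Js s) _ _ K (@JJs s) mK.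
      apply: measurable_funD; first exact: (measurable_dot (mA s) (mA s)).
      exact: measurable_funM mKs (measurable_cst _).
    - move=> w _; apply: (@second_moment_shift _ _ _ D _ (A s w)
        (fun z => b%:R^-1 *: N w z) (K w / b%:R ^+ 2)).
        by have := has_mean_rVZ b%:R^-1 (N0 w); rewrite scaler0.
      under eq_integral do rewrite dotZl dotZr mulrA -expr2 EFinM.
      have mNw := has_mean_rV_measurable (N0 w).
      have mNN : measurable_fun setT (fun z => (dot (N w z) (N w z))%:E).
        by have /measurable_EFinP := measurable_dot mNw mNw.
      rewrite ge0_integralZl_EFin ?sqr_ge0//; last first.
        by move=> z _; rewrite lee_fin dot_ge0.
      rewrite (mulrC (K w)) -exprVn [X in (_ <= X)%E]EFinM.
      apply: lee_pmul => //.
      by apply: integral_ge0 => z _; rewrite lee_fin dot_ge0.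
  have mKP : measurable_fun setT (EFin \o (fun w => K w / b%:R ^+ 2)).
    apply/measurable_EFinP; apply: measurable_funM => //.
    exact: (measurable_past_ambient Gm mK).
  have mAP : measurable_fun setT (EFin \o (fun w => dot (A s w) (A s w))).
    apply/measurable_EFinP; apply: (measurable_past_ambient Gm (J := Js s)).
    exact: measurable_dot.
  have maP : measurable_fun setT (EFin \o (fun w => dot (a w) (a w) +
       (size s)%:R * (K w / b%:R ^+ 2))).
    apply/measurable_EFinP; apply: (measurable_past_ambient Gm (J := J)).
    apply: measurable_funD; first exact: measurable_dot.
    by apply: measurable_funM => //; exact: measurable_funM.
  under eq_integral do rewrite EFinD.
  rewrite ge0_integralD//; first last.
  - by move=> w _; rewrite lee_fin divr_ge0.
  - by move=> w _; rewrite lee_fin dot_ge0.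
  rewrite [leRHS](_ : _ = \int[P]_w ((dot (a w) (a w) +
       (size s)%:R * (K w / b%:R ^+ 2))%:E + (K w / b%:R ^+ 2)%:E))%E; last first.
    apply: eq_integral => w _; rewrite -EFinD; congr EFin.
    by rewrite -natr1 mulrDl mul1r addrA.
  rewrite ge0_integralD//; first last.
  - by move=> w _; rewrite lee_fin divr_ge0.
  - by move=> w _; rewrite lee_fin addr_ge0 ?dot_ge0.
  by apply: leeD => //; exact: IH.
have := step (index_enum 'I_b) (index_enum_uniq _).
have sb : size (index_enum 'I_b) = b.
  by rewrite -[RHS]card_ord -sum1_card -sum1_size; exact: eq_bigl.
rewrite sb => /le_trans; apply; rewrite le_eqVlt; apply/orP; left; apply/eqP.
apply: eq_integral => w _; congr (_ + _)%:E.
(* For an empty batch both sides vanish, the inverse of 0 being 0. *)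
case: (posnP b) => [->|b0]; first by rewrite mulr0n mul0r invr0 mulr0.
have : b%:R != 0 :> R by rewrite pnatr_eq0 -lt0n.
by move=> bn; field.
Qed.

End BatchSecondMoment.

(** * One step of the recursive gradient estimator *)

Section OracleComponent.
Context {R : realType} {d1 d2 e : nat}.
Context {dX : measure_display} {Xi : measurableType dX} (D : probability Xi R).
Context (X : set 'rV[R]_d1) (Y : set 'rV[R]_d2) (L delta : R).
Context (h : Xi -> 'rV[R]_d1 -> 'rV[R]_d2 -> 'rV[R]_e).
Context (hm : 'rV[R]_d1 -> 'rV[R]_d2 -> 'rV[R]_e).
Hypothesis L_ge0 : 0 <= L.
Hypothesis h_mean : forall x y, X x -> Y y ->
  has_mean_rV D (fun z => h z x y) (hm x y).
Hypothesis h_var : forall x y, X x -> Y y ->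
  (\int[D]_z (dot (h z x y - hm x y) (h z x y - hm x y))%:E <= (delta ^+ 2)%:E)%E.
Hypothesis h_lip : forall z x x' y y', X x -> X x' -> Y y -> Y y' ->
  enorm (h z x y - h z x' y') <= L * enorm2 (x - x') (y - y').
Hypothesis hm_lip : forall x x' y y', X x -> X x' -> Y y -> Y y' ->
  enorm (hm x y - hm x' y') <= L * enorm2 (x - x') (y - y').

(** The contribution of one sample to the estimation error: the new error is [1 - alpha] times the
    old one plus the batch average of these terms. *)
Definition storm_noise alpha x y x' y' z :=
  (hm x' y' - h z x' y') - (1 - alpha) *: (hm x y - h z x y).

Lemma storm_noise_mean alpha x y x' y' : X x -> Y y -> X x' -> Y y' ->
  has_mean_rV D (storm_noise alpha x y x' y') 0.
Proof.
move=> Xx Yy Xx' Yy'.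
have centred u v : X u -> Y v -> has_mean_rV D (fun z => hm u v - h z u v) 0.
  move=> Xu Yv; rewrite -(subrr (hm u v)); apply: has_mean_rVB.
    exact: has_mean_rV_cst.
  exact: h_mean.
have H1 := centred _ _ Xx' Yy'.
have H2 := has_mean_rVZ (1 - alpha) (centred _ _ Xx Yy).
by have := has_mean_rVB H1 H2; rewrite scaler0 subr0.
Qed.

(** The noise is [alpha] times the fluctuation at the new point plus [1 - alpha] times a difference
    of two increments from the old point to the new. Only the first part sees the variance; the
    increments are Lipschitz, so the second is of the order of the move. *)
Lemma storm_noise_moment alpha x y x' y' : X x -> Y y -> X x' -> Y y' ->
  0 <= alpha -> alpha <= 1 ->
  (\int[D]_z (dot (storm_noise alpha x y x' y' z) (storm_noise alpha x y x' y' z))%:E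
   <= (2 * alpha ^+ 2 * delta ^+ 2 + 8 * L ^+ 2 *
        (dot (x' - x) (x' - x) + dot (y' - y) (y' - y)))%:E)%E.
Proof.
move=> Xx Yy Xx' Yy' a0 a1; set r := dot (x' - x) _ + _.
have r0 : 0 <= r by rewrite addr_ge0 ?dot_ge0.
have ptw z : dot (storm_noise alpha x y x' y' z) (storm_noise alpha x y x' y' z) <=
  2 * alpha ^+ 2 * dot (h z x' y' - hm x' y') (h z x' y' - hm x' y')
    + 8 * L ^+ 2 * r.
  pose u := hm x' y' - hm x y; pose w := h z x' y' - h z x y.
  have -> : storm_noise alpha x y x' y' z =
      - (alpha *: (h z x' y' - hm x' y')) + (1 - alpha) *: (u - w).
    by apply/rowP => i; rewrite /storm_noise /u /w !mxE; ring.
  apply: le_trans (dot_sqrD_le _ _) _.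
  rewrite dotNl dotNr opprK !dotZl !dotZr.
  have Hu : dot u u <= L ^+ 2 * r.
    rewrite -sqr_enorm /r -sqr_enorm2 -exprMn.
    by rewrite ler_pXn2r ?nnegrE ?mulr_ge0 ?enorm_ge0 ?enorm2_ge0// hm_lip.
  have Hw : dot w w <= L ^+ 2 * r.
    rewrite -sqr_enorm /r -sqr_enorm2 -exprMn.
    by rewrite ler_pXn2r ?nnegrE ?mulr_ge0 ?enorm_ge0 ?enorm2_ge0// h_lip.
  have H1 := dot_sqrB_le u w.
  have H2 : 2 * (1 - alpha) ^+ 2 * dot (u - w) (u - w) <= 2 * dot (u - w) (u - w).
    apply: ler_wpM2r; first exact: dot_ge0.
    by rewrite ler_piMr// expr_le1//; lra.
  lra.
have mh := has_mean_rV_measurable (h_mean Xx' Yy').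
have mhm : measurable_rV (fun z => h z x' y' - hm x' y').
  exact: measurable_rVB mh (measurable_rV_cst _).
have mN := has_mean_rV_measurable (storm_noise_mean alpha Xx Yy Xx' Yy').
have [m mle hmm] := has_mean_bounded (measurable_dot mhm mhm)
  (fun z => dot_ge0 _) (h_var Xx' Yy').
have [_ E] := has_meanD (has_meanZ (2 * alpha ^+ 2) hmm)
   (has_mean_cst D (8 * L ^+ 2 * r)).
apply: (@le_trans _ _ (2 * alpha ^+ 2 * m + 8 * L ^+ 2 * r)%:E).
  rewrite -E; apply: ge0_le_integral => //.
  - by move=> z _; rewrite lee_fin dot_ge0.
  - by have /measurable_EFinP := measurable_dot mN mN.
  - apply/measurable_EFinP; apply: measurable_funD => //.
    by apply: measurable_funM => //; exact: measurable_dot.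
  - by move=> z _; rewrite lee_fin; exact: ptw.
rewrite lee_fin lerD2r; apply: ler_wpM2l => //.
by rewrite mulr_ge0// sqr_ge0.
Qed.

Context {dO : measure_display} {Omega : measurableType dO}.
Context (P : probability Omega R) (I : choiceType).
Context (G : I -> set (set Omega)).
Hypothesis indG : mutually_independent P G.
Hypothesis GT : forall i, G i setT.
Hypothesis GI : forall i, setI_closed (G i).
Hypothesis Gm : forall i A, G i A -> measurable A.
Context (b : nat) (Z : 'I_b -> {RV P >-> Xi}) (idx : 'I_b -> I).
Hypothesis b_gt0 : (0 < b)%N.
Hypothesis ZD : forall i A, measurable A -> distribution P (Z i) A = D A.
Hypothesis GZ : forall i, sigma_of (Z i) `<=` G (idx i).
Hypothesis idx_inj : injective idx.
Context (J : seq I).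
Hypothesis uJ : uniq J.
Hypothesis idxJ : forall i, idx i \notin J.

Local Notation past := (past G).

Definition batch_mean (B : 'I_b -> Xi) x y := b%:R^-1 *: \sum_(i < b) h (B i) x y.

Lemma batch_mean_const (a : 'rV[R]_e) : b%:R^-1 *: \sum_(i < b) a = a.
Proof.
rewrite sumr_const card_ord -[a *+ b]scaler_nat scalerA mulVf ?scale1r//.
by rewrite pnatr_eq0 -lt0n.
Qed.

Lemma init_moment x y : X x -> Y y ->
  (\int[P]_w (let c := hm x y - batch_mean (fun i => Z i w) x y in dot c c)%:E
   <= (delta ^+ 2 / b%:R)%:E)%E.
Proof.
move=> Xx Yy.
have mh := has_mean_rV_measurable (h_mean Xx Yy).
have := @batch_second_moment _ _ _ P I G indG GT GI Gm _ _ D b Z idx ZD GZ idx_inj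
  J uJ idxJ _ (fun=> 0) (fun _ z => hm x y - h z x y) (fun=> delta ^+ 2).
move=> /(_ _ _ _ _ _ _)/le_trans H; apply: le_trans (H _ _ _ _ _ _ _ _).
- rewrite le_eqVlt; apply/orP; left; apply/eqP.
  apply: eq_integral => w _; congr EFin.
  rewrite /batch_mean add0r sumrB scalerBr batch_mean_const.
  done.
- exact: measurable_rV_cst.
- apply: measurable_rVB; first exact: measurable_rV_cst.
  by move=> i; exact: (measurableT_comp (mh i) measurable_snd).
- exact: measurable_cst.
- move=> _; rewrite -(subrr (hm x y)); apply: has_mean_rVB.
    exact: has_mean_rV_cst.
  exact: h_mean.
- by move=> _; rewrite sqr_ge0.
- move=> _; apply: le_trans (h_var Xx Yy).
  rewrite le_eqVlt; apply/orP; left; apply/eqP.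
  by apply: eq_integral => z _; rewrite -!sqr_enorm enormBC.
- under eq_integral do rewrite dot0l add0r.
  have [_] := has_mean_cst P (delta ^+ 2 / b%:R).
  by move=> ->.
Qed.

(** [batch_second_moment] with the damped old error as past part and [storm_noise] as fluctuation;
    [(1 - alpha) ^+ 2] is then relaxed to [1 - alpha]. *)
Lemma storm_step alpha (x x' : Omega -> 'rV[R]_d1) (y y' : Omega -> 'rV[R]_d2)
    (v : Omega -> 'rV[R]_e) :
  0 <= alpha -> alpha <= 1 ->
  (forall w, X (x w)) -> (forall w, X (x' w)) ->
  (forall w, Y (y w)) -> (forall w, Y (y' w)) ->
  measurable_rV (x : past J -> _) -> measurable_rV (x' : past J -> _) ->
  measurable_rV (y : past J -> _) -> measurable_rV (y' : past J -> _) ->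
  measurable_rV (v : past J -> _) ->
  (\int[P]_w (let c := hm (x' w) (y' w) -
      (batch_mean (fun i => Z i w) (x' w) (y' w) + (1 - alpha) *:
         (v w - batch_mean (fun i => Z i w) (x w) (y w))) in dot c c)%:E
   <= \int[P]_w ((1 - alpha) * dot (hm (x w) (y w) - v w) (hm (x w) (y w) - v w)
       + (2 * alpha ^+ 2 * delta ^+ 2 + 8 * L ^+ 2 *
        (dot (x' w - x w) (x' w - x w) + dot (y' w - y w) (y' w - y w))) / b%:R)%:E)%E.
Proof.
move=> a0 a1 Xx Xx' Yy Yy' mx mx' my my' mv.
pose K w := 2 * alpha ^+ 2 * delta ^+ 2 + 8 * L ^+ 2 *
        (dot (x' w - x w) (x' w - x w) + dot (y' w - y w) (y' w - y w)).
pose a w := (1 - alpha) *: (hm (x w) (y w) - v w).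
pose N w z := storm_noise alpha (x w) (y w) (x' w) (y' w) z.
have mhm (p : Omega -> 'rV[R]_d1) (q : Omega -> 'rV[R]_d2) :
    (forall w, X (p w)) -> (forall w, Y (q w)) ->
    measurable_rV (p : past J -> _) -> measurable_rV (q : past J -> _) ->
    measurable_rV ((fun w => hm (p w) (q w)) : past J -> _).
  move=> Xp Yq mp mq.
  apply: (@measurable_rV_lipschitz2 R _ (past J) d1 d2 e X Y L (fun _ => hm) p q) => //.
  by move=> *; exact: measurable_rV_cst.
(* Joint measurability in the past and the sample, as Tonelli requires it. *)
have mh (p : Omega -> 'rV[R]_d1) (q : Omega -> 'rV[R]_d2) :
    (forall w, X (p w)) -> (forall w, Y (q w)) ->
    measurable_rV (p : past J -> _) -> measurable_rV (q : past J -> _) ->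
    measurable_rV (fun wz : past J * Xi => h wz.2 (p wz.1) (q wz.1)).
  move=> Xp Yq mp mq.
  apply: (@measurable_rV_lipschitz2 R _ (past J * Xi)%type d1 d2 e X Y L
    (fun wz => h wz.2) (fun wz => p wz.1) (fun wz => q wz.1)) => //.
  - by move=> wz *; exact: h_lip.
  - move=> u u' Xu Yu' i.
    exact: (measurableT_comp (has_mean_rV_measurable (h_mean Xu Yu') i) measurable_snd).
  - by move=> i; exact: (measurableT_comp (mp i) measurable_fst).
  - by move=> i; exact: (measurableT_comp (mq i) measurable_fst).
have lift (F : past J -> 'rV[R]_e) : measurable_rV F ->
    measurable_rV (fun wz : past J * Xi => F wz.1).
  by move=> mF i; exact: (measurableT_comp (mF i) measurable_fst).
have ma : measurable_rV (a : past J -> _).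
  by apply: measurable_rVZ; apply: measurable_rVB => //; exact: mhm.
have mN : measurable_rV (fun wz : past J * Xi => N wz.1 wz.2).
  apply: measurable_rVB.
    by apply: measurable_rVB; [apply: (lift (fun w => hm (x' w) (y' w))); exact: mhm|exact: mh].
  apply: measurable_rVZ; apply: measurable_rVB.
    by apply: (lift (fun w => hm (x w) (y w))); exact: mhm.
  exact: mh.
have mK : measurable_fun setT (K : past J -> R).
  apply: measurable_funD => //; apply: measurable_funM => //.
  by apply: measurable_funD; apply: measurable_dot; exact: measurable_rVB.
have K0 w : 0 <= K w.
  apply: addr_ge0; first by rewrite -mulrA -exprMn mulr_ge0// sqr_ge0.
  by rewrite mulr_ge0 ?addr_ge0 ?dot_ge0// mulr_ge0// sqr_ge0.
have := @batch_second_moment _ _ _ P I G indG GT GI Gm _ _ D b Z idx ZD GZ idx_inj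
  J uJ idxJ _ a N K ma mN mK
  (fun w => storm_noise_mean alpha (Xx w) (Yy w) (Xx' w) (Yy' w)) K0
  (fun w => storm_noise_moment (Xx w) (Yy w) (Xx' w) (Yy' w) a0 a1).
move=> H; apply: le_trans (le_trans H _).
  rewrite le_eqVlt; apply/orP; left; apply/eqP.
  apply: eq_integral => w _; congr EFin; rewrite /batch_mean /N /storm_noise.
  have E u (k : 'I_b -> 'rV[R]_e) : b%:R^-1 *: (\sum_(i < b) (u - k i)) =
      u - b%:R^-1 *: \sum_(i < b) k i.
    by rewrite sumrB scalerBr batch_mean_const.
  rewrite [in RHS]sumrB -[in RHS]scaler_sumr [in RHS]scalerBr [in RHS]scalerA.
  rewrite [in RHS]mulrC -[in RHS]scalerA.
  rewrite (E (hm (x w) (y w)) (fun i => h (Z i w) (x w) (y w))).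
  rewrite (E (hm (x' w) (y' w)) (fun i => h (Z i w) (x' w) (y' w))).
  set c1 := _ - _; set c2 := a w + _.
  suff -> : c1 = c2 by [].
  by apply/rowP => i; rewrite /c1 /c2 /a !mxE; ring.
have m1 : measurable_fun setT ((fun w => dot (a w) (a w) + K w / b%:R) : past J -> R).
  by apply: measurable_funD; [exact: measurable_dot|exact: measurable_funM].
have m2 : measurable_fun setT ((fun w => (1 - alpha) *
   dot (hm (x w) (y w) - v w) (hm (x w) (y w) - v w) + K w / b%:R) : past J -> R).
  apply: measurable_funD; last exact: measurable_funM.
  apply: measurable_funM => //.
  by apply: measurable_dot; apply: measurable_rVB => //; exact: mhm.
apply: ge0_le_integral => //.
- by move=> w _; rewrite lee_fin addr_ge0 ?dot_ge0 ?divr_ge0.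
- by apply/measurable_EFinP; exact: (measurable_past_ambient Gm m1).
- by apply/measurable_EFinP; exact: (measurable_past_ambient Gm m2).
- move=> w _; rewrite lee_fin lerD2r /a dotZl dotZr mulrA.
  apply: ler_wpM2r; first exact: dot_ge0.
  by rewrite ler_piMr//; lra.
Qed.

End OracleComponent.

(** * Regularity of the stochastic objective and of its mean *)

Section StochasticSaddleProblem.
Context {R : realType} {d1 d2 : nat}.
Context {d : measure_display} {Xi : measurableType d} (D : probability Xi R).
Context (f : 'rV[R]_d1 -> 'rV[R]_d2 -> Xi -> R).
Context (X : set 'rV[R]_d1) (Y : set 'rV[R]_d2) (Lf delta tau : R).
Hypothesis so : stochastic_objective D f X Y.
Hypothesis bv : bounded_variance D f X Y delta.
Hypothesis lip : lipschitz_gradient f X Y Lf.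
Hypothesis sc : strongly_concave D f X Y tau.
Hypothesis tau_gt0 : 0 < tau.

Local Notation fm := (fmean D f).

Lemma objective_measurable x y : measurable_fun setT (f x y).
Proof.
by have [/(_ x y)/integrableP[/measurable_EFinP]] := so.
Qed.

(** Measurability comes from difference quotients, integrability from the finiteness of the
    prescribed expectation. *)
Lemma sgradx_mean x y : X x -> Y y ->
  has_mean_rV D (fun s => sgradx f s x y) (gradx fm x y).
Proof.
move=> Xx Yy; have [_ df _ mean _] := so.
move=> i; apply: has_mean_integral.
  rewrite /sgradx /gradx; under eq_fun do rewrite mxE.
  apply: (@measurable_derive R _ Xi 'rV[R]_d1 (fun u s => f u y s)) => [u|s].
    exact: objective_measurable.
  apply: diff_derivable.
  exact: (differentiable2_fst (G := fun u v => f u v s) (df s x y Xx Yy)).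
by have := mean x y i Xx Yy; rewrite unlock.
Qed.

Lemma sgrady_mean x y : X x -> Y y ->
  has_mean_rV D (fun s => sgrady f s x y) (grady fm x y).
Proof.
move=> Xx Yy; have [_ df _ _ mean] := so.
move=> i; apply: has_mean_integral.
  rewrite /sgrady /grady; under eq_fun do rewrite mxE.
  apply: (@measurable_derive R _ Xi 'rV[R]_d2 (fun u s => f x u s)) => [u|s].
    exact: objective_measurable.
  apply: diff_derivable.
  exact: (differentiable2_snd (G := fun u v => f u v s) (df s x y Xx Yy)).
by have := mean x y i Xx Yy; rewrite unlock.
Qed.

Lemma sgradx_variance x y : X x -> Y y ->
  (\int[D]_s (dot (sgradx f s x y - gradx fm x y) (sgradx f s x y - gradx fm x y))%:E
    <= (delta ^+ 2)%:E)%E.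
Proof.
move=> Xx Yy; have [+ _] := bv Xx Yy; rewrite unlock.
by under eq_integral do rewrite sqr_enorm.
Qed.

Lemma sgrady_variance x y : X x -> Y y ->
  (\int[D]_s (dot (sgrady f s x y - grady fm x y) (sgrady f s x y - grady fm x y))%:E
    <= (delta ^+ 2)%:E)%E.
Proof.
move=> Xx Yy; have [_] := bv Xx Yy; rewrite unlock.
by under eq_integral do rewrite sqr_enorm.
Qed.

Lemma sgradx_lip s x x' y y' : X x -> X x' -> Y y -> Y y' ->
  enorm (sgradx f s x y - sgradx f s x' y') <= Lf * enorm2 (x - x') (y - y').
Proof.
by move=> *; apply: le_trans (lip s _ _ _ _) => //; have [] := ler_enorm2
  (sgradx f s x y - sgradx f s x' y') (sgrady f s x y - sgrady f s x' y').
Qed.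

Lemma sgrady_lip s x x' y y' : X x -> X x' -> Y y -> Y y' ->
  enorm (sgrady f s x y - sgrady f s x' y') <= Lf * enorm2 (x - x') (y - y').
Proof.
by move=> *; apply: le_trans (lip s _ _ _ _) => //; have [] := ler_enorm2
  (sgradx f s x y - sgradx f s x' y') (sgrady f s x y - sgrady f s x' y').
Qed.

Lemma mean_gradient_lip x x' y y' : X x -> X x' -> Y y -> Y y' ->
  enorm2 (gradx fm x y - gradx fm x' y') (grady fm x y - grady fm x' y')
    <= Lf * enorm2 (x - x') (y - y').
Proof.
move=> Xx Xx' Yy Yy'.
apply: (has_mean_lipschitz2 (has_mean_rVB (sgradx_mean Xx Yy) (sgradx_mean Xx' Yy'))
  (has_mean_rVB (sgrady_mean Xx Yy) (sgrady_mean Xx' Yy'))) => s.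
exact: lip.
Qed.

Lemma mean_differentiable x y : X x -> Y y -> differentiable2 fm x y.
Proof. by have [_ _ + _ _] := so; exact. Qed.

(** Beyond distance [2 * enorm (grady fm x y1) / tau] from [y1] the quadratic term of strong
    concavity beats the linear one, so a maximiser exists even on an unbounded [Y]. *)
Lemma ystarP y1 x : closed Y -> Y y1 -> X x ->
  Y (ystar D f Y x) /\ forall y, Y y -> fm x y <= fm x (ystar D f Y x).
Proof.
move: (tau_gt0) => tau0 clY Yy1 Xx; rewrite /ystar.
apply: (@getPex _ (fun y => Y y /\ _)).
have [|y Yy yr|p Yp pmin] := @closed_coercive_min R d2 (fun y => - fm x y) Y y1
   (2 * enorm (grady fm x y1) / tau) clY Yy1.
- move=> y Yy; apply: continuousN.
  apply: differentiable_continuous.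
  exact: differentiable2_snd (mean_differentiable Xx Yy).
- rewrite ltrN2; apply: le_lt_trans (sc Xx Yy Yy1) _.
  have := cauchy_schwarz (grady fm x y1) (y - y1).
  have : 0 < enorm (y - y1).
    apply: le_lt_trans yr; rewrite divr_ge0 ?mulr_ge0 ?enorm_ge0//; exact: ltW.
  move: yr; rewrite ltr_pdivrMr//.
  set r := enorm (y - y1); set g := enorm _ => gr r0 c.
  have : 2 * g * r < r * tau * r by rewrite ltr_pM2r.
  rewrite -addrA gtrDl expr2; lra.
- by exists p; split => // y Yy; have := pmin _ Yy; rewrite lerN2.
Qed.

End StochasticSaddleProblem.

(** * Uniform random index *)

Section UniformIndex.
Context {R : realType} {dO : measure_display} {Omega : measurableType dO}.
Context (P : probability Omega R) (zeta : {RV P >-> nat}) (T : nat).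
Hypothesis T_gt0 : (0 < T)%N.
Hypothesis zeta_unif : forall t, (1 <= t <= T)%N ->
  distribution P zeta [set t] = (T%:R^-1)%:E.

Let event n := zeta @^-1` [set n.+1].

Let mevent n : measurable (event n).
Proof. by rewrite -[X in measurable X]setTI; exact: measurable_funPT. Qed.

(** The [T] disjoint events have probability [1 / T] each and thus exhaust the total mass. *)
Lemma uniform_index_null : P (~` \big[setU/set0]_(n < T) event n) = 0%E.
Proof.
have mU : measurable (\big[setU/set0]_(n < T) event n).
  by apply: bigsetU_measurable => n _; exact: mevent.
rewrite probability_setC// measure_semi_additive_ord//; last first.
  apply/trivIsetP => i j _ _ ij; apply/seteqP; split => // w [].
  rewrite /event /= => zi zj; move: ij; rewrite -(inj_eq val_inj) /=.
  by move: zj; rewrite zi => -[->]; rewrite eqxx.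
rewrite (eq_bigr (fun=> (T%:R^-1)%:E)); last first.
  by move=> n _; apply: zeta_unif; rewrite /= ltn_ord.
rewrite sumEFin sumr_const card_ord -[_ *+ T]mulr_natr mulVf ?subee//.
by rewrite pnatr_eq0 -lt0n.
Qed.

(** Almost surely the integrand is the sum of its restrictions to the events [zeta = n + 1], of
    which exactly one occurs. *)
Lemma integral_random_index (H : nat -> Omega -> R) :
  (forall t, measurable_fun setT (H t)) -> (forall t w, 0 <= H t w) ->
  (\int[P]_w (H (zeta w) w)%:E =
   \sum_(n < T) \int[P]_w (H n.+1 w * \1_[set n.+1] (zeta w))%:E)%E.
Proof.
move=> mH H0.
have mHi n : measurable_fun setT (fun w => (H n.+1 w * \1_[set n.+1] (zeta w))%:E).
  apply/measurable_EFinP; apply: measurable_funM => //.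
  apply: (@measurableT_comp _ _ _ _ _ _ (\1_[set n.+1] : nat -> R) setT zeta) => //.
have Hi0 n w : (0 <= (H n.+1 w * \1_[set n.+1] (zeta w))%:E)%E.
  by rewrite lee_fin mulr_ge0.
rewrite -(@ge0_integral_sum _ _ _ P setT measurableT _
  (fun (n : 'I_T) w => (H n.+1 w * \1_[set n.+1] (zeta w))%:E)) //.
apply: ae_eq_integral => //.
- apply/measurable_EFinP => _ B mB; rewrite setTI.
  (* The index is random, so the preimage is cut along the countably many values of [zeta]. *)
  rewrite (_ : _ @^-1` _ = \bigcup_t (zeta @^-1` [set t] `&` H t @^-1` B)).
    apply: bigcupT_measurable => t; rewrite -(setTI (_ `&` _)) setIIr.
    by apply: measurableI; [exact: measurable_funPT|exact: mH].
  apply/seteqP; split => [w Bw|w [t _ [/= <-]]//]; by exists (zeta w).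
- by apply: emeasurable_sum => n; exact: mHi.
exists (~` \big[setU/set0]_(n < T) event n); split.
- by apply: measurableC; apply: bigsetU_measurable => n _; exact: mevent.
- exact: uniform_index_null.
- move=> w /= Hw; apply: contra_not Hw; rewrite -bigcup_seq => -[n _ /= zn] _.
  have {}zn : zeta w = n.+1 by [].
  rewrite (bigD1 n)//= big1 => [|i ne]; rewrite indicE zn.
    by rewrite mem_set// mulr1 adde0.
  rewrite memNset ?mulr0//= => -[ni]; move: ne.
  by rewrite -(inj_eq val_inj) /= ni eqxx.
Qed.

End UniformIndex.

(** * The Lyapunov sum and the step sizes *)

Section LyapunovSum.
Context {R : realType}.

(** Deterministic core. [h] are the step sizes; [a], [q], [dd], [e], [u] stand for the mean squares
    of the x-move, the y-move, the distance to the maximiser, and the errors of [v] and [w]. The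
    weight [p] makes [p * s / 4] twice the primal loss [2 * gamma * L ^+ 2]. [W] dominates both
    error coefficients and leaves a spare [gamma * e], which brings [e] into the conclusion. The
    bound of [32 * L * kap * gamma] by [s] limits the cost of the drifting maximiser. *)
Lemma lyapunov_sum (h a q dd e u : nat -> R) (L tau lambda gamma c delta b C0 : R)
    (T : nat) :
  let kap := L / tau in let s := lambda * tau in
  let p := 16 * gamma * L ^+ 2 / s in
  let W := gamma * (3 + 80 * kap ^+ 2) in
  0 < L -> 0 < tau -> 0 < lambda -> 0 < gamma -> 2 <= c -> 0 < b ->
  (forall n, 0 < h n) ->
  (forall n, (h n.+1)^-1 <= (h n)^-1 + h n.+1) ->
  (forall n, [/\ 0 <= a n, 0 <= q n, 0 <= dd n, 0 <= e n & 0 <= u n]) ->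
  32 * L * kap * gamma <= s ->
  256 * gamma ^+ 2 * (3 + 80 * kap ^+ 2) * L ^+ 2 <= c * b ->
  32 * (3 + 80 * kap ^+ 2) * s <= 12 * c * b ->
  e 0%N + u 0%N <= 2 * delta ^+ 2 / b ->
  (forall n, e n.+1 + u n.+1 <= (1 - c * h n.+1 ^+ 2) * (e n + u n) +
     (4 * (c * h n.+1 ^+ 2) ^+ 2 * delta ^+ 2 +
        16 * L ^+ 2 * (h n.+1 ^+ 2 * (a n + q n))) / b) ->
  \sum_(n < T) h n.+1 * ((1 / (2 * gamma) - 8 * p * kap ^+ 2 / s) * a n
     + (p * s / 4 - 2 * gamma * L ^+ 2) * dd n + 3 / 4 * p * q n) <=
    C0 + \sum_(n < T) h n.+1 * (2 * gamma * e n + 5 * p * lambda / tau * u n) ->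
  \sum_(n < T) h n.+1 * (a n / gamma ^+ 2 + e n + L ^+ 2 * dd n) <=
    4 / gamma * (C0 + 2 * W / c *
      (2 * delta ^+ 2 / b / h 0%N + 4 * c ^+ 2 * delta ^+ 2 / b *
         \sum_(n < T) h n.+1 ^+ 3)).
Proof.
move=> kap s p W L0 tau0 la0 ga0 c2 b0 h0 hinv pos Hg H1 H2 init storm pot.
have s0 : 0 < s by exact: mulr_gt0.
have c0 : 0 < c by lra.
have kap0 : 0 < kap by exact: divr_gt0.
have kapE : kap = L / tau by [].
pose S (f : nat -> R) := \sum_(n < T) h n.+1 * f n.
pose E n := e n + u n.
have SD f g : S (fun n => f n + g n) = S f + S g.
  by rewrite /S -big_split; apply: eq_bigr => n _; rewrite mulrDr.
have SZ r f : S (fun n => r * f n) = r * S f.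
  by rewrite /S mulr_sumr; apply: eq_bigr => n _; rewrite mulrCA.
have S0 f : (forall n, 0 <= f n) -> 0 <= S f.
  by move=> f0; apply: sumr_ge0 => n _; rewrite mulr_ge0// ltW.
(* Each recursion is divided by [h n.+1]. Replacing [(h n.+1)^-1] by [(h n)^-1 + h n.+1] costs one
   unit of [c], and the terms [E n / h n] telescope. *)
have SE : (c - 1) * S E <= 2 * delta ^+ 2 / b / h 0%N
    + 4 * c ^+ 2 * delta ^+ 2 / b * \sum_(n < T) h n.+1 ^+ 3
    + 16 * L ^+ 2 / b * (S a + S q).
  suff H N : (c - 1) * \sum_(n < N) h n.+1 * E n + E N / h N <=
      2 * delta ^+ 2 / b / h 0%N
      + 4 * c ^+ 2 * delta ^+ 2 / b * \sum_(n < N) h n.+1 ^+ 3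
      + 16 * L ^+ 2 / b * (\sum_(n < N) h n.+1 * a n + \sum_(n < N) h n.+1 * q n).
    apply: le_trans (H T); rewrite lerDl divr_ge0 ?(ltW (h0 _))//.
    by have [_ _ _ e0 u0] := pos T; exact: addr_ge0.
  elim: N => [|N IH].
    rewrite !big_ord0 !mulr0 add0r !addr0 mulr0 addr0.
    by rewrite ler_pM2r ?invr_gt0.
  rewrite !big_ord_recr /=.
  have hN := h0 N.+1; have hN0 := h0 N.
  have EN : 0 <= E N by have [_ _ _ e0 u0] := pos N; exact: addr_ge0.
  have P1 : E N.+1 / h N.+1 <= E N / h N.+1 - c * h N.+1 * E N
     + (4 * c ^+ 2 * delta ^+ 2 / b * h N.+1 ^+ 3
        + 16 * L ^+ 2 / b * (h N.+1 * (a N + q N))).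
    rewrite ler_pdivrMr//; apply: le_trans (storm N) _.
    rewrite -/(E N) le_eqVlt; apply/orP; left; apply/eqP.
    by field; rewrite !gt_eqF.
  have P2 : E N / h N.+1 <= E N / h N + h N.+1 * E N.
    by rewrite (mulrC (h _)) -mulrDr; apply: ler_wpM2l.
  move: IH; set T1 := \sum_(n < N) _; set T2 := \sum_(n < N) _.
  set T3 := \sum_(n < N) _; set T4 := \sum_(n < N) _ => IH.
  move: P1 P2 IH; move: (E N.+1 / h N.+1) (E N / h N.+1) (E N / h N) => z1 z2 z3.
  move: (4 * c ^+ 2 * delta ^+ 2 / b) (16 * L ^+ 2 / b) (2 * delta ^+ 2 / b / h 0%N).
  move=> k1 k2 k3; lra.
have ca : 3 / (8 * gamma) <= 1 / (2 * gamma) - 8 * p * kap ^+ 2 / s.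
  have sq : (32 * L * kap * gamma) ^+ 2 <= s ^+ 2.
    have g0 : 0 <= 32 * L * kap * gamma by apply/ltW; do 3![apply: mulr_gt0 => //].
    by rewrite ler_pXn2r// nnegrE ltW.
  have : 128 * gamma * L ^+ 2 * kap ^+ 2 / s ^+ 2 <= 1 / (8 * gamma).
    rewrite ler_pdivrMr ?exprn_gt0// [leRHS]mulrAC ler_pdivlMr ?mulr_gt0//; lra.
  have -> : 8 * p * kap ^+ 2 / s = 128 * gamma * L ^+ 2 * kap ^+ 2 / s ^+ 2.
    by rewrite /p; field; rewrite gt_eqF.
  have -> : 3 / (8 * gamma) = 1 / (2 * gamma) - 1 / (8 * gamma).
    by field; rewrite gt_eqF.
  lra.
have cd : p * s / 4 - 2 * gamma * L ^+ 2 = 2 * gamma * L ^+ 2.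
  by rewrite /p; field; rewrite gt_eqF.
have cb : 3 / 4 * p = 12 * gamma * L ^+ 2 / s.
  by rewrite /p; field; rewrite gt_eqF.
have cu : 5 * p * lambda / tau = 80 * gamma * kap ^+ 2.
  by rewrite /p /s /kap; field; rewrite !gt_eqF.
have W0 : 0 < W by rewrite mulr_gt0// ltr_wpDr// mulr_ge0// sqr_ge0.
(* The weight with which the moves reenter when [W * S E] is bounded through [SE]; the hypotheses
   [H1] and [H2] let the Lyapunov decrease pay for it. *)
pose w2 := 32 * W * L ^+ 2 / (c * b).
have H1' : w2 <= 1 / (8 * gamma).
  rewrite ler_pdivrMr ?mulr_gt0// [leRHS]mulrAC ler_pdivlMr ?mulr_gt0//.
  by rewrite /W; lra.
have H2' : w2 <= 12 * gamma * L ^+ 2 / s.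
  rewrite ler_pdivrMr ?mulr_gt0// [leRHS]mulrAC ler_pdivlMr//.
  have := @ler_wpM2l _ (gamma * L ^+ 2) _ _ _ H2.
  by rewrite mulr_ge0 ?sqr_ge0 ?(ltW ga0)// => /(_ isT); rewrite /W; lra.
have Sa0 : 0 <= S a by apply: S0 => n; have [] := pos n.
have Sq0 : 0 <= S q by apply: S0 => n; have [] := pos n.
have Se0 : 0 <= S e by apply: S0 => n; have [] := pos n.
have Su0 : 0 <= S u by apply: S0 => n; have [] := pos n.
have SEE : S E = S e + S u by exact: SD.
move: pot; rewrite cd cb cu.
set ca' := 1 / (2 * gamma) - _ in ca *.
set lhs := \sum_(n < T) _; set rhs := \sum_(n < T) _.
have -> : lhs = ca' * S a + 2 * gamma * L ^+ 2 * S dd + 12 * gamma * L ^+ 2 / s * S q.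
  rewrite /lhs -(SZ ca') -(SZ (2 * gamma * L ^+ 2)) -(SZ (12 * gamma * L ^+ 2 / s)).
  by rewrite -!SD.
have -> : rhs = 2 * gamma * S e + 80 * gamma * kap ^+ 2 * S u.
  by rewrite /rhs -(SZ (2 * gamma)) -(SZ (80 * gamma * kap ^+ 2)) -SD.
move=> pot.
have -> : \sum_(n < T) h n.+1 * (a n / gamma ^+ 2 + e n + L ^+ 2 * dd n) =
    (gamma ^+ 2)^-1 * S a + S e + L ^+ 2 * S dd.
  rewrite -(SZ (gamma ^+ 2)^-1) -(SZ (L ^+ 2)) -!SD.
  by apply: eq_bigr => n _; rewrite (mulrC (a n)).
set nz := 2 * delta ^+ 2 / b / h 0%N + _ in SE *.
(* The third summand is the spare part of [W]. *)
have Q1 : 2 * gamma * S e + 80 * gamma * kap ^+ 2 * S u + gamma * S e <= W * S E.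
  rewrite SEE /W; have : 0 <= gamma * kap ^+ 2 * S e.
    by apply: mulr_ge0 => //; apply: mulr_ge0; [exact: ltW|exact: sqr_ge0].
  have : 0 <= gamma * S u by rewrite mulr_ge0// ltW.
  lra.
have Q2 : W * S E <= 2 * W / c * nz + w2 * (S a + S q).
  have SE0 : 0 <= S E by rewrite SEE addr_ge0.
  have SE' : c / 2 * S E <= nz + 16 * L ^+ 2 / b * (S a + S q).
    by apply: le_trans SE; apply: ler_wpM2r => //; lra.
  have := @ler_wpM2l _ (2 * W / c) _ _ _ SE'.
  have WC0 : 0 <= 2 * W / c.
    by apply: divr_ge0; [apply: mulr_ge0 => //; exact: ltW|exact: ltW].
  rewrite WC0 => /(_ isT).
  have -> : 2 * W / c * (c / 2 * S E) = W * S E by field; rewrite gt_eqF.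
  rewrite mulrDr; suff -> : 2 * W / c * (16 * L ^+ 2 / b * (S a + S q)) =
    w2 * (S a + S q) by [].
  by rewrite /w2; field; rewrite !gt_eqF.
have Q3 : w2 * S a <= 1 / (8 * gamma) * S a by exact: ler_wpM2r.
have Q4 : w2 * S q <= 12 * gamma * L ^+ 2 / s * S q by exact: ler_wpM2r.
have Q5 : 3 / (8 * gamma) * S a <= ca' * S a by exact: ler_wpM2r.
have Q6 : 1 / (4 * gamma) * S a + 2 * gamma * L ^+ 2 * S dd + gamma * S e <=
    C0 + 2 * W / c * nz.
  have : 1 / (4 * gamma) * S a = 3 / (8 * gamma) * S a - 1 / (8 * gamma) * S a.
    by field; rewrite gt_eqF.
  lra.
(* The factor [4 / gamma] turns the surviving [1 / (4 * gamma)] into the [1 / gamma ^ 2] of the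
   squared stationarity measure. *)
apply: (@le_trans _ _ (4 / gamma * (1 / (4 * gamma) * S a + 2 * gamma * L ^+ 2 * S dd
   + gamma * S e))); last first.
  by rewrite ler_wpM2l// divr_ge0// ltW.
have -> : 4 / gamma * (1 / (4 * gamma) * S a + 2 * gamma * L ^+ 2 * S dd + gamma * S e) =
  (gamma ^+ 2)^-1 * S a + 8 * L ^+ 2 * S dd + 4 * S e by field; rewrite gt_eqF.
have : 0 <= L ^+ 2 * S dd.
  by rewrite mulr_ge0 ?sqr_ge0//; apply: S0 => n; have [] := pos n.
lra.
Qed.

End LyapunovSum.

(** * Step sizes decaying as an inverse cube root *)

Section StepSizes.
Context {R : realType} (m : R).
Hypothesis m_ge1 : 1 <= m.

Lemma powR_cube_root (x : R) : 0 <= x -> (x `^ 3^-1) ^+ 3 = x.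
Proof.
by move=> x0; rewrite -powR_mulrn ?powR_ge0// -powRrM mulVf// powRr1.
Qed.

Local Notation r t := ((m + t%:R) `^ 3^-1 : R).

Lemma root_ge1 (t : nat) : 1 <= r t.
Proof.
rewrite -(@ler_pXn2r _ 3) ?nnegrE ?powR_ge0// powR_cube_root.
  by rewrite expr1n; move: (m_ge1) => m1; have : 0 <= t%:R :> R by []; lra.
by move: (m_ge1) => m1; have : 0 <= t%:R :> R by []; lra.
Qed.

Lemma root_cube t : r t ^+ 3 = m + t%:R.
Proof.
apply: powR_cube_root.
by move: (m_ge1) => m1; have : 0 <= t%:R :> R by []; lra.
Qed.

Lemma eta_inv t : Defs.eta 1 m t = (r t)^-1.
Proof. by rewrite /Defs.eta div1r. Qed.

Lemma eta_pos t : 0 < Defs.eta 1 m t.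
Proof. by rewrite eta_inv invr_gt0; apply: lt_le_trans (root_ge1 t). Qed.

(** For the consecutive cube roots [a] and [b] one has [b ^+ 3 - a ^+ 3 = 1], so [b - a] is the
    inverse of [b ^+ 2 + a * b + a ^+ 2], which is at least [b]. *)
Lemma eta_step t :
  (Defs.eta 1 m t.+1)^-1 <= (Defs.eta 1 m t)^-1 + Defs.eta 1 m t.+1.
Proof.
rewrite !eta_inv !invrK; have a1 := root_ge1 t; have b1 := root_ge1 t.+1.
have E : r t.+1 ^+ 3 - r t ^+ 3 = 1.
  by rewrite !root_cube -natr1; ring.
move: (r t) (r t.+1) a1 b1 E => a b a1 b1 E.
rewrite -lerBlDl -[leRHS]mul1r ler_pdivlMr; last by lra.
have ab : 0 <= b - a.
  rewrite leNgt; apply/negP => ba.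
  have : b ^+ 3 < a ^+ 3 by rewrite ltr_pXn2r ?nnegrE//; lra.
  lra.
have -> : 1 = (b - a) * (b ^+ 2 + a * b + a ^+ 2) by rewrite -E; ring.
apply: ler_wpM2l => //.
have : b * 1 <= b * b by rewrite ler_wpM2l//; lra.
have : 0 <= a * b by rewrite mulr_ge0//; lra.
have := sqr_ge0 a; lra.
Qed.

(** The term of index [n] is [1 / (m + n + 1)], at most [1 / (n + 2)], which is at most
    [ln ((n + 2) / (n + 1))]; the logarithms telescope. *)
Lemma eta_cube_sum T : \sum_(n < T) Defs.eta 1 m n.+1 ^+ 3 <= ln (1 + T%:R) :> R.
Proof.
elim: T => [|T IH]; first by rewrite big_ord0 addr0 ln1.
rewrite big_ord_recr /=; apply: le_trans (lerD IH _) _; first exact: lexx.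
have T0 : 0 <= T%:R :> R by [].
have T1 : 0 < 1 + T%:R :> R by lra.
have T2 : 0 < 1 + T.+1%:R :> R by rewrite -natr1; lra.
suff H : Defs.eta 1 m T.+1 ^+ 3 <= - ln ((1 + T%:R) / (1 + T.+1%:R)).
  by move: H; rewrite ln_div ?posrE//; lra.
have -> : (1 + T%:R) / (1 + T.+1%:R) = 1 + - (1 + T.+1%:R)^-1 :> R.
  by rewrite -natr1; field; rewrite gt_eqF//; lra.
rewrite lerNr; apply: le_trans (le_ln1Dx _) _.
  rewrite ltrN2 invf_lt1//; rewrite -natr1; lra.
rewrite lerN2 eta_inv exprVn root_cube lef_pV2 ?posrE//.
  by rewrite lerD2r.
by move: (m_ge1) => m1; lra.
Qed.

End StepSizes.

(** Here [Q] plays kappa^3 / b. One needs T^(2/3) eps^2 to exceed a multiple of [Q] times log T,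
    where T occurs on both sides. A crude polynomial bound of T in [U = 1 + kap / eps] gives log T
    of order [Lam]; then T near [z ^+ 3], with [z] of order [Num.sqrt Q * Lam / eps], is enough. *)
Lemma horizon_choice {R : realType} (kap0 K mu : R) :
  0 < kap0 -> 0 <= K -> 1 <= mu ->
  exists C0 : R, 0 < C0 /\
  forall kap Q eps : R, kap0 <= kap -> kap0 ^+ 3 <= Q -> Q <= kap ^+ 3 ->
    0 < eps -> eps <= 1 ->
  let Lam := 1 + ln (1 + kap / eps) in
  exists T : nat, [/\ (1 <= T)%N,
    T%:R <= C0 * (Q * Num.sqrt Q) * eps ^- 3 * Lam ^+ 3 &
    3 * (K * Q * (1 + ln (1 + T%:R))) * (mu ^+ 3 + T%:R) `^ 3^-1 <= T%:R * eps ^+ 2].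
Proof.
move=> k00 K0 mu1.
(* The factor 3 of the goal times the [2 * mu] of [rT] below. *)
pose K' := 6 * K * mu.
have K'0 : 0 <= K' by rewrite !mulr_ge0//; lra.
have ki0 : 0 < kap0^-1 by rewrite invr_gt0.
(* The summands serve in turn to have [C] at least 1, to beat the logarithm constant in [main], and
   to ensure [1 <= z]. *)
pose C := 1 + K' * (16 + 3 * kap0^-1) + kap0 ^- 3.
have k3 : 0 <= kap0 ^- 3 by rewrite invr_ge0 exprn_ge0// ltW.
have k16 : 0 <= K' * (16 + 3 * kap0^-1) by rewrite mulr_ge0//; lra.
have C1 : 1 <= C by rewrite /C; lra.
have CK : K' * (16 + 3 * kap0^-1) <= C by rewrite /C; lra.
have Ck3 : kap0 ^- 3 <= C by rewrite /C; lra.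
have C0 : 0 < C := lt_le_trans ltr01 C1.
have C0' := ltW C0; have ki0' := ltW ki0.
clearbody C; exists (2 * C ^+ 3); split; first by rewrite mulr_gt0// exprn_gt0.
move=> kap Q eps kk Q0 Q1 e0 e1 Lam.
have kap_gt0 : 0 < kap by lra.
have ke0 : 0 < kap / eps by rewrite divr_gt0.
pose U := 1 + kap / eps.
have U1 : 1 <= U by rewrite /U; lra.
have lnU0 : 0 <= ln U by rewrite ln_ge0.
have Lam1 : 1 <= Lam by rewrite /Lam -/U; lra.
have Lam0 : 0 < Lam := lt_le_trans ltr01 Lam1.
have U0 : 0 < U := lt_le_trans ltr01 U1.
have LamU : Lam <= U by rewrite /Lam lerD2l; apply: le_ln1Dx; lra.
have Qp : 0 < Q by apply: lt_le_trans Q0; rewrite exprn_gt0.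
have sQ2 : Num.sqrt Q ^+ 2 = Q by rewrite sqr_sqrtr// ltW.
have sQ0 : 0 < Num.sqrt Q by rewrite sqrtr_gt0.
move: (Num.sqrt Q) sQ2 sQ0 => sQ sQ2 sQ0.
have ei1 : 1 <= eps^-1 by rewrite invf_ge1.
pose z := C * (sQ * Lam * eps^-1).
have LE1 : 1 <= Lam * eps^-1 by rewrite mulr_ege1.
have C2 : C <= C ^+ 2 by rewrite expr2 ler_peMr//; lra.
have z1 : 1 <= z.
  have : 1 <= C * sQ.
    rewrite -(@ler_pXn2r _ 2) ?nnegrE//; last by rewrite mulr_ge0// ltW.
    rewrite expr1n exprMn sQ2.
    have h1 : kap0 ^- 3 <= C ^+ 2 by exact: le_trans C2.
    have : kap0 ^- 3 * kap0 ^+ 3 <= C ^+ 2 * Q.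
      by apply: ler_pM => //; rewrite exprn_ge0// ltW.
    by rewrite mulVf// expf_neq0// gt_eqF.
  have -> : z = C * sQ * (Lam * eps^-1) by rewrite /z; ring.
  by move=> H; exact: mulr_ege1.
have z0 : 0 <= z := le_trans ler01 z1.
have z3 : 1 <= z ^+ 3 by rewrite exprn_ege1.
have /andP[T1 T2] : (Num.truncn (z ^+ 3))%:R <= z ^+ 3 < (Num.truncn (z ^+ 3)).+1%:R.
  by apply: truncn_itv; lra.
set T := (Num.truncn (z ^+ 3)).+1 in T2.
have T3 : T%:R <= z ^+ 3 + 1 by rewrite /T -natr1 lerD2r.
exists T; split => //.
  apply: (@le_trans _ _ (2 * z ^+ 3)); first by lra.
  rewrite /z le_eqVlt; apply/orP; left; apply/eqP.
  by rewrite -sQ2; field; rewrite gt_eqF.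
have Tp : 1 <= T%:R :> R by rewrite ler1n.
pose y := (T%:R : R) `^ 3^-1.
have y3 : y ^+ 3 = T%:R by rewrite powR_cube_root.
have y0 : 0 <= y by rewrite powR_ge0.
have yz : z <= y by rewrite -(@ler_pXn2r _ 3) ?nnegrE ?y3// ltW.
have mu0 : 0 <= mu := le_trans ler01 mu1.
have m3 : 1 <= mu ^+ 3 by rewrite exprn_ege1.
have m30 : 0 <= mu ^+ 3 := le_trans ler01 m3.
(* Both [mu ^+ 3] and [T] are at least 1, so their sum is at most twice their product. *)
have rT : (mu ^+ 3 + T%:R) `^ 3^-1 <= 2 * mu * y.
  rewrite -(@ler_pXn2r _ 3) ?nnegrE ?powR_ge0//; last by rewrite !mulr_ge0.
  rewrite powR_cube_root; last by rewrite addr_ge0.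
  have mT : mu ^+ 3 <= mu ^+ 3 * T%:R by rewrite ler_peMr.
  have Tm : T%:R <= mu ^+ 3 * T%:R by rewrite ler_peMl.
  by rewrite !exprMn y3; move: mT Tm m30; clear; move: (mu ^+ 3) (T%:R) => x u; lra.
have U4 : z <= C * kap0^-1 * U ^+ 4.
  have sU : sQ <= U ^+ 2.
    rewrite -(@ler_pXn2r _ 2) ?nnegrE ?(ltW sQ0)//; last by rewrite exprn_ge0// ltW.
    rewrite sQ2; apply: le_trans Q1 _; rewrite -exprM.
    have kU : kap <= U.
      have : kap * 1 <= kap * eps^-1 by rewrite ler_wpM2l// ltW.
      by rewrite /U; lra.
    apply: (@le_trans _ _ (U ^+ 3)); first by rewrite lerXn2r ?nnegrE// ltW.
    by apply: ler_weXn2l.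
  have eU : eps^-1 <= kap0^-1 * U.
    rewrite mulrC ler_pdivlMr// /U; apply: (@le_trans _ _ (eps^-1 * kap)).
      by rewrite ler_wpM2l// (le_trans ler01 ei1).
    by rewrite mulrC lerDr.
  have -> : C * kap0^-1 * U ^+ 4 = C * (U ^+ 2 * U * (kap0^-1 * U)) by ring.
  have ei0 : 0 <= eps^-1 := le_trans ler01 ei1.
  rewrite /z; apply: ler_wpM2l; first exact: ltW.
  apply: ler_pM => //; first by rewrite mulr_ge0// ltW.
  by apply: ler_pM => //; exact: ltW.
(* [1 + T] is below the cube of a constant times [U ^+ 4], so its logarithm is linear in [ln U],
   that is in [Lam]. *)
have lnT : 1 + ln (1 + T%:R) <= C * (16 + 3 * kap0^-1) * Lam.
  have Ck : 0 < C * kap0^-1 by rewrite mulr_gt0.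
  have U40 : 1 <= U ^+ 4 by rewrite exprn_ege1.
  have CU0 : 0 < (2 + C * kap0^-1) * U ^+ 4 by rewrite mulr_gt0 ?exprn_gt0// addr_gt0.
  have h1 : 1 + T%:R <= ((2 + C * kap0^-1) * U ^+ 4) ^+ 3.
    apply: (@le_trans _ _ ((2 + z) ^+ 3)).
      have zz : 0 <= z * z by rewrite mulr_ge0.
      have -> : (2 + z) ^+ 3 = 8 + 12 * z + 6 * (z * z) + z ^+ 3 by ring.
      move: zz z0 T3; clear; move: (z) (T%:R) => x u; lra.
    rewrite lerXn2r ?nnegrE ?addr_ge0 ?(ltW CU0)//.
    have : 2 * 1 <= 2 * U ^+ 4 by rewrite ler_wpM2l.
    lra.
  have h2 : ln (1 + T%:R) <= 3 * (ln (2 + C * kap0^-1) + 4 * ln U).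
    apply: (@le_trans _ _ (ln (((2 + C * kap0^-1) * U ^+ 4) ^+ 3))).
      by rewrite ler_ln ?posrE ?exprn_gt0// addr_gt0// ltr0n.
    rewrite lnXn// lnM ?posrE ?exprn_gt0 ?addr_gt0//.
    by rewrite lnXn// !mulr_natl.
  have h3 : ln (2 + C * kap0^-1) <= 1 + C * kap0^-1.
    have -> : 2 + C * kap0^-1 = 1 + (1 + C * kap0^-1) by ring.
    by apply: le_ln1Dx; lra.
  have h4 : ln U = Lam - 1 by rewrite /Lam -/U; ring.
  rewrite h4 in h2.
  have h5 : Lam <= C * Lam by rewrite ler_peMl// ltW.
  have h6 : C * kap0^-1 <= C * kap0^-1 * Lam by rewrite ler_peMr// ltW.
  lra.
have main : K' * Q * (1 + ln (1 + T%:R)) <= y ^+ 2 * eps ^+ 2.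
  apply: (@le_trans _ _ (K' * Q * (C * (16 + 3 * kap0^-1) * Lam))).
    by apply: ler_wpM2l => //; rewrite mulr_ge0// ltW.
  apply: (@le_trans _ _ (z ^+ 2 * eps ^+ 2)); last first.
    apply: ler_wpM2r; first exact: sqr_ge0.
    by rewrite ler_pXn2r ?nnegrE.
  have -> : z ^+ 2 * eps ^+ 2 = C ^+ 2 * Q * Lam ^+ 2.
    by rewrite /z -sQ2; field; rewrite gt_eqF.
  have h2 : 0 <= C * Q * Lam by rewrite !mulr_ge0// ?(ltW Qp)// ltW.
  have h3 : K' * (16 + 3 * kap0^-1) * (C * Q * Lam) <= C * Lam * (C * Q * Lam).
    apply: ler_wpM2r => //; apply: le_trans CK _.
    by rewrite ler_peMr.
  lra.
apply: (@le_trans _ _ (3 * (K * Q * (1 + ln (1 + T%:R))) * (2 * mu * y))).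
  have lnT0 : 0 <= ln (1 + T%:R) :> R by rewrite ln_ge0// lerDl.
  by apply: ler_wpM2l => //; rewrite !mulr_ge0 ?(ltW Qp) ?addr_ge0.
have := @ler_wpM2l _ y y0 _ _ main; rewrite -y3 /K'; lra.
Qed.

(** * Trajectories of Acc-MDA *)

Section SigmaOf.
Context {R : realType} {dO : measure_display} {Omega : measurableType dO}.
Context (P : probability Omega R) {d : measure_display} {T : measurableType d}.
Context (Z : {RV P >-> T}).

Lemma sigma_of_setT : sigma_of Z setT.
Proof. by exists setT => //; rewrite preimage_setT setTI. Qed.

Lemma sigma_of_setI : setI_closed (sigma_of Z).
Proof.
move=> _ _ [A mA <-] [B mB <-]; exists (A `&` B); first exact: measurableI.
by rewrite !setTI preimage_setI.
Qed.

Lemma sigma_of_measurable A : sigma_of Z A -> measurable A.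
Proof. by move=> [B mB <-]; exact: measurable_funPT. Qed.

End SigmaOf.

Section Trajectory.
Context {R : realType} {d1 d2 : nat}.
Context {d : measure_display} {Xi : measurableType d} (D : probability Xi R).
Context (f : 'rV[R]_d1 -> 'rV[R]_d2 -> Xi -> R).
Context (X : set 'rV[R]_d1) (Y : set 'rV[R]_d2) (Lf delta tau : R).
Hypothesis so : stochastic_objective D f X Y.
Hypothesis bv : bounded_variance D f X Y delta.
Hypothesis lip : lipschitz_gradient f X Y Lf.
Hypothesis sc : strongly_concave D f X Y tau.
Hypothesis tau_gt0 : 0 < tau.
Hypothesis Lf_gt0 : 0 < Lf.
Hypothesis clX : closed X.
Hypothesis cvX : convex_set X.
Hypothesis clY : closed Y.
Hypothesis cvY : convex_set Y.
Context (x1 : 'rV[R]_d1) (y1 : 'rV[R]_d2).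
Hypothesis Xx1 : X x1.
Hypothesis Yy1 : Y y1.
Context (b : nat) (k m c1 c2 lambda gamma : R).
Hypothesis b_gt0 : (0 < b)%N.
Hypothesis eta_gt0 : forall n, 0 < Defs.eta k m n.+1.
Hypothesis eta_le1 : forall n, Defs.eta k m n.+1 <= 1.
Hypothesis alpha_ge0 : forall n, 0 <= c1 * Defs.eta k m n.+1 ^+ 2.
Hypothesis alpha_le1 : forall n, c1 * Defs.eta k m n.+1 ^+ 2 <= 1.
Hypothesis beta_ge0 : forall n, 0 <= c2 * Defs.eta k m n.+1 ^+ 2.
Hypothesis beta_le1 : forall n, c2 * Defs.eta k m n.+1 ^+ 2 <= 1.
Hypothesis gamma_gt0 : 0 < gamma.
Hypothesis lambda_gt0 : 0 < lambda.
Hypothesis gammaLg : forall n, (Lf + Lf ^+ 2 / tau) * Defs.eta k m n.+1 * gamma <= 1 / 2.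
Hypothesis lambdaL : lambda * Lf <= 1 / 6.
Hypothesis lambdatau : lambda * tau <= 1 / 6.
Context {dO : measure_display} {Omega : measurableType dO}.
Context (P : probability Omega R) (xi : nat -> 'I_b -> {RV P >-> Xi}).
Context (zeta : {RV P >-> nat}) (T : nat).
Hypothesis smp : sampling D T xi zeta.

Local Notation fm := (fmean D f).
Local Notation ys := (ystar D f Y).

(** The index [None] carries the random output time, [Some (t, i)] the samples. *)
Definition sample_family (j : option (nat * 'I_b)) : set (set Omega) :=
  if j is Some (t, i) then sigma_of (xi t i) else sigma_of zeta.

Lemma sample_indep : mutually_independent P sample_family.
Proof. by have [_ _] := smp. Qed.

Lemma sample_law t i A : measurable A -> distribution P (xi t i) A = D A.
Proof. by have [+ _ _] := smp; exact. Qed.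

Lemma sample_family_setT j : sample_family j setT.
Proof. by case: j => [[t i]|]; exact: sigma_of_setT. Qed.

Lemma sample_family_setI j : setI_closed (sample_family j).
Proof. by case: j => [[t i]|]; exact: sigma_of_setI. Qed.

Lemma sample_family_measurable j A : sample_family j A -> measurable A.
Proof. by case: j => [[t i]|]; exact: sigma_of_measurable. Qed.

Fixpoint drawn (n : nat) : seq (option (nat * 'I_b)) :=
  if n is n'.+1 then [seq Some (n, i) | i <- enum 'I_b] ++ drawn n' else [::].

Lemma mem_drawn n j : j \in drawn n ->
  exists t i, j = Some (t, i) /\ (t <= n)%N.
Proof.
elim: n => [//|n IH] /=; rewrite mem_cat => /orP[/mapP[i _ ->]|/IH[t [i [-> tn]]]].
  by exists n.+1, i.
by exists t, i; split => //; exact: leq_trans tn _.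
Qed.

Lemma drawn_fresh n i : Some (n.+1, i) \notin drawn n.
Proof. by apply/negP => /mem_drawn[t [j [[<- _]]]]; rewrite ltnn. Qed.

Lemma drawn_zeta n : None \notin drawn n.
Proof. by apply/negP => /mem_drawn[t [j []]]. Qed.

Lemma drawn_uniq n : uniq (drawn n).
Proof.
elim: n => [//|n IH] /=; rewrite cat_uniq IH andbT map_inj_uniq ?enum_uniq/=; last first.
  by move=> i j [].
apply/hasPn => j jn; apply/mapP => -[i _ ji].
by have := drawn_fresh n i; rewrite -ji jn.
Qed.

Lemma drawn_last n i : Some (n.+1, i) \in drawn n.+1.
Proof. by rewrite /= mem_cat map_f// mem_enum. Qed.

Lemma drawn_sub n : {subset drawn n <= drawn n.+1}.
Proof. by move=> j jn; rewrite /= mem_cat jn orbT. Qed.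

(* times start at 1: index [n] below stands for time [n.+1] *)
Definition traj (n : nat) (w : Omega) :=
  accmda f X Y k m c1 c2 lambda gamma x1 y1 (fun t i => xi t i w) n.+1.

Local Notation tx n w := (st_x (traj n w)).
Local Notation ty n w := (st_y (traj n w)).
Local Notation tv n w := (st_v (traj n w)).
Local Notation tw n w := (st_w (traj n w)).
Local Notation eta_ n := (Defs.eta k m n.+1).

Definition xt n w := xtilde X gamma (traj n w).
Definition yt n w := ytilde Y lambda (traj n w).

Lemma trajS n w : traj n.+1 w =
  acc_step f X Y k m c1 c2 lambda gamma n.+1 (fun i => xi n.+2 i w) (traj n w).
Proof. by []. Qed.

Lemma tx0 w : tx 0 w = x1. Proof. by []. Qed.
Lemma ty0 w : ty 0 w = y1. Proof. by []. Qed.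

Lemma tv0 w : tv 0 w = batch_mean (sgradx f) (fun i => xi 1 i w) x1 y1.
Proof. by []. Qed.

Lemma tw0 w : tw 0 w = batch_mean (sgrady f) (fun i => xi 1 i w) x1 y1.
Proof. by []. Qed.

Lemma txS n w : tx n.+1 w = tx n w + eta_ n *: (xt n w - tx n w).
Proof.
by rewrite trajS /xt; case: (traj n w).
Qed.

Lemma tyS n w : ty n.+1 w = ty n w + eta_ n *: (yt n w - ty n w).
Proof.
by rewrite trajS /yt; case: (traj n w).
Qed.

Lemma tvS n w : tv n.+1 w =
  batch_mean (sgradx f) (fun i => xi n.+2 i w) (tx n.+1 w) (ty n.+1 w) +
  (1 - c1 * eta_ n ^+ 2) *:
    (tv n w - batch_mean (sgradx f) (fun i => xi n.+2 i w) (tx n w) (ty n w)).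
Proof.
by rewrite txS tyS trajS /xt /yt; case: (traj n w).
Qed.

Lemma twS n w : tw n.+1 w =
  batch_mean (sgrady f) (fun i => xi n.+2 i w) (tx n.+1 w) (ty n.+1 w) +
  (1 - c2 * eta_ n ^+ 2) *:
    (tw n w - batch_mean (sgrady f) (fun i => xi n.+2 i w) (tx n w) (ty n w)).
Proof.
by rewrite txS tyS trajS /xt /yt; case: (traj n w).
Qed.

#[local] Opaque traj.

Lemma xtP n w : X (xt n w).
Proof. by have [] := eprojP (tx n w - gamma *: tv n w) clX Xx1. Qed.

Lemma ytP n w : Y (yt n w).
Proof. by have [] := eprojP (ty n w + lambda *: tw n w) clY Yy1. Qed.

Lemma txP n w : X (tx n w).
Proof.
elim: n => [|n IH]; first by rewrite tx0.
rewrite txS.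
by apply: convex_segment => //; [exact: xtP|exact/ltW/eta_gt0].
Qed.

Lemma tyP n w : Y (ty n w).
Proof.
elim: n => [|n IH]; first by rewrite ty0.
rewrite tyS.
by apply: convex_segment => //; [exact: ytP|exact/ltW/eta_gt0].
Qed.

Local Notation past := (past sample_family).

Lemma measurable_batch_mean e (h : Xi -> 'rV[R]_d1 -> 'rV[R]_d2 -> 'rV[R]_e) n
    (p : Omega -> 'rV[R]_d1) (q : Omega -> 'rV[R]_d2) :
  (forall x y, X x -> Y y -> measurable_rV (fun z => h z x y)) ->
  (forall z x x' y y', X x -> X x' -> Y y -> Y y' ->
    enorm (h z x y - h z x' y') <= Lf * enorm2 (x - x') (y - y')) ->
  (forall w, X (p w)) -> (forall w, Y (q w)) ->
  measurable_rV (p : past (drawn n.+1) -> _) ->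
  measurable_rV (q : past (drawn n.+1) -> _) ->
  measurable_rV ((fun w => batch_mean h (fun i => xi n.+1 i w) (p w) (q w))
     : past (drawn n.+1) -> _).
Proof.
move=> mh hlip Xp Yq mp mq; apply: measurable_rVZ; apply: measurable_rV_sum => i.
apply: (@measurable_rV_lipschitz2 R _ (past (drawn n.+1)) d1 d2 e X Y Lf
  (fun w => h (xi n.+1 i w)) p q) => //; first exact: ltW.
  by move=> w *; exact: hlip.
move=> x y Xx Yy j.
apply: (@measurableT_comp _ _ _ _ _ _ (fun z => h z x y 0 j) setT
  (xi n.+1 i : past (drawn n.+1) -> Xi)); first exact: mh.
apply: (measurable_past_RV sample_family_setT (drawn_last n i)).
exact: subset_refl.
Qed.

Lemma measurable_eproj e n (A : set 'rV[R]_e) (p : Omega -> 'rV[R]_e) :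
  closed A -> convex_set A -> A !=set0 ->
  measurable_rV (p : past (drawn n) -> _) ->
  measurable_rV ((fun w => eproj A (p w)) : past (drawn n) -> _).
Proof.
move=> clA cA A0 mp.
apply: (@measurable_rV_lipschitz R _ (past (drawn n)) e e setT 1 (eproj A) p) => //.
by move=> a a' _ _; rewrite mul1r; exact: eproj_nonexpansive.
Qed.

Lemma past_le_rV e n (p : Omega -> 'rV[R]_e) :
  measurable_rV (p : past (drawn n) -> _) ->
  measurable_rV (p : past (drawn n.+1) -> _).
Proof.
move=> mp i; exact: (@past_le _ _ _ _ sample_family_setT _ _ _ _
  (fun w => p w 0 i) (@drawn_sub n) (mp i)).
Qed.

Lemma measurable_xt_of n :
  measurable_rV ((fun w => tx n w) : past (drawn n.+1) -> _) ->
  measurable_rV ((fun w => tv n w) : past (drawn n.+1) -> _) ->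
  measurable_rV (xt n : past (drawn n.+1) -> _).
Proof.
move=> mx mv; apply: (measurable_eproj (p := fun w => tx n w - gamma *: tv n w)) => //.
  by exists x1.
by apply: measurable_rVB => //; exact: measurable_rVZ.
Qed.

Lemma measurable_yt_of n :
  measurable_rV ((fun w => ty n w) : past (drawn n.+1) -> _) ->
  measurable_rV ((fun w => tw n w) : past (drawn n.+1) -> _) ->
  measurable_rV (yt n : past (drawn n.+1) -> _).
Proof.
move=> my mw; apply: (measurable_eproj (p := fun w => ty n w + lambda *: tw n w)) => //.
  by exists y1.
by apply: measurable_rVD => //; exact: measurable_rVZ.
Qed.

Let msgx x y : X x -> Y y -> measurable_rV (fun z => sgradx f z x y).
Proof. by move=> Xx Yy; exact: has_mean_rV_measurable (sgradx_mean so Xx Yy). Qed.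

Let msgy x y : X x -> Y y -> measurable_rV (fun z => sgrady f z x y).
Proof. by move=> Xx Yy; exact: has_mean_rV_measurable (sgrady_mean so Xx Yy). Qed.

(** Adaptedness: the state of time [n.+1] is a function of the batches up to that time, which makes
    the batch of time [n.+2] fresh. *)
Lemma traj_measurable n :
  [/\ measurable_rV ((fun w => tx n w) : past (drawn n.+1) -> _),
      measurable_rV ((fun w => ty n w) : past (drawn n.+1) -> _),
      measurable_rV ((fun w => tv n w) : past (drawn n.+1) -> _) &
      measurable_rV ((fun w => tw n w) : past (drawn n.+1) -> _)].
Proof.
elim: n => [|n [mx my mv mw]].
  have mx := @measurable_rV_cst R _ (past (drawn 1)) _ x1.
  have my := @measurable_rV_cst R _ (past (drawn 1)) _ y1.
  split.
  - by under eq_fun do rewrite tx0.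
  - by under eq_fun do rewrite ty0.
  - under eq_fun do rewrite tv0.
    exact: (@measurable_batch_mean _ (sgradx f) 0 (fun=> x1) (fun=> y1) msgx
      (sgradx_lip lip)).
  - under eq_fun do rewrite tw0.
    exact: (@measurable_batch_mean _ (sgrady f) 0 (fun=> x1) (fun=> y1) msgy
      (sgrady_lip lip)).
have mxt := measurable_xt_of mx mv; have myt := measurable_yt_of my mw.
have Ex : (fun w => tx n.+1 w) = (fun w => tx n w + eta_ n *: (xt n w - tx n w)).
  by apply/funext => w; rewrite txS.
have Ey : (fun w => ty n.+1 w) = (fun w => ty n w + eta_ n *: (yt n w - ty n w)).
  by apply/funext => w; rewrite tyS.
have mx' := past_le_rV
  (measurable_rVD mx (measurable_rVZ (eta_ n) (measurable_rVB mxt mx))).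
have my' := past_le_rV
  (measurable_rVD my (measurable_rVZ (eta_ n) (measurable_rVB myt my))).
rewrite -Ex in mx'; rewrite -Ey in my'.
have {}mx := past_le_rV mx; have {}my := past_le_rV my.
have {}mv := past_le_rV mv; have {}mw := past_le_rV mw.
split => //.
  under eq_fun do rewrite tvS; apply: measurable_rVD.
    apply: (@measurable_batch_mean _ _ n.+1 (fun w => tx n.+1 w) (fun w => ty n.+1 w)) => //.
    - exact: (sgradx_lip lip).
    - by move=> w; exact: txP.
    - by move=> w; exact: tyP.
  apply: measurable_rVZ; apply: measurable_rVB => //.
  apply: (@measurable_batch_mean _ _ n.+1 (fun w => tx n w) (fun w => ty n w)) => //.
  - exact: (sgradx_lip lip).
  - by move=> w; exact: txP.
  - by move=> w; exact: tyP.
under eq_fun do rewrite twS; apply: measurable_rVD.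
  apply: (@measurable_batch_mean _ _ n.+1 (fun w => tx n.+1 w) (fun w => ty n.+1 w)) => //.
  - exact: (sgrady_lip lip).
  - by move=> w; exact: txP.
  - by move=> w; exact: tyP.
apply: measurable_rVZ; apply: measurable_rVB => //.
apply: (@measurable_batch_mean _ _ n.+1 (fun w => tx n w) (fun w => ty n w)) => //.
- exact: (sgrady_lip lip).
- by move=> w; exact: txP.
- by move=> w; exact: tyP.
Qed.

Local Notation L := Lf.
Local Notation kap := (L / tau).

Let dgm x y : X x -> Y y -> differentiable2 fm x y := @mean_differentiable _ _ _ _ _ _ _ _ _ so x y.
Let ysp x : X x -> Y (ys x) /\ forall y, Y y -> fm x y <= fm x (ys x) :=
  @ystarP _ _ _ _ _ _ _ _ _ _ so sc tau_gt0 _ _ clY Yy1.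

(** The five squares [qA], [qB], [qD], [qE], [qU] have means that instantiate [a], [q], [dd], [e],
    [u] of [lyapunov_sum]. *)
Definition qA n w := dot (xt n w - tx n w) (xt n w - tx n w).
Definition qB n w := dot (yt n w - ty n w) (yt n w - ty n w).
Definition qD n w := dot (ty n w - ys (tx n w)) (ty n w - ys (tx n w)).
Definition qE n w := let c := gradx fm (tx n w) (ty n w) - tv n w in dot c c.
Definition qU n w := let c := grady fm (tx n w) (ty n w) - tw n w in dot c c.

Lemma measurable_qA n : measurable_fun setT (qA n : past (drawn n.+1) -> R).
Proof.
have [mx my mv mw] := traj_measurable n.
by apply: measurable_dot; apply: measurable_rVB => //; exact: measurable_xt_of.
Qed.

Lemma measurable_qB n : measurable_fun setT (qB n : past (drawn n.+1) -> R).
Proof.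
have [mx my mv mw] := traj_measurable n.
by apply: measurable_dot; apply: measurable_rVB => //; exact: measurable_yt_of.
Qed.

Lemma measurable_qD n : measurable_fun setT (qD n : past (drawn n.+1) -> R).
Proof.
have [mx my mv mw] := traj_measurable n.
have mys : measurable_rV ((fun w => ys (tx n w)) : past (drawn n.+1) -> _).
  apply: (@measurable_rV_lipschitz R _ (past (drawn n.+1)) d1 d2 X kap ys
    (fun w => tx n w)) => //.
  - by rewrite divr_ge0// ltW.
  - move=> a a' Xa Xa'.
    exact: (ystar_lip Lf_gt0 tau_gt0 cvY dgm (mean_gradient_lip so lip) sc ysp).
  - by move=> w; exact: txP.
by apply: measurable_dot; exact: measurable_rVB.
Qed.

Lemma measurable_qE n : measurable_fun setT (qE n : past (drawn n.+1) -> R).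
Proof.
have [mx my mv mw] := traj_measurable n.
have mg : measurable_rV ((fun w => gradx fm (tx n w) (ty n w)) : past (drawn n.+1) -> _).
  apply: (@measurable_rV_lipschitz2 R _ (past (drawn n.+1)) d1 d2 d1 X Y L
    (fun _ => gradx fm) (fun w => tx n w) (fun w => ty n w)) => //; first exact: ltW.
  - by move=> _ x x' y y'; exact: (gradx_lip (mean_gradient_lip so lip)).
  - by move=> *; exact: measurable_rV_cst.
  - by move=> w; exact: txP.
  - by move=> w; exact: tyP.
by apply: measurable_dot; exact: measurable_rVB.
Qed.

Lemma measurable_qU n : measurable_fun setT (qU n : past (drawn n.+1) -> R).
Proof.
have [mx my mv mw] := traj_measurable n.
have mg : measurable_rV ((fun w => grady fm (tx n w) (ty n w)) : past (drawn n.+1) -> _).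
  apply: (@measurable_rV_lipschitz2 R _ (past (drawn n.+1)) d1 d2 d2 X Y L
    (fun _ => grady fm) (fun w => tx n w) (fun w => ty n w)) => //; first exact: ltW.
  - by move=> _ x x' y y'; exact: (grady_lip (mean_gradient_lip so lip)).
  - by move=> *; exact: measurable_rV_cst.
  - by move=> w; exact: txP.
  - by move=> w; exact: tyP.
by apply: measurable_dot; exact: measurable_rVB.
Qed.

Lemma path_primal n w :
  fm (tx n.+1 w) (ys (tx n.+1 w)) + eta_ n / (2 * gamma) * qA n w <=
  fm (tx n w) (ys (tx n w)) + 2 * eta_ n * gamma * L ^+ 2 * qD n w
    + 2 * eta_ n * gamma * qE n w.
Proof.
rewrite txS.
have [_ H] := primal_step Lf_gt0 tau_gt0 clX cvX cvY dgm (mean_gradient_lip so lip)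
  sc ysp gamma_gt0 (ltW (eta_gt0 n)) (eta_le1 n) (gammaLg n) (tv n w) (txP n w) (tyP n w).
exact: H.
Qed.

Lemma path_dual n w :
  qD n.+1 w <= (1 - eta_ n * lambda * tau / 4) * qD n w - 3 / 4 * eta_ n * qB n w
    + 5 * eta_ n * lambda / tau * qU n w
    + 8 * kap ^+ 2 * eta_ n / (lambda * tau) * qA n w.
Proof.
rewrite /qD txS tyS.
have [_ H] := dual_step Lf_gt0 tau_gt0 cvX clY cvY dgm (mean_gradient_lip so lip)
  sc ysp lambda_gt0 (ltW (eta_gt0 n)) (eta_le1 n) lambdaL lambdatau (tw n w)
  (txP n w) (xtP n w) (tyP n w).
exact: H.
Qed.

(** The primal inequality plus [p] times the dual one, telescoped along a fixed trajectory; [Fst]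
    bounds the final value of the potential from below. *)
Lemma potential_sum p Fst N w : 0 <= p ->
  (forall x, X x -> Fst <= fm x (ys x)) ->
  \sum_(n < N) eta_ n * ((1 / (2 * gamma) - 8 * p * kap ^+ 2 / (lambda * tau)) * qA n w
     + (p * (lambda * tau) / 4 - 2 * gamma * L ^+ 2) * qD n w + 3 / 4 * p * qB n w) <=
  fm x1 (ys x1) - Fst + p * dot (y1 - ys x1) (y1 - ys x1)
  + \sum_(n < N) eta_ n * (2 * gamma * qE n w + 5 * p * lambda / tau * qU n w).
Proof.
move: (gamma_gt0) (lambda_gt0) (tau_gt0) => ga0 la0 ta0 p0 lbF.
have -> : 5 * p * lambda / tau = p * (5 * (lambda / tau)) by field; rewrite gt_eqF.
have -> : 8 * p * kap ^+ 2 / (lambda * tau) = p * (8 * kap ^+ 2 / (lambda * tau)).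
  by field; rewrite !gt_eqF.
set S1 := \sum_(n < N) _; set S2 := \sum_(n < N) _.
suff : S1 + fm (tx N w) (ys (tx N w)) + p * qD N w <=
   fm x1 (ys x1) + p * dot (y1 - ys x1) (y1 - ys x1) + S2.
  have := lbF _ (txP N w); have := mulr_ge0 p0 (dot_ge0 (ty N w - ys (tx N w))).
  rewrite -/(qD N w); lra.
rewrite /S1 /S2; elim: N {S1 S2} => [|N IH].
  by rewrite !big_ord0 add0r addr0 /qD tx0 ty0.
rewrite !big_ord_recr /=; move: IH.
set T1 := \sum_(n < N) _; set T2 := \sum_(n < N) _; move: T1 T2 => T1 T2.
have H1 := path_primal N w.
have H2 := ler_wpM2l p0 (path_dual N w).
have E1 : eta_ N / (2 * gamma) = eta_ N * (1 / (2 * gamma)) by rewrite div1r.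
rewrite E1 in H1.
have E2 : 5 * eta_ N * lambda / tau = eta_ N * (5 * (lambda / tau)).
  by field; rewrite gt_eqF.
have E3 : 8 * kap ^+ 2 * eta_ N / (lambda * tau) = eta_ N * (8 * kap ^+ 2 / (lambda * tau)).
  by field; rewrite !gt_eqF.
rewrite E2 E3 in H2.
move: (1 / (2 * gamma)) (8 * kap ^+ 2 / (lambda * tau)) (lambda / tau) (eta_ N)
  (qA N w) (qB N w) (qD N w) (qE N w) (qU N w) (qD N.+1 w) H1 H2
  => g1 g2 g3 et A B Dq E U D' H1 H2.
move=> IH.
lra.
Qed.

(** [storm_step] with the batch of time [n.+2] and the past [drawn n.+1], on which the states before
    and after the move are measurable. *)
Lemma storm_x n :
  (\int[P]_w (qE n.+1 w)%:E <=
   \int[P]_w ((1 - c1 * eta_ n ^+ 2) * qE n w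
     + (2 * (c1 * eta_ n ^+ 2) ^+ 2 * delta ^+ 2 + 8 * L ^+ 2 *
        (eta_ n ^+ 2 * (qA n w + qB n w))) / b%:R)%:E)%E.
Proof.
have [mx my mv mw] := traj_measurable n.
have mxt := measurable_xt_of mx mv; have myt := measurable_yt_of my mw.
pose x' w := tx n w + eta_ n *: (xt n w - tx n w).
pose y' w := ty n w + eta_ n *: (yt n w - ty n w).
have Xx' w : X (x' w) by rewrite /x' -txS; exact: txP.
have Yy' w : Y (y' w) by rewrite /y' -tyS; exact: tyP.
have H := @storm_step _ _ _ _ _ _ D X Y L delta (sgradx f) (gradx fm) (ltW Lf_gt0)
  (sgradx_mean so) (sgradx_variance bv) (sgradx_lip lip)
  (gradx_lip (mean_gradient_lip so lip)) _ _ P _ sample_family sample_indep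
  sample_family_setT sample_family_setI sample_family_measurable b (xi n.+2)
  (fun i => Some (n.+2, i)) b_gt0 (sample_law n.+2) (fun i => @subset_refl _ _)
  _ (drawn n.+1) (drawn_uniq _) (drawn_fresh _) (c1 * eta_ n ^+ 2)
  (fun w => tx n w) x' (fun w => ty n w) y' (fun w => tv n w)
  (alpha_ge0 n) (alpha_le1 n) (txP n) Xx' (tyP n) Yy' mx
  (measurable_rVD mx (measurable_rVZ (eta_ n) (measurable_rVB mxt mx)))
  my (measurable_rVD my (measurable_rVZ (eta_ n) (measurable_rVB myt my))) mv.
have {}H := H (ltac:(by move=> i j [])).
apply: le_trans (le_trans H _).
  rewrite le_eqVlt; apply/orP; left; apply/eqP; apply: eq_integral => w _.
  by rewrite /qE tvS txS tyS.
rewrite le_eqVlt; apply/orP; left; apply/eqP; apply: eq_integral => w _.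
congr (_ + (_ + _ * _) / _)%:E.
rewrite /x' /y' ![_ + _ *: _]addrC !addrK !dotZl !dotZr /qA /qB.
by ring.
Qed.

Lemma storm_y n :
  (\int[P]_w (qU n.+1 w)%:E <=
   \int[P]_w ((1 - c2 * eta_ n ^+ 2) * qU n w
     + (2 * (c2 * eta_ n ^+ 2) ^+ 2 * delta ^+ 2 + 8 * L ^+ 2 *
        (eta_ n ^+ 2 * (qA n w + qB n w))) / b%:R)%:E)%E.
Proof.
have [mx my mv mw] := traj_measurable n.
have mxt := measurable_xt_of mx mv; have myt := measurable_yt_of my mw.
pose x' w := tx n w + eta_ n *: (xt n w - tx n w).
pose y' w := ty n w + eta_ n *: (yt n w - ty n w).
have Xx' w : X (x' w) by rewrite /x' -txS; exact: txP.
have Yy' w : Y (y' w) by rewrite /y' -tyS; exact: tyP.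
have H := @storm_step _ _ _ _ _ _ D X Y L delta (sgrady f) (grady fm) (ltW Lf_gt0)
  (sgrady_mean so) (sgrady_variance bv) (sgrady_lip lip)
  (grady_lip (mean_gradient_lip so lip)) _ _ P _ sample_family sample_indep
  sample_family_setT sample_family_setI sample_family_measurable b (xi n.+2)
  (fun i => Some (n.+2, i)) b_gt0 (sample_law n.+2) (fun i => @subset_refl _ _)
  _ (drawn n.+1) (drawn_uniq _) (drawn_fresh _) (c2 * eta_ n ^+ 2)
  (fun w => tx n w) x' (fun w => ty n w) y' (fun w => tw n w)
  (beta_ge0 n) (beta_le1 n) (txP n) Xx' (tyP n) Yy' mx
  (measurable_rVD mx (measurable_rVZ (eta_ n) (measurable_rVB mxt mx)))
  my (measurable_rVD my (measurable_rVZ (eta_ n) (measurable_rVB myt my))) mw.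
have {}H := H (ltac:(by move=> i j [])).
apply: le_trans (le_trans H _).
  rewrite le_eqVlt; apply/orP; left; apply/eqP; apply: eq_integral => w _.
  by rewrite /qU twS txS tyS.
rewrite le_eqVlt; apply/orP; left; apply/eqP; apply: eq_integral => w _.
congr (_ + (_ + _ * _) / _)%:E.
rewrite /x' /y' ![_ + _ *: _]addrC !addrK !dotZl !dotZr /qA /qB.
by ring.
Qed.

Local Notation mean := (mean P).

Lemma initial_means :
  [/\ has_mean P (qE 0) (mean (qE 0)), mean (qE 0) <= delta ^+ 2 / b%:R,
      has_mean P (qU 0) (mean (qU 0)) & mean (qU 0) <= delta ^+ 2 / b%:R].
Proof.
have inj : injective (fun i : 'I_b => Some (1%N, i)) by move=> i j [].
have fresh (i : 'I_b) : Some (1%N, i) \notin [::] by [].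
have HE := @init_moment _ _ _ _ _ _ D X Y delta (sgradx f) (gradx fm)
  (sgradx_mean so) (sgradx_variance bv) _ _ P _ sample_family sample_indep
  sample_family_setT sample_family_setI sample_family_measurable b (xi 1)
  (fun i => Some (1%N, i)) b_gt0 (sample_law 1) (fun i => @subset_refl _ _)
  inj [::] isT fresh _ _ Xx1 Yy1.
have HU := @init_moment _ _ _ _ _ _ D X Y delta (sgrady f) (grady fm)
  (sgrady_mean so) (sgrady_variance bv) _ _ P _ sample_family sample_indep
  sample_family_setT sample_family_setI sample_family_measurable b (xi 1)
  (fun i => Some (1%N, i)) b_gt0 (sample_law 1) (fun i => @subset_refl _ _)
  inj [::] isT fresh _ _ Xx1 Yy1.
have mE := measurable_past_ambient sample_family_measurable (@measurable_qE 0).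
have mU := measurable_past_ambient sample_family_measurable (@measurable_qU 0).
have {}HE : (\int[P]_w (qE 0 w)%:E <= (delta ^+ 2 / b%:R)%:E)%E.
  apply: le_trans HE; rewrite le_eqVlt; apply/orP; left; apply/eqP.
  by apply: eq_integral => w _; rewrite /qE tv0 tx0 ty0.
have {}HU : (\int[P]_w (qU 0 w)%:E <= (delta ^+ 2 / b%:R)%:E)%E.
  apply: le_trans HU; rewrite le_eqVlt; apply/orP; left; apply/eqP.
  by apply: eq_integral => w _; rewrite /qU tw0 tx0 ty0.
have [e ele he] := has_mean_bounded mE (fun w => dot_ge0 _) HE.
have [u ule hu] := has_mean_bounded mU (fun w => dot_ge0 _) HU.
by rewrite (mean_eq he) (mean_eq hu); split.
Qed.

Lemma storm_means n :
  has_mean P (qE n) (mean (qE n)) -> has_mean P (qU n) (mean (qU n)) ->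
  has_mean P (qA n) (mean (qA n)) -> has_mean P (qB n) (mean (qB n)) ->
  let noise a := (2 * (a * eta_ n ^+ 2) ^+ 2 * delta ^+ 2 + 8 * L ^+ 2 *
        (eta_ n ^+ 2 * (mean (qA n) + mean (qB n)))) / b%:R in
  [/\ has_mean P (qE n.+1) (mean (qE n.+1)), has_mean P (qU n.+1) (mean (qU n.+1)),
      mean (qE n.+1) <= (1 - c1 * eta_ n ^+ 2) * mean (qE n) + noise c1 &
      mean (qU n.+1) <= (1 - c2 * eta_ n ^+ 2) * mean (qU n) + noise c2].
Proof.
move=> hE hU hA hB noise.
have mE := measurable_past_ambient sample_family_measurable (@measurable_qE n.+1).
have mU := measurable_past_ambient sample_family_measurable (@measurable_qU n.+1).
have rhs (q : Omega -> R) c r : has_mean P q r -> has_mean P (fun w =>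
    (1 - c * eta_ n ^+ 2) * q w + (2 * (c * eta_ n ^+ 2) ^+ 2 * delta ^+ 2 +
       8 * L ^+ 2 * (eta_ n ^+ 2 * (qA n w + qB n w))) / b%:R)
    ((1 - c * eta_ n ^+ 2) * r + noise c).
  move=> hq; apply: has_meanD; first exact: has_meanZ.
  apply: has_meanZr; apply: has_meanD; first exact: has_mean_cst.
  by apply: has_meanZ; apply: has_meanZ; exact: has_meanD.
have [_ EE] := rhs _ c1 _ hE; have [_ EU] := rhs _ c2 _ hU.
have HE := storm_x n; rewrite EE in HE; have HU := storm_y n; rewrite EU in HU.
have [e ele he] := has_mean_bounded mE (fun w => dot_ge0 _) HE.
have [u ule hu] := has_mean_bounded mU (fun w => dot_ge0 _) HU.
by rewrite (mean_eq he) (mean_eq hu); split.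
Qed.

Section Means.
Context (p Fst : R).
Let ca := 1 / (2 * gamma) - 8 * p * kap ^+ 2 / (lambda * tau).
Let cd := p * (lambda * tau) / 4 - 2 * gamma * L ^+ 2.
Let cb := 3 / 4 * p.
Let cu := 5 * p * lambda / tau.
Hypothesis p_gt0 : 0 < p.
Hypothesis ca_gt0 : 0 < ca.
Hypothesis cd_gt0 : 0 < cd.
Hypothesis lbF : forall x, X x -> Fst <= fm x (ys x).

Let C0 := fm x1 (ys x1) - Fst + p * dot (y1 - ys x1) (y1 - ys x1).

Let has_mean_rhs N :
  (forall n, (n < N)%N -> has_mean P (qE n) (mean (qE n)) /\
                          has_mean P (qU n) (mean (qU n))) ->
  has_mean P (fun w => C0 + \sum_(n < N) eta_ n * (2 * gamma * qE n w + cu * qU n w))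
    (C0 + \sum_(n < N) eta_ n * (2 * gamma * mean (qE n) + cu * mean (qU n))).
Proof.
move=> H; apply: has_meanD; first exact: has_mean_cst.
apply: (@has_mean_sum _ _ _ P 'I_N) => n.
have [hE hU] := H n (ltn_ord n).
by apply: has_meanZ; apply: has_meanD; exact: has_meanZ.
Qed.

(** Pathwise, [potential_sum] dominates each move and the distance at index [n] by a combination of
    errors up to [n]; positive coefficients turn this into integrability. *)
Let means_step n :
  (forall j, (j < n.+1)%N -> has_mean P (qE j) (mean (qE j)) /\
                          has_mean P (qU j) (mean (qU j))) ->
  [/\ has_mean P (qA n) (mean (qA n)), has_mean P (qB n) (mean (qB n)) &
      has_mean P (qD n) (mean (qD n))].
Proof.
move=> /has_mean_rhs; set rhs := (fun w => _) => hr.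
have et0 := eta_gt0 n.
have cb0 : 0 < cb by rewrite /cb; move: (p_gt0) => p0; lra.
have bound w : eta_ n * (ca * qA n w + cd * qD n w + cb * qB n w) <= rhs w.
  apply: le_trans (potential_sum n.+1 w (ltW p_gt0) lbF).
  rewrite big_ord_recr /= lerDr; apply: sumr_ge0 => j _.
  apply: mulr_ge0; first exact/ltW/eta_gt0.
  by rewrite !addr_ge0// mulr_ge0 ?dot_ge0// ltW.
have dom (q : Omega -> R) c : 0 < c -> measurable_fun setT q ->
    (forall w, 0 <= q w) ->
    (forall w, c * q w <= ca * qA n w + cd * qD n w + cb * qB n w) ->
    has_mean P q (mean q).
  move=> c0 mq q0 qle.
  have [] := has_mean_dominated mq q0 (has_meanZ (eta_ n * c)^-1 hr).
    move=> w; change (q w <= (eta_ n * c)^-1 * rhs w).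
    rewrite ler_pdivlMl; last exact: mulr_gt0.
    by rewrite -mulrA; apply: le_trans (bound w); rewrite ler_pM2l.
  by move=> r _; exact: has_mean_mean.
have A0 w := mulr_ge0 (ltW ca_gt0) (dot_ge0 (xt n w - tx n w)).
have B0 w := mulr_ge0 (ltW cb0) (dot_ge0 (yt n w - ty n w)).
have D0 w := mulr_ge0 (ltW cd_gt0) (dot_ge0 (ty n w - ys (tx n w))).
split.
- apply: (dom _ ca) => // [|w|w]; last by have := B0 w; have := D0 w; rewrite /qB /qD; lra.
    exact: (measurable_past_ambient sample_family_measurable (@measurable_qA n)).
  exact: dot_ge0.
- apply: (dom _ cb) => // [|w|w]; last by have := A0 w; have := D0 w; rewrite /qA /qD; lra.
    exact: (measurable_past_ambient sample_family_measurable (@measurable_qB n)).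
  exact: dot_ge0.
- apply: (dom _ cd) => // [|w|w]; last by have := B0 w; have := A0 w; rewrite /qB /qA; lra.
    exact: (measurable_past_ambient sample_family_measurable (@measurable_qD n)).
  exact: dot_ge0.
Qed.

(** Induction that alternates [means_step], from errors to moves, with [storm_means], from moves to
    the next errors. *)
Lemma traj_means n :
  [/\ has_mean P (qE n) (mean (qE n)), has_mean P (qU n) (mean (qU n)),
      has_mean P (qA n) (mean (qA n)), has_mean P (qB n) (mean (qB n)) &
      has_mean P (qD n) (mean (qD n))].
Proof.
suff H : forall j, (j < n.+1)%N ->
    has_mean P (qE j) (mean (qE j)) /\ has_mean P (qU j) (mean (qU j)).
  by have [hE hU] := H n (ltnSn n); have [hA hB hD] := means_step H; split.
elim: n => [|n IH] j.
  by rewrite ltnS leqn0 => /eqP ->; have [] := initial_means.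
rewrite ltnS leq_eqVlt => /orP[/eqP ->|]; last exact: IH.
have [hE hU] := IH n (ltnSn n); have [hA hB hD] := means_step IH.
by have [] := storm_means hE hU hA hB.
Qed.

Lemma mean_potential_sum N :
  \sum_(n < N) eta_ n * (ca * mean (qA n) + cd * mean (qD n) + cb * mean (qB n)) <=
  C0 + \sum_(n < N) eta_ n * (2 * gamma * mean (qE n) + cu * mean (qU n)).
Proof.
have hr : has_mean P
    (fun w => C0 + \sum_(n < N) eta_ n * (2 * gamma * qE n w + cu * qU n w))
    (C0 + \sum_(n < N) eta_ n * (2 * gamma * mean (qE n) + cu * mean (qU n))).
  by apply: has_mean_rhs => n _; have [] := traj_means n.
apply: (has_mean_le _ hr _) => [|w].
- apply: (@has_mean_sum _ _ _ P 'I_N _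
    (fun n w => eta_ n * (ca * qA n w + cd * qD n w + cb * qB n w))) => n.
  have [_ _ hA hB hD] := traj_means n.
  apply: has_meanZ; apply: has_meanD; last exact: has_meanZ.
  by apply: has_meanD; exact: has_meanZ.
- exact: potential_sum (ltW p_gt0) lbF.
Qed.

(* [H <= eps/2 + H^2/(2 eps)] turns second moments into a bound on the mean. *)
Lemma expected_stationarity eps : 0 < eps -> (0 < T)%N ->
  \sum_(n < T) (mean (qA n) / gamma ^+ 2 + mean (qE n) + L ^+ 2 * mean (qD n)) <=
    T%:R * eps ^+ 2 / 3 ->
  ('E_P[fun w => stationarity D f X Y gamma Lf
          (accmda f X Y k m c1 c2 lambda gamma x1 y1
             (fun t i => xi t i w) (zeta w))] <= eps%:E)%E.
Proof.
move=> eps0 T0 Hsum.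
pose H n w := stationarity D f X Y gamma Lf (traj n w).
pose h n w := eps / 2 + 3 / (2 * eps) *
  (qA n w / gamma ^+ 2 + qE n w + L ^+ 2 * qD n w).
have Hh n w : H n w <= h n w.
  have -> : H n w = gamma^-1 * Num.sqrt (qA n w) + Num.sqrt (qE n w)
      + L * Num.sqrt (qD n w) by [].
  have sA : Num.sqrt (qA n w) ^+ 2 = qA n w by apply: sqr_sqrtr; exact: dot_ge0.
  have sE : Num.sqrt (qE n w) ^+ 2 = qE n w by apply: sqr_sqrtr; exact: dot_ge0.
  have sD : Num.sqrt (qD n w) ^+ 2 = qD n w by apply: sqr_sqrtr; exact: dot_ge0.
  rewrite /h; move: (Num.sqrt (qA n w)) (Num.sqrt (qE n w)) (Num.sqrt (qD n w)) sA sE sD.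
  move=> a e' d' <- <- <-.
  rewrite -expr_div_n -exprMn [gamma^-1 * a]mulrC.
  move: (a / gamma) (L * d') => r s.
  have e0 : eps != 0 by rewrite gt_eqF.
  (* The square of the sum of three numbers plus their squared pairwise differences is three times
     the sum of their squares. *)
  have -> : eps / 2 + 3 / (2 * eps) * (r ^+ 2 + e' ^+ 2 + s ^+ 2) = r + e' + s +
     ((eps - (r + e' + s)) ^+ 2 + (r - e') ^+ 2 + (r - s) ^+ 2 + (e' - s) ^+ 2) / (2 * eps).
    by field.
  by rewrite lerDl divr_ge0 ?mulr_ge0 ?addr_ge0 ?sqr_ge0// ltW.
have H0 n w : 0 <= H n w.
  have i0 : 0 <= gamma^-1 by rewrite invr_ge0 ltW.
  by rewrite !addr_ge0 ?mulr_ge0 ?enorm_ge0// ltW.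
have mH n : measurable_fun setT (H n : past (drawn n.+1) -> R).
  have -> : H n = (fun w => gamma^-1 * Num.sqrt (qA n w) + Num.sqrt (qE n w)
      + L * Num.sqrt (qD n w)) by [].
  apply: measurable_funD; first apply: measurable_funD.
  - by apply: measurable_funM => //; apply: measurable_sqrt_comp; exact: measurable_qA.
  - by apply: measurable_sqrt_comp; exact: measurable_qE.
  - by apply: measurable_funM => //; apply: measurable_sqrt_comp; exact: measurable_qD.
pose mh n := eps / 2 + 3 / (2 * eps) *
  (mean (qA n) / gamma ^+ 2 + mean (qE n) + L ^+ 2 * mean (qD n)).
have HHh n : (\int[P]_w (H n w)%:E <= (mh n)%:E)%E.
  have [hE _ hA _ hD] := traj_means n.
  have hh : has_mean P (h n) (mh n).
    apply: has_meanD; first exact: has_mean_cst.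
    apply: has_meanZ; apply: has_meanD; last exact: has_meanZ.
    by apply: has_meanD => //; exact: has_meanZr.
  have [_ <-] := hh; apply: ge0_le_integral => //.
  - by move=> w _; rewrite lee_fin.
  - apply/measurable_EFinP.
    exact: (measurable_past_ambient sample_family_measurable (mH n)).
  - by apply/measurable_EFinP; exact: has_mean_measurable hh.
  - by move=> w _; rewrite lee_fin.
(* The output time is independent of the samples, so its indicator integrates to [1 / T] given the
   past. *)
have Hind n : (n < T)%N ->
    (\int[P]_w (H n w * \1_[set n.+1] (zeta w))%:E =
     T%:R^-1%:E * \int[P]_w (H n w)%:E)%E.
  move=> nT; pose Psi (wt : past (drawn n.+1) * nat) :=
    (H n wt.1 * \1_[set n.+1] wt.2)%:E.
  have mPsi : measurable_fun setT Psi.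
    apply/measurable_EFinP; apply: measurable_funM.
      exact: (measurableT_comp (mH n) measurable_fst).
    apply: (@measurableT_comp _ _ _ _ _ _ (\1_[set n.+1] : nat -> R) setT
      (fun wt : past (drawn n.+1) * nat => wt.2)) => //; exact: measurable_snd.
  have Psi0 z : (0 <= Psi z)%E by rewrite /Psi lee_fin mulr_ge0.
  have -> := past_fubini sample_indep sample_family_setT sample_family_setI
    sample_family_measurable (drawn_uniq n.+1) (drawn_zeta n.+1)
    (@subset_refl _ (sigma_of zeta)) (fun _ _ => erefl) mPsi Psi0.
  rewrite -ge0_integralZl_EFin//; first last.
  - apply/measurable_EFinP.
    exact: (measurable_past_ambient sample_family_measurable (mH n)).
  - by move=> w _; rewrite lee_fin.
  apply: eq_integral => w _; under eq_integral do rewrite /Psi/= EFinM.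
  rewrite ge0_integralZl_EFin//.
  rewrite integral_indic// setIT.
  have zP : distribution P zeta [set n.+1] = (T%:R^-1)%:E.
    by have [_ + _] := smp; apply; rewrite /= nT.
  exact: (etrans (congr1 (fun x => ((H n w)%:E * x)%E) zP) (muleC _ _)).
(* [zeta] counts from 1 and [traj] from 0. The dummy state of time 0 equals that of time 1, so the
   predecessor is right even where [zeta] is 0. *)
have -> : 'E_P[fun w => stationarity D f X Y gamma Lf
    (accmda f X Y k m c1 c2 lambda gamma x1 y1 (fun t i => xi t i w) (zeta w))]%E =
    (\int[P]_w (H (zeta w).-1 w)%:E)%E.
  rewrite unlock; apply: eq_integral => w _; congr (stationarity _ _ _ _ _ _ _)%:E.
  by case: (zeta w).
rewrite (integral_random_index T0 _ (H := fun t => H t.-1)) //; first last.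
- by move=> t; exact: (measurable_past_ambient sample_family_measurable (mH t.-1)).
- by have [] := smp.
apply: (@le_trans _ _ (\sum_(n < T) (T%:R^-1 * mh n)%:E)%E).
  apply: lee_sum => n _; rewrite Hind//=.
  apply: (@le_trans _ _ ((T%:R^-1)%:E * (mh n)%:E)%E); last by [].
  apply: lee_pmul => //.
  by apply: integral_ge0 => w _; rewrite lee_fin.
rewrite sumEFin lee_fin -mulr_sumr big_split/= sumr_const card_ord -mulr_sumr.
have Tn : 0 < T%:R :> R by rewrite ltr0n.
rewrite -ler_pdivlMl ?invr_gt0// invrK -[_ *+ T]mulr_natl.
apply: (@le_trans _ _ (T%:R * (eps / 2) + 3 / (2 * eps) * (T%:R * eps ^+ 2 / 3))).
  by rewrite lerD2l; apply: ler_wpM2l => //; rewrite divr_ge0// ltW// mulr_gt0.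
rewrite le_eqVlt; apply/orP; left; apply/eqP; field.
by rewrite gt_eqF.
Qed.

End Means.

(** Fixes the weight [p] and feeds the means into [lyapunov_sum]. A lower bound [hT] on the steps
    removes the step weights from the sum. *)
Lemma stationarity_rate (Fst hT eps : R) :
  let p := 16 * gamma * L ^+ 2 / (lambda * tau) in
  let W := gamma * (3 + 80 * kap ^+ 2) in
  c2 = c1 -> 2 <= c1 ->
  (forall t, 0 < Defs.eta k m t) ->
  (forall t, (Defs.eta k m t.+1)^-1 <= (Defs.eta k m t)^-1 + Defs.eta k m t.+1) ->
  32 * L * kap * gamma <= lambda * tau ->
  256 * gamma ^+ 2 * (3 + 80 * kap ^+ 2) * L ^+ 2 <= c1 * b%:R ->
  32 * (3 + 80 * kap ^+ 2) * (lambda * tau) <= 12 * c1 * b%:R ->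
  (forall x, X x -> Fst <= fm x (ys x)) ->
  0 < eps -> (0 < T)%N -> 0 < hT ->
  (forall n, (n < T)%N -> hT <= Defs.eta k m n.+1) ->
  4 / gamma * (fm x1 (ys x1) - Fst + p * dot (y1 - ys x1) (y1 - ys x1) +
     2 * W / c1 * (2 * delta ^+ 2 / b%:R / Defs.eta k m 0 +
       4 * c1 ^+ 2 * delta ^+ 2 / b%:R * \sum_(n < T) Defs.eta k m n.+1 ^+ 3))
    <= hT * (T%:R * eps ^+ 2 / 3) ->
  ('E_P[fun w => stationarity D f X Y gamma Lf
          (accmda f X Y k m c1 c2 lambda gamma x1 y1
             (fun t i => xi t i w) (zeta w))] <= eps%:E)%E.
Proof.
move: (tau_gt0) (Lf_gt0) (lambda_gt0) (gamma_gt0) => tau0 L0 la0 ga0.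
move=> p W Ec c12 h0 hinv Hg H1 H2 lbF eps0 T0 hT0 hTle Hb.
have s0 : 0 < lambda * tau by exact: mulr_gt0.
have p0 : 0 < p by rewrite /p divr_gt0// !mulr_gt0// exprn_gt0.
have kap0 : 0 < kap by exact: divr_gt0.
have b0 : 0 < b%:R :> R by rewrite ltr0n.
have ca0 : 0 < 1 / (2 * gamma) - 8 * p * kap ^+ 2 / (lambda * tau).
  have g0 : 0 <= 32 * L * kap * gamma by apply/ltW; do 3![apply: mulr_gt0 => //].
  have sq : (32 * L * kap * gamma) ^+ 2 <= (lambda * tau) ^+ 2.
    by rewrite ler_pXn2r// nnegrE ltW.
  have -> : 8 * p * kap ^+ 2 / (lambda * tau) =
      128 * gamma * L ^+ 2 * kap ^+ 2 / (lambda * tau) ^+ 2.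
    by rewrite /p; field; rewrite !gt_eqF.
  rewrite subr_gt0 ltr_pdivrMr ?exprn_gt0// [ltRHS]mulrAC ltr_pdivlMr ?mulr_gt0//.
  have : 0 < (lambda * tau) ^+ 2 by rewrite exprn_gt0.
  lra.
have cd0 : 0 < p * (lambda * tau) / 4 - 2 * gamma * L ^+ 2.
  have -> : p * (lambda * tau) / 4 - 2 * gamma * L ^+ 2 = 2 * gamma * L ^+ 2.
    by rewrite /p; field; rewrite !gt_eqF.
  by rewrite !mulr_gt0// exprn_gt0.
have tm := traj_means p0 ca0 cd0 lbF.
have pos n : [/\ 0 <= mean (qA n), 0 <= mean (qB n), 0 <= mean (qD n),
                 0 <= mean (qE n) & 0 <= mean (qU n)].
  have [hE hU hA hB hD] := tm n.
  by split; [apply: has_mean_ge0 hA|apply: has_mean_ge0 hB|apply: has_mean_ge0 hD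
            |apply: has_mean_ge0 hE|apply: has_mean_ge0 hU] => w; exact: dot_ge0.
apply: (expected_stationarity p0 ca0 cd0 lbF eps0 T0).
have := @lyapunov_sum R (Defs.eta k m) (fun n => mean (qA n)) (fun n => mean (qB n))
  (fun n => mean (qD n)) (fun n => mean (qE n)) (fun n => mean (qU n))
  L tau lambda gamma c1 delta b%:R
  (fm x1 (ys x1) - Fst + p * dot (y1 - ys x1) (y1 - ys x1)) T
  L0 tau0 la0 ga0 c12 b0 h0 hinv pos Hg H1 H2.
have init : mean (qE 0) + mean (qU 0) <= 2 * delta ^+ 2 / b%:R.
  have [_ e0 _ u0] := initial_means.
  have -> : 2 * delta ^+ 2 / b%:R = delta ^+ 2 / b%:R + delta ^+ 2 / b%:R.
    by field; rewrite gt_eqF.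
  exact: lerD.
have storm n : mean (qE n.+1) + mean (qU n.+1) <=
    (1 - c1 * Defs.eta k m n.+1 ^+ 2) * (mean (qE n) + mean (qU n)) +
    (4 * (c1 * Defs.eta k m n.+1 ^+ 2) ^+ 2 * delta ^+ 2 +
        16 * L ^+ 2 * (Defs.eta k m n.+1 ^+ 2 * (mean (qA n) + mean (qB n)))) / b%:R.
  have [hE hU hA hB hD] := tm n.
  have [_ _ sE sU] := storm_means hE hU hA hB.
  apply: le_trans (lerD sE sU) _; rewrite Ec.
  by rewrite le_eqVlt; apply/orP; left; apply/eqP; field; rewrite gt_eqF.
move=> /(_ init storm (mean_potential_sum p0 ca0 cd0 lbF T)) H.
rewrite -(ler_pM2l hT0); apply: le_trans Hb; apply: le_trans H.
rewrite mulr_sumr; apply: ler_sum => n _.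
apply: ler_wpM2r; last exact: hTle.
have [A0 B0 D0 E0 U0] := pos n.
apply: addr_ge0; last by apply: mulr_ge0 => //; exact: sqr_ge0.
by apply: addr_ge0 => //; apply: divr_ge0 => //; exact: sqr_ge0.
Qed.

End Trajectory.

(** * Choice of the step parameters *)

(* Every [kap]-dependence of the Lyapunov bound is dominated by [kap ^+ 3 / b]. *)
Lemma lyapunov_constant {R : realType} (L t0 c' c mu delta Delta rho tau b l S C0 : R) :
  let kap := L / tau in
  let lambda := c' * b * tau in
  let gamma := c' * b * tau ^+ 3 / (32 * L ^+ 2) in
  let p := 16 * gamma * L ^+ 2 / (lambda * tau) in
  let W := gamma * (3 + 80 * kap ^+ 2) in
  let K := 128 * `|Delta| / (c' * L) + 64 * rho ^+ 2 * t0 / (c' * L) +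
    8 / c * ((3 * t0 ^+ 2 + 80 * L ^+ 2) * t0 / L ^+ 3) *
      (delta ^+ 2 * (2 * mu + 4 * c ^+ 2)) in
  0 < L -> 0 < tau -> tau <= t0 -> 0 < b -> 0 < c' -> 0 < c -> 0 <= mu ->
  0 <= S -> S <= l -> C0 <= `|Delta| + p * rho ^+ 2 ->
  4 / gamma * (C0 + 2 * W / c * (2 * delta ^+ 2 / b * mu +
     4 * c ^+ 2 * delta ^+ 2 / b * S)) <= K * (kap ^+ 3 / b) * (1 + l).
Proof.
move=> kap lambda gamma p W K L0 tau0 tt b0 c'0 c0 mu0 S0 Sl C0le.
have ga0 : 0 < gamma by rewrite divr_gt0// !mulr_gt0// exprn_gt0.
have t00 : 0 < t0 by lra.
pose Q := kap ^+ 3 / b.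
have Q0 : 0 < Q by rewrite divr_gt0// exprn_gt0// divr_gt0.
have l0 : 0 <= l by lra.
have d0 : 0 <= delta ^+ 2 by exact: sqr_ge0.
have r0 : 0 <= rho ^+ 2 by exact: sqr_ge0.
have c20 : 0 <= c ^+ 2 by exact: sqr_ge0.
have cL : 0 < c' * L by exact: mulr_gt0.
have wc : 0 <= 2 * W / c.
  rewrite divr_ge0 ?(ltW c0)// mulr_ge0// mulr_ge0 ?(ltW ga0)// addr_ge0//.
  by rewrite mulr_ge0// sqr_ge0.
have db : 0 <= delta ^+ 2 / b by rewrite divr_ge0// ltW.
pose N := delta ^+ 2 / b * ((2 * mu + 4 * c ^+ 2) * (1 + l)).
have HN : 2 * delta ^+ 2 / b * mu + 4 * c ^+ 2 * delta ^+ 2 / b * S <= N.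
  have -> : 2 * delta ^+ 2 / b * mu + 4 * c ^+ 2 * delta ^+ 2 / b * S =
     delta ^+ 2 / b * (2 * mu + 4 * c ^+ 2 * S) by field; rewrite gt_eqF.
  apply: ler_wpM2l => //.
  have : 0 <= mu * l by exact: mulr_ge0.
  have : c ^+ 2 * S <= c ^+ 2 * l by exact: ler_wpM2l.
  lra.
apply: (@le_trans _ _ (4 / gamma * (`|Delta| + p * rho ^+ 2 + 2 * W / c * N))).
  apply: ler_wpM2l; first by rewrite divr_ge0// ltW.
  by apply: lerD => //; exact: ler_wpM2l.
(* With these parameters [p] equals [tau / 2] and [4 / gamma] equals [128 / (c' * L) * Q]; in the
   noise term [(3 + 80 * kap ^+ 2) / b] is [Q] times a quantity that vanishes with [tau]. The
   surplus powers of [tau] are bounded by those of [t0] below. *)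
have -> : 4 / gamma * (`|Delta| + p * rho ^+ 2 + 2 * W / c * N) =
  128 * `|Delta| / (c' * L) * Q + 64 * rho ^+ 2 * tau / (c' * L) * Q
  + 8 / c * ((3 * tau ^+ 2 + 80 * L ^+ 2) * tau / L ^+ 3) *
      (delta ^+ 2 * (2 * mu + 4 * c ^+ 2)) * (Q * (1 + l)).
  rewrite /N /W /p /Q /gamma /lambda /kap; field.
  by rewrite !gt_eqF.
have e1 : 0 <= 128 * `|Delta| / (c' * L) * Q.
  by rewrite mulr_ge0 ?(ltW Q0)// divr_ge0 ?(ltW cL)// mulr_ge0.
have e2 : 64 * rho ^+ 2 * tau / (c' * L) * Q <= 64 * rho ^+ 2 * t0 / (c' * L) * Q.
  rewrite ler_wpM2r ?(ltW Q0)// ler_wpM2r ?invr_ge0 ?(ltW cL)//.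
  by rewrite ler_wpM2l// mulr_ge0.
have e2' : 0 <= 64 * rho ^+ 2 * t0 / (c' * L) * Q.
  by rewrite mulr_ge0 ?(ltW Q0)// divr_ge0 ?(ltW cL)// mulr_ge0 ?(ltW t00)// mulr_ge0.
pose M := delta ^+ 2 * (2 * mu + 4 * c ^+ 2).
have M0 : 0 <= M by rewrite mulr_ge0// addr_ge0// mulr_ge0.
have e3 : 8 / c * ((3 * tau ^+ 2 + 80 * L ^+ 2) * tau / L ^+ 3) * M * (Q * (1 + l))
   <= 8 / c * ((3 * t0 ^+ 2 + 80 * L ^+ 2) * t0 / L ^+ 3) * M * (Q * (1 + l)).
  apply: ler_wpM2r; first by rewrite mulr_ge0 ?(ltW Q0)//; lra.
  apply: ler_wpM2r => //; apply: ler_wpM2l; first by rewrite divr_ge0// ltW.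
  apply: ler_wpM2r; first by rewrite invr_ge0 exprn_ge0// ltW.
  have tt2 : tau ^+ 2 <= t0 ^+ 2 by rewrite ler_pXn2r// nnegrE ltW.
  apply: ler_pM => //; [|exact: ltW|lra].
  by have := sqr_ge0 tau; have := sqr_ge0 L; lra.
have e1' := mulr_ge0 e1 l0; have e2'' := mulr_ge0 e2' l0.
rewrite -/M /K -/M -/Q; lra.
Qed.

(** Since [b] times kappa^3 / b is kappa^3, only the square root still involves [b], and there the
    lower bound on the batch gives the exponent [3 + (3 - nu) / 2]. *)
Lemma batch_horizon {R : realType} (kappa nu blo b : R) :
  0 < kappa -> 0 < blo -> 0 < b -> blo * kappa `^ nu <= b ->
  b * (kappa ^+ 3 / b * Num.sqrt (kappa ^+ 3 / b))
    <= kappa `^ (9 / 2 - nu / 2) / Num.sqrt blo.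
Proof.
move=> k0 blo0 b0 hb.
have kn0 : 0 < kappa `^ nu by exact: powR_gt0.
have k3E : kappa `^ 3 = kappa ^+ 3 by rewrite powR_mulrn// ltW.
have neq : (kappa != 0) by rewrite gt_eqF.
have Q1 : kappa ^+ 3 / b <= kappa `^ (3 - nu) / blo.
  rewrite powRB; last by rewrite neq implybT.
  rewrite k3E -mulrA -invfM ler_wpM2l ?exprn_ge0 ?(ltW k0)// lef_pV2 ?posrE//.
    by rewrite mulrC.
  exact: mulr_gt0.
rewrite mulrA [b * _]mulrC divfK ?gt_eqF//.
have -> : 9 / 2 - nu / 2 = 3 + (3 - nu) / 2 by field.
rewrite powRD ?neq ?implybT// k3E -mulrA.
rewrite ler_wpM2l ?exprn_ge0 ?(ltW k0)//.
apply: le_trans (ler_wsqrtr Q1) _.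
rewrite sqrtrM ?powR_ge0// sqrtrV ?(ltW blo0)//.
by rewrite -powR12_sqrt ?powR_ge0// -powRrM.
Qed.

(** [t0] is the bound on [b * tau] contained in the batch condition. The constants [c'], [c] and
    [mu] depend on [L] and [t0] alone; [mu] is the cube root of [m], and [c] serves as both momentum
    constants. *)
Section StepParameters.
Context {R : realType} (L t0 c' c mu : R).
Hypotheses (L_gt0 : 0 < L) (t0_gt0 : 0 < t0) (Lt0 : L * t0 = 8 / 81).
Hypotheses (c'_gt0 : 0 < c') (c'_le1 : c' <= 1).
Hypotheses (c'6 : c' * t0 ^+ 2 <= 1 / 6) (c'L : c' * t0 ^+ 2 <= L).
Hypothesis c_ge : 3 + 3 * (t0 ^+ 2 / L ^+ 2) + 12 * t0 ^+ 2 + 280 * L ^+ 2 <= c.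
Hypothesis mu_ge : c + t0 / L + 1 <= mu.

Lemma c_ge3 : 3 <= c.
Proof.
move: (c_ge) => h; have : 0 <= t0 ^+ 2 / L ^+ 2 by rewrite divr_ge0 ?sqr_ge0.
have := sqr_ge0 t0; have := sqr_ge0 L; lra.
Qed.

Lemma mu_ge4 : 4 <= mu.
Proof.
move: (mu_ge) => h; have := c_ge3; have : 0 < t0 / L by rewrite divr_gt0.
lra.
Qed.

Lemma c_le_mu : c <= mu.
Proof. move: (mu_ge) => h; have : 0 < t0 / L by rewrite divr_gt0. lra. Qed.

Lemma mu_root : (mu ^+ 3) `^ 3^-1 = mu.
Proof.
have mu0 : 0 <= mu by have := mu_ge4; lra.
by rewrite -powR_mulrn// -powRrM mulfV// powRr1.
Qed.

Lemma mu3_ge1 : 1 <= mu ^+ 3.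
Proof. by rewrite exprn_ege1//; have := mu_ge4; lra. Qed.

Lemma eta_le_muV t : Defs.eta 1 (mu ^+ 3) t <= mu^-1.
Proof.
have m4 := mu_ge4; have m1 := mu3_ge1; have mu0 : 0 < mu by lra.
rewrite eta_inv lef_pV2 ?posrE//; last exact: lt_le_trans (root_ge1 m1 t).
rewrite -[X in X <= _]mu_root; apply: ge0_ler_powR; rewrite ?nnegrE ?lerDl//.
  by lra.
by rewrite addr_ge0//; lra.
Qed.

Lemma eta_le1 t : Defs.eta 1 (mu ^+ 3) t <= 1.
Proof.
have m4 := mu_ge4; have mu0 : 0 < mu by lra.
by apply: le_trans (eta_le_muV t) _; rewrite invf_le1//; lra.
Qed.

Lemma momentum_ge0 t : 0 <= c * Defs.eta 1 (mu ^+ 3) t ^+ 2.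
Proof. by have := c_ge3 => c3; rewrite mulr_ge0 ?sqr_ge0//; lra. Qed.

Lemma momentum_le1 t : c * Defs.eta 1 (mu ^+ 3) t ^+ 2 <= 1.
Proof.
have c3 := c_ge3; have m4 := mu_ge4; have mu0 : 0 < mu by lra.
have c0 : 0 <= c by lra.
have e0 : 0 <= Defs.eta 1 (mu ^+ 3) t by apply/ltW/eta_pos/mu3_ge1.
rewrite expr2 mulrA; apply: (@le_trans _ _ (1 * 1)); last by rewrite mulr1.
apply: ler_pM => //; [exact: mulr_ge0| |exact: eta_le1].
apply: (@le_trans _ _ (mu * mu^-1)); last by rewrite mulfV// gt_eqF.
by apply: ler_pM => //; [exact: c_le_mu|exact: eta_le_muV].
Qed.

Section Problem.
Context (tau b : R).
Hypotheses (tau_gt0 : 0 < tau) (b_ge1 : 1 <= b) (b_tau : b * tau <= t0).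

Local Notation kappa := (L / tau).
Local Notation Lg := (L + L ^+ 2 / tau).
Local Notation lambda := (c' * b * tau).
Local Notation gamma := (c' * b * tau ^+ 3 / (32 * L ^+ 2)).
Local Notation s := (lambda * tau).

Let b_gt0 : 0 < b. Proof. exact: lt_le_trans b_ge1. Qed.

Let tau_t0 : tau <= t0.
Proof. by apply: le_trans b_tau; rewrite ler_peMl// ltW. Qed.

Let lambda_gt0 : 0 < lambda. Proof. by rewrite !mulr_gt0. Qed.

Let gamma_gt0 : 0 < gamma.
Proof. by rewrite divr_gt0 ?mulr_gt0// exprn_gt0. Qed.

Let s_gt0 : 0 < s. Proof. by rewrite mulr_gt0. Qed.

Let kappa_gt0 : 0 < kappa. Proof. exact: divr_gt0. Qed.

(** So [gamma] is the largest value compatible with [gamma_kappa]. *)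
Lemma gammaE : gamma = s / (32 * L * kappa).
Proof. by field; rewrite !gt_eqF. Qed.

Let tau2 : tau ^+ 2 <= t0 ^+ 2.
Proof. by rewrite ler_pXn2r// nnegrE ltW. Qed.

Let s_t0 : s <= c' * t0 ^+ 2.
Proof.
rewrite -!mulrA; apply: ler_wpM2l; first exact: ltW.
rewrite mulrA expr2; apply: ler_pM => //; [|exact: ltW].
by rewrite mulr_ge0// ltW.
Qed.

Lemma s_le : s <= 1 / 6.
Proof. exact: le_trans s_t0 c'6. Qed.

Lemma lambdaL_le : lambda * L <= 1 / 6.
Proof.
have : c' * (b * tau * L) <= 1 * (b * tau * L).
  by rewrite ler_wpM2r// !mulr_ge0// ltW.
have : b * tau * L <= t0 * L by rewrite ler_wpM2r// ltW.
move: (Lt0); lra.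
Qed.

Lemma gammaLg : 2 * (Lg * gamma) <= mu.
Proof.
have -> : Lg * gamma = s * (tau / L + 1) / 32 by field; rewrite !gt_eqF.
have h1 : tau / L <= t0 / L by rewrite ler_wpM2r// invr_ge0 ltW.
have : s * (tau / L + 1) <= 1 / 6 * (tau / L + 1).
  by rewrite ler_wpM2r ?s_le// addr_ge0// divr_ge0// ltW.
have : 0 < tau / L by rewrite divr_gt0.
move: (mu_ge) (c_ge3) h1; move: (s * (tau / L + 1)) (tau / L) (t0 / L) => z u v; lra.
Qed.

Lemma step_gamma t : Lg * Defs.eta 1 (mu ^+ 3) t * gamma <= 1 / 2.
Proof.
have mu0 : 0 < mu by have := mu_ge4; lra.
have -> : Lg * Defs.eta 1 (mu ^+ 3) t * gamma =
   2 * (Lg * gamma) * Defs.eta 1 (mu ^+ 3) t / 2 by field; rewrite !gt_eqF.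
rewrite ler_wpM2r//; apply: (@le_trans _ _ (mu * mu^-1)); last first.
  by rewrite mulfV// gt_eqF.
apply: ler_pM; [|exact/ltW/eta_pos/mu3_ge1|exact: gammaLg|exact: eta_le_muV].
apply: mulr_ge0 => //; apply: mulr_ge0; last exact: ltW.
by rewrite addr_ge0 ?divr_ge0 ?sqr_ge0// ltW.
Qed.

Lemma admissible_momentum :
  [/\ 2 / (3 * 1 ^+ 3) + 9 * tau ^+ 2 / 4 <= c,
      2 / (3 * 1 ^+ 3) + 75 * L ^+ 2 / 2 <= c &
      Num.max (Num.max 2 (1 ^+ 3)) (Num.max ((c * 1) ^+ 3) ((c * 1) ^+ 3))
        <= mu ^+ 3].
Proof.
have q0 : 0 <= t0 ^+ 2 / L ^+ 2 by rewrite divr_ge0 ?sqr_ge0.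
move: (c_ge) (tau2) (sqr_ge0 L) (sqr_ge0 t0) => h1 h2 h3 h4.
have c3 := c_ge3; have m4 := mu_ge4; rewrite expr1n !mulr1.
split; [by lra|by lra|].
rewrite !ge_max mu3_ge1.
have -> : c ^+ 3 <= mu ^+ 3 by rewrite lerXn2r ?nnegrE ?c_le_mu//; lra.
rewrite !andbT; apply: (@le_trans _ _ (4 ^+ 3)); first by lra.
by rewrite lerXn2r ?nnegrE//; lra.
Qed.

Lemma admissible_steps :
  [/\ 0 < lambda,
      lambda <= Num.min (1 / (6 * L)) (27 * b * tau / 16),
      0 < gamma &
      gamma <= Num.min
        (lambda * tau / (2 * L) *
           Num.sqrt (2 * b / (8 * lambda ^+ 2 + 75 * kappa ^+ 2 * b)))
        ((mu ^+ 3) `^ (3^-1) / (2 * Lg * 1))].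
Proof.
split; [exact: lambda_gt0| |exact: gamma_gt0|].
- rewrite le_min; apply/andP; split.
    by rewrite ler_pdivlMr ?mulr_gt0//; have := lambdaL_le; lra.
  have : c' * (b * tau) <= 1 * (b * tau) by rewrite ler_wpM2r// mulr_ge0// ltW.
  have : 0 < b * tau by rewrite mulr_gt0.
  lra.
rewrite le_min; apply/andP; split; last first.
  have Lg0 : 0 < Lg by rewrite addr_gt0// divr_gt0// exprn_gt0.
  rewrite mu_root mulr1 ler_pdivlMr ?mulr_gt0//; have := gammaLg.
  by rewrite mulrA [_ * gamma]mulrC.
have la2 : lambda ^+ 2 <= kappa ^+ 2 * b.
  have -> : lambda ^+ 2 = s * (c' * tau ^+ 2) * (b / tau ^+ 2).
    by field; rewrite gt_eqF.
  have -> : kappa ^+ 2 * b = L * L * (b / tau ^+ 2) by field; rewrite gt_eqF.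
  apply: ler_wpM2r; first by rewrite divr_ge0 ?sqr_ge0// ltW.
  apply: ler_pM; [exact: ltW| |exact: le_trans s_t0 c'L|].
    by rewrite mulr_ge0 ?sqr_ge0// ltW.
  by apply: le_trans c'L; rewrite ler_pM2l.
have kb : 0 < kappa ^+ 2 * b by rewrite mulr_gt0// exprn_gt0.
have k10 : 0 < 10 * kappa by rewrite mulr_gt0.
(* By [la2] the denominator is at most [83 * kappa ^+ 2 * b], and 2/83 exceeds 1/100. *)
have sq : (10 * kappa)^-1 <=
    Num.sqrt (2 * b / (8 * lambda ^+ 2 + 75 * kappa ^+ 2 * b)).
  have i0 : 0 <= (10 * kappa)^-1 by rewrite invr_ge0 ltW.
  rewrite -(ger0_norm i0) -sqrtr_sqr ler_wsqrtr// exprVn.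
  move: la2 kb (sqr_ge0 lambda) k10 (b_gt0).
  move: (lambda ^+ 2) (kappa) => l2 k la2 kb l20 k10 b0.
  have k2 : 0 < k ^+ 2 by rewrite -(pmulr_lgt0 _ b0).
  rewrite ler_pdivlMr; last by lra.
  by rewrite ler_pdivrMl ?exprn_gt0//; lra.
apply: (@le_trans _ _ (s / (2 * L) * (10 * kappa)^-1)); last first.
  apply: ler_wpM2l => //; apply: divr_ge0; first exact: ltW.
  by apply: mulr_ge0; last exact: ltW.
have -> : s / (2 * L) * (10 * kappa)^-1 = s / (20 * L * kappa).
  by field; rewrite !gt_eqF.
rewrite gammaE ler_wpM2l ?(ltW s_gt0)//.
have : 0 < L * kappa by rewrite mulr_gt0.
rewrite -!(mulrA _ L); move: (L * kappa) => z z0.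
by rewrite lef_pV2 ?posrE ?mulr_gt0//; lra.
Qed.

Let kap2 : (3 + 80 * kappa ^+ 2) * tau ^+ 2 <= 3 * t0 ^+ 2 + 80 * L ^+ 2.
Proof.
have -> : (3 + 80 * kappa ^+ 2) * tau ^+ 2 = 3 * tau ^+ 2 + 80 * L ^+ 2.
  by field; rewrite gt_eqF.
move: (tau2); lra.
Qed.

Lemma gamma_kappa : 32 * L * kappa * gamma <= s.
Proof. by rewrite le_eqVlt; apply/orP; left; apply/eqP; field; rewrite !gt_eqF. Qed.

Lemma gamma_momentum :
  256 * gamma ^+ 2 * (3 + 80 * kappa ^+ 2) * L ^+ 2 <= c * b.
Proof.
have -> : 256 * gamma ^+ 2 * (3 + 80 * kappa ^+ 2) * L ^+ 2 =
    s ^+ 2 / 4 * (3 * (tau ^+ 2 / L ^+ 2) + 80) by field; rewrite !gt_eqF.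
have s2 : s ^+ 2 <= 1 / 6 * (1 / 6).
  by rewrite expr2; apply: ler_pM => //; [exact: ltW|exact: ltW|exact: s_le|exact: s_le].
have tL : tau ^+ 2 / L ^+ 2 <= t0 ^+ 2 / L ^+ 2.
  by rewrite ler_wpM2r// invr_ge0 sqr_ge0.
have tL0 : 0 <= tau ^+ 2 / L ^+ 2 by rewrite divr_ge0 ?sqr_ge0.
apply: (@le_trans _ _ c); last first.
  by rewrite ler_peMr//; have := c_ge3; lra.
move: (sqr_ge0 L) (sqr_ge0 t0) (c_ge) tL tL0.
move: (tau ^+ 2 / L ^+ 2) (t0 ^+ 2 / L ^+ 2) => u v L2 t2 ch uv u0.
apply: (@le_trans _ _ (1 / 6 * (1 / 6) / 4 * (3 * u + 80))); last by lra.
by apply: ler_wpM2r; [lra|apply: ler_wpM2r].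
Qed.

(** The factor [tau ^+ 2] hidden in [s] compensates [kappa ^+ 2], so a constant [c] suffices; this
    is the main reason for the terms [12 * t0 ^+ 2] and [280 * L ^+ 2] in [c_ge]. *)
Lemma lambda_momentum : 32 * (3 + 80 * kappa ^+ 2) * s <= 12 * c * b.
Proof.
have -> : 32 * (3 + 80 * kappa ^+ 2) * s =
  32 * b * (c' * ((3 + 80 * kappa ^+ 2) * tau ^+ 2)) by ring.
have -> : 12 * c * b = 32 * b * (3 / 8 * c) by field.
apply: ler_wpM2l; first by rewrite mulr_ge0// ltW.
have q0 : 0 <= t0 ^+ 2 / L ^+ 2 by rewrite divr_ge0 ?sqr_ge0.
have h : c' * ((3 + 80 * kappa ^+ 2) * tau ^+ 2) <= 1 * (3 * t0 ^+ 2 + 80 * L ^+ 2).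
  apply: ler_pM => //; first exact: ltW.
  by rewrite mulr_ge0 ?sqr_ge0// addr_ge0// mulr_ge0// sqr_ge0.
by apply: le_trans h _; move: (c_ge) (sqr_ge0 L) (sqr_ge0 t0); lra.
Qed.

End Problem.

End StepParameters.

Theorem corollary11 (R : realType)
  (* quantities treated as constants by the O-notation *)
  (Lf delta Delta rho nu blo bhi : R)
  (Lf_gt0 : 0 < Lf) (delta_gt0 : 0 < delta) (nu_gt0 : 0 < nu)
  (blo_gt0 : 0 < blo) (bhi_gt0 : 0 < bhi) :
  exists (C : R) (p : nat), 0 < C /\
  forall (tau : R) (b : nat),
  let kappa := Lf / tau in
  let Lg := Lf + Lf ^+ 2 / tau in
  0 < tau -> (1 <= b)%N ->
  blo * kappa `^ nu <= b%:R -> b%:R <= bhi * kappa `^ nu ->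
  27 * b%:R * tau / 16 <= 1 / (6 * Lf) ->
  exists k m c1 c2 lambda gamma : R,
  [/\ 0 < k,
      2 / (3 * k ^+ 3) + 9 * tau ^+ 2 / 4 <= c1,
      2 / (3 * k ^+ 3) + 75 * Lf ^+ 2 / 2 <= c2 &
      Num.max (Num.max 2 (k ^+ 3)) (Num.max ((c1 * k) ^+ 3) ((c2 * k) ^+ 3))
        <= m] /\
  [/\ 0 < lambda,
      lambda <= Num.min (1 / (6 * Lf)) (27 * b%:R * tau / 16),
      0 < gamma &
      gamma <= Num.min
        (lambda * tau / (2 * Lf) *
           Num.sqrt (2 * b%:R / (8 * lambda ^+ 2 + 75 * kappa ^+ 2 * b%:R)))
        (m `^ (3^-1) / (2 * Lg * k))] /\
  forall eps : R, 0 < eps -> eps <= 1 ->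
  exists T : nat, (1 <= T)%N /\
  4 * b%:R * T%:R <=
    C * kappa `^ (9 / 2 - nu / 2) * eps ^- 3 * (1 + ln (1 + kappa / eps)) ^+ p /\
  forall (d1 d2 : nat) (dXi : measure_display) (Xi : measurableType dXi)
    (D : probability Xi R) (f : 'rV[R]_d1 -> 'rV[R]_d2 -> Xi -> R)
    (X : set 'rV[R]_d1) (Y : set 'rV[R]_d2)
    (x1 : 'rV[R]_d1) (y1 : 'rV[R]_d2),
  compact X -> convex_set X ->
  (compact Y /\ convex_set Y) \/ Y = setT ->
  stochastic_objective D f X Y ->
  bounded_variance D f X Y delta ->
  lipschitz_gradient f X Y Lf ->
  strongly_concave D f X Y tau ->
  has_lbound (Fmax D f Y @` X) ->
  X x1 -> Y y1 ->
  Fmax D f Y x1 - Fstar D f X Y <= Delta ->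
  enorm (y1 - ystar D f Y x1) <= rho ->
  forall (dOmega : measure_display) (Omega : measurableType dOmega)
    (P : probability Omega R) (xi : nat -> 'I_b -> {RV P >-> Xi})
    (zeta : {RV P >-> nat}),
  sampling D T xi zeta ->
  ('E_P[fun w => stationarity D f X Y gamma Lf
          (accmda f X Y k m c1 c2 lambda gamma x1 y1
             (fun t i => xi t i w) (zeta w))] <= eps%:E)%E.
Proof.
pose t0 := 8 / (81 * Lf).
have t00 : 0 < t0 by rewrite divr_gt0// mulr_gt0.
have Lt0 : Lf * t0 = 8 / 81 by rewrite /t0; field; rewrite gt_eqF.
have [c' [c'0 c'1 c'6 c'L]] : exists c' : R,
    [/\ 0 < c', c' <= 1, c' * t0 ^+ 2 <= 1 / 6 & c' * t0 ^+ 2 <= Lf].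
  have t02 : 0 < t0 ^+ 2 by rewrite exprn_gt0.
  have t0L : 0 <= t0 ^+ 2 / Lf by rewrite divr_ge0 ?sqr_ge0// ltW.
  have cden : 0 < 1 + 6 * t0 ^+ 2 + t0 ^+ 2 / Lf by lra.
  exists (1 + 6 * t0 ^+ 2 + t0 ^+ 2 / Lf)^-1; split.
  - by rewrite invr_gt0.
  - by rewrite invf_le1//; lra.
  - by rewrite ler_pdivrMl//; lra.
  - rewrite ler_pdivrMl// mulrDl divfK ?gt_eqF// lerDr mulr_ge0//; lra.
(* The lower bounds themselves are taken; hiding the witnesses leaves only the inequalities. *)
have [c [mu [c_ge mu_ge]]] : exists c mu : R,
    3 + 3 * (t0 ^+ 2 / Lf ^+ 2) + 12 * t0 ^+ 2 + 280 * Lf ^+ 2 <= c /\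
    c + t0 / Lf + 1 <= mu.
  by do 2![eexists]; split.
have c3 := c_ge3 c_ge.
have m3 := mu3_ge1 Lf_gt0 t00 c_ge mu_ge.
have m4 := mu_ge4 Lf_gt0 t00 c_ge mu_ge.
have mu_gt0 : 0 < mu by lra.
have c0 : 0 < c by lra.
have c2 : 2 <= c by lra.
have m30 : 0 <= mu ^+ 3 := le_trans ler01 m3.
clearbody t0.
pose K := 128 * `|Delta| / (c' * Lf) + 64 * rho ^+ 2 * t0 / (c' * Lf) +
    8 / c * ((3 * t0 ^+ 2 + 80 * Lf ^+ 2) * t0 / Lf ^+ 3) *
      (delta ^+ 2 * (2 * mu + 4 * c ^+ 2)).
have K0 : 0 <= K.
  have cL : 0 <= c' * Lf by apply/ltW; exact: mulr_gt0.
  have r0 := sqr_ge0 rho; have d0 := sqr_ge0 delta; have cc := sqr_ge0 c.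
  have tt0 := sqr_ge0 t0; have LL0 := sqr_ge0 Lf.
  apply: addr_ge0; first apply: addr_ge0.
  - by apply: divr_ge0 => //; exact: mulr_ge0.
  - by apply: divr_ge0 => //; apply: mulr_ge0; [exact: mulr_ge0|exact: ltW].
  - apply: mulr_ge0; last by apply: mulr_ge0 => //; lra.
    apply: mulr_ge0; first by apply: divr_ge0 => //; lra.
    apply: divr_ge0; last by rewrite exprn_ge0// ltW.
    by apply: mulr_ge0; [lra|exact: ltW].
have kap00 : 0 < Lf / t0 by rewrite divr_gt0.
have [C0 [C00 horizon]] := @horizon_choice R (Lf / t0) K mu kap00 K0 (ltac:(lra)).
exists (4 * C0 / Num.sqrt blo), 3%N; split.
  by rewrite divr_gt0 ?sqrtr_gt0// mulr_gt0.
move=> tau b kappa Lg tau0 b1 blob bhib btau.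
have b1R : 1 <= b%:R :> R by rewrite ler1n.
have b0R : 0 < b%:R :> R by exact: lt_le_trans b1R.
have bt : b%:R * tau <= t0.
  have -> : t0 = 8 / (81 * Lf) by rewrite -[LHS](mulKf (x := Lf)) ?gt_eqF// Lt0; field; rewrite gt_eqF.
  rewrite ler_pdivlMr ?mulr_gt0//.
  by move: btau; rewrite ler_pdivlMr ?mulr_gt0//; clear; lra.
have tt : tau <= t0 by apply: le_trans bt; rewrite ler_peMl// ltW.
have kap_gt0 : 0 < kappa by rewrite divr_gt0.
have kap0le : Lf / t0 <= kappa by rewrite ler_pM2l// lef_pV2 ?posrE.
pose lambda := c' * b%:R * tau.
pose gamma := c' * b%:R * tau ^+ 3 / (32 * Lf ^+ 2).
(* With [m = mu ^+ 3] the initial step size is exactly [mu^-1]. *)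
exists 1, (mu ^+ 3), c, c, lambda, gamma; split; last split.
- by have [h1 h2 h3] := admissible_momentum Lf_gt0 t00 c_ge mu_ge tau0 b1R bt.
- exact: (admissible_steps Lf_gt0 t00 Lt0 c'0 c'1 c'6 c'L c_ge mu_ge tau0 b1R bt).
move=> eps e0 e1.
pose Q := kappa ^+ 3 / b%:R.
have Q1 : Q <= kappa ^+ 3 by rewrite ler_pdivrMr// ler_peMr// exprn_ge0// ltW.
(* One factor of kappa absorbs [b]: the product [b * tau], and not only [tau], is bounded by
   [t0]. *)
have Q0 : (Lf / t0) ^+ 3 <= Q.
  have -> : Q = kappa ^+ 2 * (Lf / (b%:R * tau)).
    by rewrite /Q /kappa; field; rewrite !gt_eqF.
  rewrite exprSr; apply: ler_pM; [|exact: ltW| |].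
  - by rewrite exprn_ge0// ltW.
  - by rewrite lerXn2r ?nnegrE ?(ltW kap00) ?(ltW kap_gt0).
  - by rewrite ler_pM2l// lef_pV2 ?posrE// mulr_gt0.
have [T [T1 TC TE]] := horizon kappa Q eps kap0le Q0 Q1 e0 e1.
exists T; split => //; split.
  apply: (@le_trans _ _ (4 * C0 * (b%:R * (Q * Num.sqrt Q)) *
     (eps ^- 3 * (1 + ln (1 + kappa / eps)) ^+ 3))).
    have := @ler_wpM2l _ (4 * b%:R) (mulr_ge0 (ler0n _ 4) (ltW b0R)) _ _ TC.
    move=> H; apply: le_trans H _.
    by rewrite le_eqVlt; apply/orP; left; apply/eqP; ring.
  rewrite [leRHS](_ : _ = 4 * C0 * (kappa `^ (9 / 2 - nu / 2) / Num.sqrt blo) *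
     (eps ^- 3 * (1 + ln (1 + kappa / eps)) ^+ 3)); last by ring.
  apply: ler_wpM2r.
    apply: mulr_ge0; first by rewrite invr_ge0 exprn_ge0// ltW.
    by rewrite exprn_ge0// addr_ge0// ln_ge0// lerDl divr_ge0// ltW.
  apply: ler_wpM2l; first by rewrite mulr_ge0// ltW.
  exact: batch_horizon.
move=> d1 d2 dXi Xi D f X Y x1 y1 cX cvX HY so bv lip sc lb Xx1 Yy1 FD yr.
move=> dO Omega P xi zeta smp.
have clX : closed X by apply: compact_closed => //; exact: norm_hausdorff.
have [clY cvY] : closed Y /\ convex_set Y.
  case: HY => [[cY cvY]|->].
    by split => //; apply: compact_closed => //; exact: norm_hausdorff.
  by split; [exact: closedT|].
have la0 : 0 < lambda by rewrite !mulr_gt0.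
have ga0 : 0 < gamma by rewrite divr_gt0 ?mulr_gt0// exprn_gt0.
have eta0 t : 0 < Defs.eta 1 (mu ^+ 3) t := eta_pos m3 t.
have m1 t := momentum_le1 Lf_gt0 t00 c_ge mu_ge t.
have m0 t := momentum_ge0 mu c_ge t.
(* The steps decrease, so the last one is the lower bound [hT]. *)
apply: (stationarity_rate (Fst := Fstar D f X Y) (hT := Defs.eta 1 (mu ^+ 3) T)
  so bv lip sc tau0 Lf_gt0 clX cvX clY cvY Xx1 Yy1 b1 (fun n => eta0 n.+1)
  (fun n => eta_le1 Lf_gt0 t00 c_ge mu_ge n.+1)
  (fun n => m0 n.+1) (fun n => m1 n.+1) (fun n => m0 n.+1) (fun n => m1 n.+1)
  ga0 la0 (fun n => step_gamma Lf_gt0 t00 c'0 c'6 c_ge mu_ge tau0 b1R bt n.+1)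
  (lambdaL_le Lf_gt0 Lt0 c'1 tau0 b1R bt)
  (s_le c'0 c'6 tau0 b1R bt) smp) => //.
- exact: eta_step m3.
- exact: gamma_kappa.
- exact: (gamma_momentum Lf_gt0 t00 c'0 c'6 c_ge tau0 b1R bt).
- exact: (lambda_momentum t00 c'0 c'1 c_ge tau0 b1R bt).
- by move=> x Xx; apply: ge_inf => //; exists x.
- move=> n nT; rewrite !eta_inv lef_pV2 ?posrE; last 2 first.
  - exact: lt_le_trans (root_ge1 m3 T).
  - exact: lt_le_trans (root_ge1 m3 n.+1).
  apply: ge0_ler_powR; rewrite ?nnegrE ?lerD2l ?ler_nat//.
  - exact: addr_ge0.
  - exact: addr_ge0.
have eta00 : (Defs.eta 1 (mu ^+ 3) 0)^-1 = mu.
  by rewrite eta_inv invrK addr0 (mu_root Lf_gt0 t00 c_ge mu_ge).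
rewrite eta00.
pose S := \sum_(n < T) Defs.eta 1 (mu ^+ 3) n.+1 ^+ 3.
have S0 : 0 <= S by apply: sumr_ge0 => n _; rewrite exprn_ge0// ltW.
apply: (@le_trans _ _ (K * (kappa ^+ 3 / b%:R) * (1 + ln (1 + T%:R)))).
  apply: lyapunov_constant => //; first exact: ltW.
    exact: eta_cube_sum.
  apply: lerD; first exact: le_trans FD (ler_norm _).
  apply: ler_wpM2l.
    apply: divr_ge0; last by apply: mulr_ge0; exact: ltW.
    by apply: mulr_ge0; [apply: mulr_ge0 => //; exact: ltW|exact: sqr_ge0].
  rewrite -sqr_enorm lerXn2r ?nnegrE ?enorm_ge0//.
  exact: le_trans (enorm_ge0 _) yr.
rewrite eta_inv [leRHS]mulrC ler_pdivlMr; last exact: lt_le_trans (root_ge1 m3 T).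
rewrite ler_pdivlMr// -/Q; apply: le_trans TE.
by rewrite le_eqVlt; apply/orP; left; apply/eqP; ring.
Qed.
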